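(* Let $\mathcal{A}$ be a unital simple separable C*-algebra with real rank zero, stable rank one, and strict comparison of projections, and assume that $T(\mathcal{A})$ has a finite number of extremal points. Then $\mathcal{A}$ is the linear span of its projections. Furthermore, there exist a positive integer $N\ge 1$ and a constant $V_0>0$ such that for every $a\in\mathcal{A}$ there exist an integer $n\le N$, complex numbers $\alpha_1,\dots,\alpha_n$ with $|\alpha_i|\le V_0\|a\|$ for $1\le i\le n$, and projections $p_1,\dots,p_n\in\mathcal{A}$ such that $a=\alpha_1p_1+\alpha_2p_2+\cdots+\alpha_np_n$.
   Context: For a unital C*-algebra $\mathcal{A}$, $T(\mathcal{A})$ denotes the set of tracial states of $\mathcal{A}$ (a weak*-compact convex set). For projections $p,q\in\mathcal{A}$, $p\prec q$ means that $[p]<[q]$ in the strict ordering induced by Murray-von Neumann equivalence, i.e., $p$ is Murray-von Neumann equivalent to a proper subprojection of $q$. $\mathcal{A}$ has strict comparison of projections if $T(\mathcal{A})\neq\emptyset$ and, for any projections $p,q\in\mathcal{A}$, the strict inequalities $\tau(p)<\tau(q)$ for all $\tau\in T(\mathcal{A})$ imply $p\prec q$. *)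

(* Defs.v *)
From HB Require Import structures.
From mathcomp Require Import all_boot all_order all_algebra.
From mathcomp Require Import complex.
From mathcomp Require Import boolp classical_sets functions cardinality reals.
From mathcomp Require Import topology normedtype.

Set Implicit Arguments.
Unset Strict Implicit.
Unset Printing Implicit Defensive.

Import Order.TTheory GRing.Theory Num.Theory.
Import numFieldNormedType.Exports.

Local Open Scope classical_set_scope.
Local Open Scope complex_scope.
Local Open Scope ring_scope.

(* The norm [`|a|] is valued in [R[i]], where [0 <= z] means that [z] is real
   and nonnegative.  The multiplication is part of this mixin because
   Hierarchy Builder cannot join [GRing.Algebra] with [CompleteNormedModule]
   (the two already meet in [Num.NumDomain], normed over itself); the instances
   below turn every such algebra into an [algType R[i]]. *)
HB.mixin Record isCStarAlgebra (R : realType) (A : Type)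
    of CompleteNormedModule R[i] A := {
  cstar_one : A ;
  cstar_mul : A -> A -> A ;
  cstar_mulA : associative cstar_mul ;
  cstar_mul1l : left_id cstar_one cstar_mul ;
  cstar_mul1r : right_id cstar_one cstar_mul ;
  cstar_mulDl : left_distributive cstar_mul +%R ;
  cstar_mulDr : right_distributive cstar_mul +%R ;
  cstar_one_neq0 : cstar_one != 0 ;
  cstar_scaleAl : forall (c : R[i]) (a b : A),
    c *: cstar_mul a b = cstar_mul (c *: a) b ;
  cstar_scaleAr : forall (c : R[i]) (a b : A),
    c *: cstar_mul a b = cstar_mul a (c *: b) ;
  star : A -> A ;
  starK : involutive star ;
  starD : {morph star : a b / a + b} ;
  starZ : forall (c : R[i]) (a : A), star (c *: a) = conjc c *: star a ;
  starM : forall a b : A, star (cstar_mul a b) = cstar_mul (star b) (star a) ;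
  ler_norm_cstar_mul : forall a b : A,
    `|cstar_mul a b| <= `|a| * `|b| :> R[i] ;
  norm_star_mul : forall a : A,
    `|cstar_mul (star a) a| = `|a| ^+ 2 :> R[i]
}.

#[short(type="cstarAlgType")]
HB.structure Definition CStarAlgebra (R : realType) :=
  {A of isCStarAlgebra R A & CompleteNormedModule R[i] A}.

HB.instance Definition _ (R : realType) (A : cstarAlgType R) :=
  GRing.Zmodule_isNzRing.Build (CStarAlgebra.sort A)
    (@cstar_mulA R A) (@cstar_mul1l R A) (@cstar_mul1r R A)
    (@cstar_mulDl R A) (@cstar_mulDr R A) (@cstar_one_neq0 R A).

HB.instance Definition _ (R : realType) (A : cstarAlgType R) :=
  GRing.Lmodule_isLalgebra.Build R[i] (CStarAlgebra.sort A) (@cstar_scaleAl R A).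

HB.instance Definition _ (R : realType) (A : cstarAlgType R) :=
  GRing.Lalgebra_isAlgebra.Build R[i] (CStarAlgebra.sort A) (@cstar_scaleAr R A).

Section Span.
Context {K : nzRingType} {V : lmodType K}.

Definition linear_span (S : set V) : set V :=
  [set v | exists (n : nat) (c : 'I_n -> K) (s : 'I_n -> V),
     (forall i, S (s i)) /\ v = \sum_(i < n) c i *: s i].

End Span.

Section CStar.
Context {R : realType} (A : cstarAlgType R).

Definition invertible (a : A) := exists b : A, a * b = 1 /\ b * a = 1.

Definition selfadjoint (a : A) := star a = a.

Definition projection (p : A) := selfadjoint p /\ p * p = p.

Definition two_sided_ideal (I : set A) :=
  [/\ I 0,
      forall a b, I a -> I b -> I (a + b),
      forall (c : R[i]) a, I a -> I (c *: a) &
      forall a b, I a -> I (b * a) /\ I (a * b)].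

Definition simple :=
  forall I : set A, closed I -> two_sided_ideal I ->
    I = [set 0] \/ I = [set: A].

Definition separable := exists S : set A, countable S /\ dense S.

Definition real_rank_zero :=
  [set a | selfadjoint a] `<=` closure [set a | selfadjoint a /\ invertible a].

Definition stable_rank_one := dense [set a : A | invertible a].

Definition subprojection (p q : A) := projection p /\ q * p = p.

Definition mvn_equiv (p q : A) := exists v : A, star v * v = p /\ v * star v = q.

Definition mvn_lt (p q : A) :=
  exists r : A, [/\ mvn_equiv p r, subprojection r q & r <> q].

(* Positivity and [tau 1 = 1] force [tau] to be bounded, of norm one. *)
Definition tracial_state (tau : A -> R[i]) :=
  [/\ scalar tau,
      forall a, 0 <= tau (star a * a),
      tau 1 = 1 &
      forall a b, tau (a * b) = tau (b * a)].

Definition tracial_states : set (A -> R[i]) := [set tau | tracial_state tau].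

(* [T] is meant to be a convex set of functionals. *)
Definition extreme_points (T : set (A -> R[i])) : set (A -> R[i]) :=
  [set tau | T tau /\
     forall (tau1 tau2 : A -> R[i]) (t : R), T tau1 -> T tau2 -> 0 < t < 1 ->
       tau = (fun a => t%:C * tau1 a + (1 - t)%:C * tau2 a) ->
       tau1 = tau /\ tau2 = tau].

Definition strict_comparison :=
  tracial_states !=set0 /\
  forall p q : A, projection p -> projection q ->
    (forall tau, tracial_states tau -> tau p < tau q) -> mvn_lt p q.

End CStar.

Arguments tracial_states {R} A.

(* Main.v *)
(* Projections [p] satisfy [p y - y p] in their linear span [V], because an
   off-diagonal element [y = e y (1 - e)] is a combination of four projections;
   so [V] is a Lie ideal, and a commutator [x y - y x] with [x] off-diagonal
   lies in [V] with uniform bounds. The span of the projections being dense,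
   finitely many projections account for the values of the traces, of which
   there are finitely many extreme ones, and it remains to treat a self-adjoint
   [a] on which all traces vanish.

   If the traces of nonzero projections are bounded below, then 1 is a finite
   sum of minimal projections and the theorem follows. Otherwise simplicity
   and the existence of projections of small trace provide pairwise orthogonal
   projections [r_0, r_1, ...] in a corner [e A e] such that
   [tau (r_n) < 6 tau (r_(n+1))] for all traces, [e] having many orthogonal
   equivalent copies. Up to commutators [a] can be moved to the corner of [r_0].
   By real rank zero, [a = 2 t (q_1 + ... + q_M - (M/2) r_0) + a'] with
   projections [q_i <= r_0] and [a'] of norm at most [2 t = 2 |a| / (M + 1)].
   As [tau a = 0], the direct sum of the [q_i] and that of [M/2] copies of
   [r_0] have almost the same traces, so by comparison the first term is, up to
   commutators, a multiple by [2 t] of projections of small trace. Hence [a] is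
   congruent, modulo a fixed number of commutators, to a traceless element of
   the corner of [r_1] of norm at most [|a| / 4]. Iterating, the commutators of
   the successive steps have orthogonal supports and add up to finitely many
   commutators with off-diagonal factors. *)

Require Import Defs.
From mathcomp Require Import all_boot all_order all_algebra.
From mathcomp Require Import complex.
From mathcomp Require Import boolp classical_sets functions cardinality reals.
From mathcomp Require Import topology normedtype sequences.
From mathcomp Require Import ring lra zify.

Set Implicit Arguments.
Unset Strict Implicit.

Import Order.TTheory GRing.Theory Num.Theory.
Import numFieldNormedType.Exports.

Local Open Scope classical_set_scope.
Local Open Scope complex_scope.
Local Open Scope ring_scope.

(** * A decision procedure for identities in noncommutative algebras *)

(** The number of projections must not depend on [a], so the corrections made at infinitely many
    steps cannot simply be listed one after the other. Two competing rates shape the descent.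
    Passing to the next corner packs up to 18 copies into one and may multiply norms by 18, whereas
    an approximation by M projections leaves norms of order |a| / (M + 1); M is a fixed constant
    chosen large enough to win. The bounded ratio of the traces of successive corners is what keeps
    the number of copies bounded.

    Order and functional calculus are rebuilt from norms. For a self-adjoint T, the estimate |k/2 -
    T| <= k/2 expresses that T lies between 0 and k. Square roots come from a contracting iteration,
    signs and spectral projections from the approximation by invertible self-adjoint elements.
    Positivity of [y * star y] is not an axiom: it is derived from real rank zero. *)

Section NCAlgebra.
Context {K : comNzRingType} {A : algType K}.

Inductive nc_expr :=
  | NCvar of nat | NCzero | NCone
  | NCadd of nc_expr & nc_expr | NCmul of nc_expr & nc_expr
  | NCopp of nc_expr | NCscale of K & nc_expr.

Fixpoint nc_nth (env : list A) (i : nat) : A :=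
  match env, i with
  | cons a _, 0 => a
  | cons _ env', S i' => nc_nth env' i'
  | nil, _ => 0
  end.

Fixpoint nc_eval (env : list A) (e : nc_expr) : A :=
  match e with
  | NCvar i => nc_nth env i
  | NCzero => 0
  | NCone => 1
  | NCadd e1 e2 => nc_eval env e1 + nc_eval env e2
  | NCmul e1 e2 => nc_eval env e1 * nc_eval env e2
  | NCopp e1 => - nc_eval env e1
  | NCscale c e1 => c *: nc_eval env e1
  end.

(** Private copies of append and of equality on numbers: the tactic unfolds only an explicit list of
    names, so the scalars and atoms are not reduced by accident. *)
Fixpoint nc_app {T : Type} (s t : list T) : list T :=
  match s with nil => t | cons x s' => cons x (nc_app s' t) end.

Fixpoint nc_eqn (m n : nat) : bool :=
  match m, n with
  | 0, 0 => true | S m', S n' => nc_eqn m' n' | _, _ => false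
  end.

Fixpoint nc_eqw (v w : list nat) : bool :=
  match v, w with
  | nil, nil => true
  | cons i v', cons j w' => if nc_eqn i j then nc_eqw v' w' else false
  | _, _ => false
  end.

Fixpoint nc_insert (c : K) (w : list nat) (l : list (K * list nat)) :=
  match l with
  | nil => cons (c, w) nil
  | cons (d, v) l' =>
    if nc_eqw w v then cons (c + d, v) l' else cons (d, v) (nc_insert c w l')
  end.

Fixpoint nc_merge (l m : list (K * list nat)) :=
  match l with nil => m | cons (c, w) l' => nc_insert c w (nc_merge l' m) end.

Fixpoint nc_mulmono (c : K) (w : list nat) (l : list (K * list nat)) :=
  match l with
  | nil => nil
  | cons (d, v) l' => nc_insert (c * d) (nc_app w v) (nc_mulmono c w l')
  end.

Fixpoint nc_mul (l m : list (K * list nat)) :=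
  match l with
  | nil => nil
  | cons (c, w) l' => nc_merge (nc_mulmono c w m) (nc_mul l' m)
  end.

Fixpoint nc_norm (e : nc_expr) : list (K * list nat) :=
  match e with
  | NCvar i => cons (1, cons i nil) nil
  | NCzero => nil
  | NCone => cons (1, nil) nil
  | NCadd e1 e2 => nc_merge (nc_norm e1) (nc_norm e2)
  | NCmul e1 e2 => nc_mul (nc_norm e1) (nc_norm e2)
  | NCopp e1 => nc_mulmono (-1) nil (nc_norm e1)
  | NCscale c e1 => nc_mulmono c nil (nc_norm e1)
  end.

Fixpoint nc_word (env : list A) (w : list nat) : A :=
  match w with nil => 1 | cons i w' => nc_nth env i * nc_word env w' end.

Fixpoint nc_sum (env : list A) (l : list (K * list nat)) : A :=
  match l with
  | nil => 0
  | cons (c, w) l' => c *: nc_word env w + nc_sum env l'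
  end.

(** Equality of coefficients does not compute, so cancelled monomials stay in the normal form and
    each of them yields an equation between scalars, left to [ring] or [field]. *)
Fixpoint nc_allzero (l : list (K * list nat)) : Prop :=
  match l with
  | nil => True
  | cons (c, _) l' => c = 0 /\ nc_allzero l'
  end.

Lemma nc_eqwP v w : nc_eqw v w -> v = w.
Proof.
have eqnP m n : nc_eqn m n -> m = n.
  by elim: m n => [|m IHm] [|n] //= /IHm ->.
elim: v w => [|i v IHv] [|j w] //=.
by case: (boolP (nc_eqn i j)) => // /eqnP -> /IHv ->.
Qed.

Lemma nc_word_app env v w :
  nc_word env (nc_app v w) = nc_word env v * nc_word env w.
Proof. by elim: v => [|i v IHv] /=; rewrite ?mul1r // IHv mulrA. Qed.

Lemma nc_sum_insert env c w l :
  nc_sum env (nc_insert c w l) = c *: nc_word env w + nc_sum env l.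
Proof.
elim: l => [|[d v] l IHl] //=.
case: (boolP (nc_eqw w v)) => [/nc_eqwP -> | _] /=.
  by rewrite scalerDl addrA.
by rewrite IHl addrCA.
Qed.

Lemma nc_sum_merge env l m :
  nc_sum env (nc_merge l m) = nc_sum env l + nc_sum env m.
Proof.
elim: l => [|[c w] l IHl] /=; first by rewrite add0r.
by rewrite nc_sum_insert IHl addrA.
Qed.

Lemma nc_sum_mulmono env c w l :
  nc_sum env (nc_mulmono c w l) = c *: (nc_word env w * nc_sum env l).
Proof.
elim: l => [|[d v] l IHl] /=; first by rewrite mulr0 scaler0.
rewrite nc_sum_insert IHl nc_word_app mulrDr scalerDr -scalerA.
by rewrite -scalerAr.
Qed.

Lemma nc_sum_mul env l m :
  nc_sum env (nc_mul l m) = nc_sum env l * nc_sum env m.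
Proof.
elim: l => [|[c w] l IHl] /=; first by rewrite mul0r.
by rewrite nc_sum_merge nc_sum_mulmono IHl mulrDl -scalerAl.
Qed.

Lemma nc_normE env e : nc_eval env e = nc_sum env (nc_norm e).
Proof.
elim: e => [i|||e1 IH1 e2 IH2|e1 IH1 e2 IH2|e1 IH1|c e1 IH1] //=.
- by rewrite mulr1 scale1r addr0.
- by rewrite scale1r addr0.
- by rewrite nc_sum_merge IH1 IH2.
- by rewrite nc_sum_mul IH1 IH2.
- by rewrite nc_sum_mulmono /= mul1r scaleN1r IH1.
- by rewrite nc_sum_mulmono /= mul1r IH1.
Qed.

Lemma nc_correct env e1 e2 :
  nc_allzero (nc_norm (NCadd e1 (NCopp e2))) -> nc_eval env e1 = nc_eval env e2.
Proof.
move=> H; apply/eqP; rewrite -subr_eq0; apply/eqP.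
rewrite -[LHS]/(nc_eval env (NCadd e1 (NCopp e2))) nc_normE.
elim: (nc_norm _) H => [|[c w] l IHl] //= [-> /IHl ->].
by rewrite scale0r addr0.
Qed.

End NCAlgebra.

(* [constr_eq] cannot be run directly by a tactic returning a term. *)
Ltac nc_index a l :=
  match l with
  | cons ?b ?l' =>
    match constr:(Set) with
    | _ => let _ := match constr:(Set) with _ => constr_eq a b end in constr:(O)
    | _ => let n := nc_index a l' in constr:(S n)
    end
  end.

Ltac nc_atoms e l :=
  lazymatch e with
  | @Algebra.add _ ?a ?b => let l := nc_atoms a l in nc_atoms b l
  | @GRing.mul _ ?a ?b => let l := nc_atoms a l in nc_atoms b l
  | @Algebra.opp _ ?a => nc_atoms a l
  | @GRing.scale _ _ _ ?a => nc_atoms a l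
  | @Algebra.zero _ => l
  | @GRing.one _ => l
  | _ => match constr:(Set) with
         | _ => let _ := nc_index e l in l
         | _ => constr:(cons e l)
         end
  end.

Ltac nc_reify K e l :=
  lazymatch e with
  | @Algebra.add _ ?a ?b =>
    let a := nc_reify K a l in let b := nc_reify K b l in
    constr:(@NCadd K a b)
  | @GRing.mul _ ?a ?b =>
    let a := nc_reify K a l in let b := nc_reify K b l in
    constr:(@NCmul K a b)
  | @Algebra.opp _ ?a => let a := nc_reify K a l in constr:(@NCopp K a)
  | @GRing.scale _ _ ?c ?a =>
    let a := nc_reify K a l in constr:(@NCscale K c a)
  | @Algebra.zero _ => constr:(@NCzero K)
  | @GRing.one _ => constr:(@NCone K)
  | _ => let n := nc_index e l in constr:(@NCvar K n)
  end.

Ltac nc_close :=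
  lazymatch goal with
  | |- _ /\ _ => split; [first [by [] | by ring | by field | idtac] | nc_close]
  | |- True => exact I
  end.

Ltac ncring_in K A :=
  lazymatch goal with
  | |- @eq ?T ?a ?b =>
    let l := nc_atoms a (@nil A) in
    let l := nc_atoms b l in
    let e1 := nc_reify K a l in
    let e2 := nc_reify K b l in
    let H := fresh in
    enough (H : nc_allzero (nc_norm (NCadd e1 (NCopp e2))))
      by exact (@nc_correct K A l e1 e2 H);
    cbv beta iota zeta delta [nc_allzero nc_norm nc_mul nc_mulmono nc_merge
      nc_insert nc_eqw nc_eqn nc_app];
    nc_close
  end.


(** Terms such as [star x] are atoms, and no relation between atoms is known: idempotency and
    orthogonality are rewritten by hand before or after. *)
Ltac ncring :=
  lazymatch goal with
  | R : realType, A : cstarAlgType ?R |- _ =>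
    ncring_in (R[i] : comNzRingType) (A : algType R[i])
  end.

(** * Modulus, norm and involution *)

Lemma pow_small (R : realType) (q D r : R) :
  0 <= q < 1 -> 0 <= D -> 0 < r -> exists n, D * q ^+ n < r.
Proof.
move=> /andP[q0 q1] D0 r0; have D1 : 0 < D + 1 by rewrite ltr_wpDl.
have /cvg_expr/cvgrPdist_lt/(_ (r / (D + 1))) : `|q| < 1 by rewrite ger0_norm.
case=> [|N _ /(_ N (leqnn N))]; first by rewrite divr_gt0.
rewrite sub0r normrN ger0_norm ?exprn_ge0 // ltr_pdivlMr // => h.
by exists N; apply: le_lt_trans h; rewrite mulrC ler_wpM2l ?exprn_ge0 // lerDl.
Qed.

Section ComplexModulus.
Context {R : realType}.
Implicit Types (r : R) (c d : R[i]).

(** Norms are valued in [R[i]]; taking real parts gives elements of [R], on which [lra] and [nra]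
    work. [nrm] and [tr] below follow the same device. *)
Definition cabs c : R := complex.Re `|c|.

Lemma ge0_Re c : 0 <= c -> (complex.Re c)%:C = c.
Proof. by move=> c0; rewrite RRe_real // ger0_real. Qed.

Lemma cabsE c : `|c| = (cabs c)%:C.
Proof. by rewrite ge0_Re. Qed.

Lemma cabs_ge0 c : 0 <= cabs c.
Proof. by rewrite -ler0c -cabsE. Qed.

Lemma cabs_real r : cabs r%:C = `|r|.
Proof. by rewrite /cabs normc_def /= expr0n /= addr0 sqrtr_sqr. Qed.

Lemma cabsM c d : cabs (c * d) = cabs c * cabs d.
Proof. by apply: complexI; rewrite rmorphM /= -!cabsE normrM. Qed.

Lemma cabsN c : cabs (- c) = cabs c.
Proof. by rewrite /cabs normrN. Qed.

Lemma cabsD c d : cabs (c + d) <= cabs c + cabs d.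
Proof. by rewrite -lecR rmorphD /= -!cabsE ler_normD. Qed.

Lemma cabs_i : cabs 'i%C = 1.
Proof. by rewrite /cabs normc_def /= expr0n expr1n add0r sqrtr1. Qed.

Lemma Re_le_cabs c : complex.Re c <= cabs c.
Proof.
rewrite /cabs normc_def /=; apply: le_trans (ler_norm _) _.
by rewrite -sqrtr_sqr ler_sqrt ?lerDl ?addr_ge0 ?sqr_ge0.
Qed.

Lemma cabs_ReIm c : cabs c <= `|complex.Re c| + `|complex.Im c|.
Proof.
case: c => x y /=; have -> : Complex x y = x%:C + 'i%C * y%:C.
  by apply/eqP; rewrite eq_complex /=; apply/andP; split; apply/eqP; lra.
by apply: le_trans (cabsD _ _) _; rewrite cabsM cabs_i mul1r !cabs_real.
Qed.

End ComplexModulus.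

Section CStarBasics.
Context {R : realType} {A : cstarAlgType R}.
Implicit Types (a b x y z : A) (r : R) (c : R[i]).

Definition nrm a : R := complex.Re `|a|.

Lemma nrmE a : `|a| = (nrm a)%:C.
Proof. by rewrite ge0_Re. Qed.

Lemma nrm_ge0 a : 0 <= nrm a.
Proof. by rewrite -ler0c -nrmE. Qed.

Lemma nrm0 : nrm 0 = 0.
Proof. by rewrite /nrm normr0. Qed.

Lemma nrm_eq0 a : nrm a = 0 -> a = 0.
Proof. by move=> a0; apply: normr0_eq0; rewrite nrmE a0. Qed.

Lemma nrmN a : nrm (- a) = nrm a.
Proof. by rewrite /nrm normrN. Qed.

Lemma nrmD a b : nrm (a + b) <= nrm a + nrm b.
Proof. by rewrite -lecR rmorphD /= -!nrmE ler_normD. Qed.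

Lemma nrmB a b : nrm (a - b) <= nrm a + nrm b.
Proof. by rewrite -[nrm b]nrmN nrmD. Qed.

Lemma nrmBC a b : nrm (a - b) = nrm (b - a).
Proof. by rewrite -nrmN opprB. Qed.

Lemma nrmM a b : nrm (a * b) <= nrm a * nrm b.
Proof. by rewrite -lecR rmorphM /= -!nrmE; exact: ler_norm_cstar_mul. Qed.

Lemma nrmZ c a : nrm (c *: a) = cabs c * nrm a.
Proof. by apply: complexI; rewrite rmorphM /= -cabsE -!nrmE normrZ. Qed.

Lemma nrmZr r a : nrm (r%:C *: a) = `|r| * nrm a.
Proof. by rewrite nrmZ cabs_real. Qed.

Lemma nrm_sum (I : Type) (s : seq I) (P : pred I) (F : I -> A) :
  nrm (\sum_(i <- s | P i) F i) <= \sum_(i <- s | P i) nrm (F i).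
Proof.
elim/big_ind2: _ => [|a u b v ha hb|//]; first by rewrite nrm0.
exact: le_trans (nrmD _ _) (lerD ha hb).
Qed.

Lemma starMr a b : star (a * b) = star b * star a.
Proof. exact: starM. Qed.

Lemma starDr a b : star (a + b) = star a + star b.
Proof. exact: starD. Qed.

Lemma starZc c a : star (c *: a) = conjc c *: star a.
Proof. exact: starZ. Qed.

Lemma star0 : star (0 : A) = 0.
Proof. by rewrite -[in LHS](scale0r (0 : A)) starZc conjc0 scale0r. Qed.

Lemma starN a : star (- a) = - star a.
Proof. by apply/eqP; rewrite -subr_eq0 opprK -starDr addNr star0. Qed.

Lemma starB a b : star (a - b) = star a - star b.
Proof. by rewrite starDr starN. Qed.

Lemma starZr r a : star (r%:C *: a) = r%:C *: star a.
Proof. by rewrite starZc conjc_real. Qed.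

Lemma star1 : star (1 : A) = 1.
Proof. by rewrite -[LHS]mul1r -[X in X * _](starK (1 : A)) -starMr mul1r starK. Qed.

Lemma star_sum (I : Type) (s : seq I) (P : pred I) (F : I -> A) :
  star (\sum_(i <- s | P i) F i) = \sum_(i <- s | P i) star (F i).
Proof. by elim/big_ind2: _ => [|a u b v <- <-|//]; rewrite ?star0 ?starDr. Qed.

Lemma nrm_starM a : nrm (star a * a) = nrm a ^+ 2.
Proof. by apply: complexI; rewrite rmorphXn /= -!nrmE; exact: norm_star_mul. Qed.

Lemma nrm_star a : nrm (star a) = nrm a.
Proof.
suff le b : nrm b <= nrm (star b) by apply/eqP; rewrite eq_le le -{2}[a]starK le.
have [b0|b0] := eqVneq (nrm b) 0; first by rewrite b0 nrm_ge0.
have bp : 0 < nrm b by rewrite lt_neqAle eq_sym b0 nrm_ge0.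
by rewrite -(ler_pM2r bp) -expr2 -nrm_starM nrmM.
Qed.

Lemma nrm_sa a : star a = a -> nrm (a * a) = nrm a ^+ 2.
Proof. by move=> sa; rewrite -nrm_starM sa. Qed.

Lemma nrm_Mstar a : nrm (a * star a) = nrm a ^+ 2.
Proof. by rewrite -(nrm_star a) -nrm_starM starK. Qed.

Lemma nrm1 : nrm (1 : A) = 1.
Proof.
have n0 : nrm (1 : A) != 0.
  by apply/eqP => /nrm_eq0/eqP; rewrite oner_eq0.
by apply: (mulfI n0); rewrite mulr1 -expr2 -nrm_sa ?star1 ?mulr1.
Qed.

Lemma nrm_proj a : projection a -> nrm a <= 1.
Proof.
move=> [sa aa]; have := nrm_sa sa; rewrite aa => h.
have [->|n0] := eqVneq (nrm a) 0; first exact: ler01.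
suff -> : nrm a = 1 by [].
by apply: (mulfI n0); rewrite mulr1 -expr2 -h.
Qed.

Lemma nrm_proj_lt1 a : projection a -> nrm a < 1 -> a = 0.
Proof.
move=> [sa aa] lt1; apply: nrm_eq0; apply/eqP; apply: contraT => n0.
have := nrm_sa sa; rewrite aa expr2 -[LHS]mulr1 => /(mulfI n0) e.
by rewrite -e ltxx in lt1.
Qed.

Lemma nrmM_le a b r s : nrm a <= r -> nrm b <= s -> nrm (a * b) <= r * s.
Proof.
by move=> ha hb; apply: le_trans (nrmM _ _) _; apply: ler_pM; rewrite ?nrm_ge0.
Qed.

Lemma nrm_contl a b r : nrm a <= 1 -> nrm b <= r -> nrm (a * b) <= r.
Proof. by move=> ha hb; rewrite -[r]mul1r nrmM_le. Qed.

Lemma nrm_contr a b r : nrm a <= 1 -> nrm b <= r -> nrm (b * a) <= r.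
Proof. by move=> ha hb; rewrite -[r]mulr1 nrmM_le. Qed.

Lemma nrm_ballP a b r : 0 < r -> ball a r%:C b <-> nrm (a - b) < r.
Proof. by move=> r0; rewrite -ball_normE /ball_ /= nrmE ltcR. Qed.

Lemma posC (e : R[i]) : 0 < e -> exists2 r : R, 0 < r & e = r%:C.
Proof.
move=> e0; exists (complex.Re e); last by rewrite ge0_Re // ltW.
by rewrite -ltcR ge0_Re // ltW.
Qed.

Lemma nbhs_nrmP a (P : set A) :
  nbhs a P <-> exists2 r, 0 < r & forall b, nrm (a - b) < r -> P b.
Proof.
split=> [/nbhs_ballP [_ /posC [r r0 ->] h]|[r r0 h]].
  by exists r => // b /(nrm_ballP a b r0); exact: h.
apply/nbhs_ballP; exists r%:C; first by rewrite /= ltcR.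
by move=> b /(nrm_ballP a b r0); exact: h.
Qed.

Lemma closure_nrmP (P : set A) a :
  closure P a <-> forall r, 0 < r -> exists2 b, P b & nrm (a - b) < r.
Proof.
split=> [cl r r0|h B /nbhs_nrmP [r r0 hB]].
  have [b [Pb ab]] : P `&` [set b | nrm (a - b) < r] !=set0.
    by apply: cl; apply/nbhs_nrmP; exists r.
  by exists b.
by have [b Pb ab] := h _ r0; exists b; split => //; exact: hB.
Qed.

Lemma dense_nrm (P : set A) : dense P ->
  forall a r, 0 < r -> exists2 b, P b & nrm (a - b) < r.
Proof.
move=> dP a r r0.
have : nbhs a (ball a r%:C) by apply: nbhsx_ballx; rewrite ltcR.
rewrite nbhsE => -[O [oO Oa] OB].
have [|b [Ob Pb]] := dP O _ oO; first by exists a.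
by exists b => //; apply/(nrm_ballP a b r0); exact: OB.
Qed.

(** Completeness of the algebra enters only here. All its limits are taken along sequences with
    geometric increments, so that an explicit error bound accompanies each of them. *)
Lemma geometric_limit (u : nat -> A) (C q : R) :
    0 <= C -> 0 <= q < 1 -> (forall n, nrm (u n.+1 - u n) <= C * q ^+ n) ->
  exists l, forall n, nrm (l - u n) <= C / (1 - q) * q ^+ n.
Proof.
move=> C0 /andP[q0 q1] hu.
pose D := C / (1 - q).
have D0 : 0 <= D by rewrite divr_ge0 // subr_ge0 ltW.
have DE : C = D * (1 - q) by rewrite /D mulfVK // subr_eq0 eq_sym lt_eqF.
(* The subtracted term makes the induction on [k] close; it is dropped right after. *)
have tail n k : nrm (u (n + k)%N - u n) <= D * q ^+ n - D * q ^+ (n + k).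
  elim: k => [|k IHk]; first by rewrite addn0 !subrr nrm0.
  rewrite addnS; have -> : u (n + k).+1 - u n =
    (u (n + k).+1 - u (n + k)%N) + (u (n + k)%N - u n) by rewrite addrA subrK.
  apply: le_trans (nrmD _ _) _; apply: le_trans (lerD (hu _) IHk) _.
  by rewrite DE exprS; lra.
have tail' n k : nrm (u (n + k)%N - u n) <= D * q ^+ n.
  apply: le_trans (tail n k) _; rewrite lerBlDr lerDl.
  by rewrite mulr_ge0 ?exprn_ge0.
have small r : 0 < r -> exists n, D * q ^+ n < r.
  by move=> r0; apply: pow_small => //; rewrite q0 q1.
have cu : cauchy (u @ \oo).
  apply: cauchy_exP => _ /posC [r r0 ->]; have [n hn] := small _ r0.
  exists (u n); exists n => // m /= nm; apply/(nrm_ballP _ _ r0).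
  by rewrite nrmBC -(subnKC nm); apply: le_lt_trans hn; exact: tail'.
have /cvg_ex [l ul] : cvg (u @ \oo) by exact/cauchy_cvgP.
exists l => n; apply/ler_addgt0Pr => r r0.
have : nbhs l (ball l r%:C) by apply: nbhsx_ballx; rewrite ltcR.
move=> /ul [N _ hN]; have := hN (n + N)%N (leq_addl _ _).
move=> /(nrm_ballP _ _ r0) lt_r.
have -> : l - u n = (l - u (n + N)%N) + (u (n + N)%N - u n) by rewrite addrA subrK.
by apply: le_trans (nrmD _ _) _; rewrite addrC lerD // ltW.
Qed.

End CStarBasics.

(** * Square roots and signs *)

Section FunctionalCalculus.
Context {R : realType} {A : cstarAlgType R}.
Implicit Types (a b x y z V W : A) (r k : R) (c : R[i]).
Local Notation sc r := (r%:C *: 1).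

Lemma nrm_sc r : nrm (sc r : A) = `|r|.
Proof. by rewrite nrmZr nrm1 mulr1. Qed.

Lemma star_sc r : star (sc r : A) = sc r.
Proof. by rewrite starZr star1. Qed.

Lemma eq0_geometric a (C q : R) : 0 <= C -> 0 <= q < 1 ->
  (forall n, nrm a <= C * q ^+ n) -> a = 0.
Proof.
move=> C0 q01 h; apply: nrm_eq0; apply/eqP; rewrite eq_le nrm_ge0 andbT.
apply/ler_addgt0Pr => r r0; rewrite add0r.
by have [n /ltW] := pow_small q01 C0 r0; apply: le_trans (h n).
Qed.

(** Membership in the bicommutant of [x]. It stands for being a function of [x], and is all that is
    retained of a functional calculus. *)
Definition bicommutes x z := forall b, b * x = x * b -> b * z = z * b.

Lemma geometric_limit_props (u : nat -> A) (C q : R) :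
    0 <= C -> 0 <= q < 1 -> (forall n, nrm (u n.+1 - u n) <= C * q ^+ n) ->
  exists l, [/\ forall n, nrm (l - u n) <= C / (1 - q) * q ^+ n,
    forall b, (forall n, b * u n = u n * b) -> b * l = l * b &
    (forall n, star (u n) = u n) -> star l = l].
Proof.
move=> C0 q01 hu; have [l hl] := geometric_limit C0 q01 hu.
have D0 : 0 <= C / (1 - q) by rewrite divr_ge0 // subr_ge0; lra.
exists l; split=> // [b cb|su].
  apply/eqP; rewrite -subr_eq0; apply/eqP.
  apply: (@eq0_geometric _ (2 * nrm b * (C / (1 - q))) q) => // [|n].
    by rewrite mulr_ge0 // mulr_ge0 // nrm_ge0.
  have -> : b * l - l * b = b * (l - u n) - (l - u n) * b.
    rewrite mulrBr mulrBl cb; ncring.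
  apply: le_trans (nrmB _ _) _.
  have := nrmM_le (lexx (nrm b)) (hl n); have := nrmM_le (hl n) (lexx (nrm b)).
  by lra.
apply/eqP; rewrite -subr_eq0; apply/eqP.
apply: (@eq0_geometric _ (2 * (C / (1 - q))) q) => // [|n].
  by rewrite mulr_ge0.
have -> : star l - l = star (l - u n) - (l - u n).
  by rewrite starB su; ncring.
by apply: le_trans (nrmB _ _) _; rewrite nrm_star; have := hl n; lra.
Qed.

Lemma neumann y : nrm y < 1 -> exists w,
  [/\ (1 - y) * w = 1, w * (1 - y) = 1, nrm w <= 1 / (1 - nrm y) & bicommutes y w].
Proof.
move=> y1; set q := nrm y in y1 *; have q01 : 0 <= q < 1 by rewrite nrm_ge0.
pose u := fix u n := if n is n'.+1 then 1 + y * u n' else 0.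
have hu n : nrm (u n.+1 - u n) <= 1 * q ^+ n.
  rewrite mul1r; elim: n => [|n IHn] /=.
    by rewrite mulr0 addr0 subr0 nrm1.
  rewrite (_ : _ - _ = y * (u n.+1 - u n)); last by rewrite /=; ncring.
  by rewrite exprS nrmM_le.
have uc b n : b * y = y * b -> b * u n = u n * b.
  move=> cb; elim: n => [|n IHn] /=; first by rewrite mulr0 mul0r.
  by rewrite mulrDr mulrDl mulr1 mul1r mulrA cb -!mulrA IHn.
have [l [hl cl _]] := geometric_limit_props ler01 q01 hu.
have cb : bicommutes y l by move=> b cb; apply: cl => n; exact: uc.
have yl : (1 - y) * l = 1.
  apply/eqP; rewrite -subr_eq0; apply/eqP.
  apply: (@eq0_geometric _ (2 * (1 / (1 - q))) q) => // [|n].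
    by rewrite mulr_ge0 ?divr_ge0 ?subr_ge0 ?ler01 //; lra.
  have -> : (1 - y) * l - 1 = (l - u n.+1) - y * (l - u n) by rewrite /=; ncring.
  apply: le_trans (nrmB _ _) _.
  have h1 := hl n.+1; have h2 := nrmM_le (lexx (nrm y)) (hl n).
  have h3 : 0 <= 1 / (1 - q) * q ^+ n.
    by rewrite mulr_ge0 ?divr_ge0 ?exprn_ge0 ?subr_ge0; lra.
  move: h1 h2; rewrite exprS -/q => h1 h2.
  suff : q * (1 / (1 - q) * q ^+ n) <= 1 / (1 - q) * q ^+ n by lra.
  by rewrite ler_piMl //; lra.
exists l; split => //.
  by rewrite -[RHS]yl mulrBr mulrBl mulr1 mul1r (cb y erefl).
by have := hl 0%N; rewrite subr0 expr0 mulr1.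
Qed.

Lemma nrm_half a : nrm ((1/2)%:C *: a) = nrm a / 2.
Proof. by rewrite nrmZr ger0_norm; lra. Qed.

(** The equation (1 - z)^2 = 1 - y is the fixed point equation z = (y + z^2) / 2. On the ball of
    radius |y| the right-hand side contracts by the factor |y|, and the iteration from 0 stays
    there. *)
Lemma sqrt_one_sub y : star y = y -> nrm y < 1 ->
  exists z, [/\ star z = z, nrm z <= nrm y, (1 - z) * (1 - z) = 1 - y & bicommutes y z].
Proof.
move=> sy y1; set q := nrm y in y1 *; have q01 : 0 <= q < 1 by rewrite nrm_ge0.
have /andP[q0 _] := q01.
pose u := fix u n := if n is n'.+1 then (1/2)%:C *: (y + u n' * u n') else 0.
have uq n : nrm (u n) <= q.
  elim: n => [|n IHn] /=; first by rewrite nrm0.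
  rewrite nrm_half; have := nrmD y (u n * u n).
  have := nrmM_le IHn IHn; rewrite -/q => h1 h2.
  have : q * q <= q by rewrite ler_piMl //; lra.
  by lra.
have hu n : nrm (u n.+1 - u n) <= q * q ^+ n.
  elim: n => [|n IHn].
    rewrite /= mulr0 addr0 subr0 nrm_half expr0 mulr1 -/q; lra.
  have -> : u n.+2 - u n.+1 = (1/2)%:C *:
    (u n.+1 * (u n.+1 - u n) + (u n.+1 - u n) * u n).
    by rewrite -[u n.+2]/((1/2)%:C *: (y + u n.+1 * u n.+1)) {3}/u -/u; ncring.
  rewrite nrm_half; have := nrmM_le (uq n.+1) IHn.
  have := nrmM_le IHn (uq n); have := nrmD (u n.+1 * (u n.+1 - u n)) ((u n.+1 - u n) * u n).
  by rewrite exprS; lra.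
have uc b n : b * y = y * b -> b * u n = u n * b.
  move=> cb; elim: n => [|n IHn] /=; first by rewrite mulr0 mul0r.
  by rewrite -scalerAr -scalerAl mulrDr mulrDl cb mulrA IHn -!mulrA IHn.
have us n : star (u n) = u n.
  by elim: n => [|n IHn] /=; rewrite ?star0 // starZr starDr starMr sy IHn.
have [l [hl cl sl]] := geometric_limit_props q0 q01 hu.
set D := q / (1 - q) in hl; have D0 : 0 <= D by rewrite divr_ge0 // subr_ge0; lra.
have lq : nrm l <= q.
  apply/ler_addgt0Pr => r r0; have [n /ltW hn] := pow_small q01 D0 r0.
  have := nrmD (u n) (l - u n); rewrite addrC subrK => h.
  by have := hl n; have := uq n; lra.
have lE : l = (1/2)%:C *: (y + l * l).
  apply/eqP; rewrite -subr_eq0; apply/eqP.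
  apply: (@eq0_geometric _ (2 * D) q) => // [|n]; first by rewrite mulr_ge0.
  have -> : l - (1/2)%:C *: (y + l * l) = (l - u n.+1) -
    (1/2)%:C *: (l * (l - u n) + (l - u n) * u n) by rewrite /=; ncring.
  apply: le_trans (nrmB _ _) _; rewrite nrm_half -mulrA.
  have := hl n.+1; rewrite exprS (mulrCA D).
  have := nrmM_le lq (hl n); have := nrmM_le (hl n) (uq n).
  have := nrmD (l * (l - u n)) ((l - u n) * u n).
  have : 0 <= D * q ^+ n by rewrite mulr_ge0 ?exprn_ge0.
  set e := D * q ^+ n => e0.
  have : q * e <= e by rewrite ler_piMl //; lra.
  by rewrite [e * q]mulrC; lra.
exists l; split => //; first exact: sl.
  have -> : (1 - l) * (1 - l) =
    1 - y - 2%:C *: (l - (1/2)%:C *: (y + l * l)) by ncring.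
  by rewrite -lE subrr scaler0 subr0.
by move=> b cb; apply: cl => n; exact: uc.
Qed.

(* The bound on [sc r - V] makes [V] a square in turn. *)
Lemma sqrt_pos x k : star x = x -> nrm (sc k - x) < k ->
  exists V, [/\ star V = V, V * V = x, bicommutes x V &
    exists r, nrm (sc r - V) < r].
Proof.
move=> sx hx; have k0 : 0 < k by apply: le_lt_trans hx; rewrite nrm_ge0.
have n1 : nrm (1 - k^-1%:C *: x) < 1.
  have -> : 1 - k^-1%:C *: x = k^-1%:C *: (sc k - x).
    by rewrite scalerBr scalerA -rmorphM /= mulVf ?gt_eqF // scale1r.
  by rewrite nrmZr gtr0_norm ?invr_gt0 // mulrC ltr_pdivrMr // mul1r.
pose s := Num.sqrt k; have s0 : 0 < s by rewrite sqrtr_gt0.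
have ss : s * s = k by rewrite -expr2 sqr_sqrtr // ltW.
have [||z [sz nz zz cz]] := @sqrt_one_sub (1 - k^-1%:C *: x).
- by rewrite starB star1 starZr sx.
- by [].
exists (s%:C *: (1 - z)); split.
- by rewrite starZr starB star1 sz.
- rewrite -scalerAl -scalerAr zz subKr !scalerA -!rmorphM /= ss.
  by rewrite divff ?gt_eqF // scale1r.
- move=> b bx; rewrite -scalerAr -scalerAl mulrBr mulrBl mulr1 mul1r; congr (_ *: (_ - _)).
  by apply: cz; rewrite mulrBr mulrBl mulr1 mul1r -scalerAr -scalerAl bx.
exists s; rewrite scalerBr opprB addrCA subrr addr0 nrmZr gtr0_norm //.
by rewrite -[ltRHS]mulr1 ltr_pM2l //; apply: le_lt_trans nz _.
Qed.

Lemma star_iZ a : star ('i%C *: a) = - ('i%C *: star a).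
Proof.
rewrite starZc -scaleNr; congr (_ *: _).
by apply/eqP; rewrite eq_complex /= oppr0 !eqxx.
Qed.

(** [y] is the real part of the normal element y + i w, whose squared norm is that of y^2 + w^2.
    This replaces the order relation y^2 <= y^2 + w^2. *)
Lemma normal_re_bound y w : star y = y -> star w = w -> y * w = w * y ->
  nrm y ^+ 2 <= nrm (y * y + w * w).
Proof.
move=> sy sw yw; pose N := y + 'i%C *: w.
have sN : star N = y - 'i%C *: w.
  by rewrite starDr star_iZ sy sw.
have i2 : 'i%C * 'i%C = -1 :> R[i] by rewrite -expr2 sqr_i.
have -> : y * y + w * w = star N * N.
  rewrite sN (_ : _ * N = y * y + 'i%C *: (y * w - w * y) - ('i%C * 'i%C) *: (w * w)).
    by rewrite yw subrr scaler0 addr0 i2 scaleN1r opprK.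
  by rewrite /N; ncring.
rewrite nrm_starM lerXn2r ?nnegrE ?nrm_ge0 //.
have -> : y = (1/2)%:C *: (N + star N) by rewrite sN /N; ncring.
by rewrite nrm_half; have := nrmD N (star N); rewrite nrm_star; lra.
Qed.

(* Write [W] as the real part of [sqrt k] times a unitary [u]. Then
   [k/2 - W^2] is a multiple of [u^2 + (star u)^2]. *)
Lemma square_bound W k : star W = W -> nrm (W * W) <= k ->
  nrm (sc (k / 2) - W * W) <= k / 2.
Proof.
move=> sW.
(* Strictness puts [sc k' - W * W] in the domain of [sqrt_pos]; the general case follows by
   enlarging [k] slightly. *)
have strict k' : nrm (W * W) < k' -> nrm (sc (k' / 2) - W * W) <= k' / 2.
  move=> hW; have k0 : 0 <= k' by apply: ltW; apply: le_lt_trans hW; rewrite nrm_ge0.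
  have [||V [sV VV cV _]] := @sqrt_pos (sc k' - W * W) k'.
  - by rewrite starB star_sc starMr sW.
  - by rewrite opprB addrCA subrr addr0.
  have WV : W * V = V * W.
    apply: cV; rewrite mulrBr mulrBl mulrA; congr (_ - _); ncring.
  pose u := W + 'i%C *: V.
  have su : star u = W - 'i%C *: V.
    by rewrite starDr star_iZ sW sV.
  have i2 : 'i%C * 'i%C = -1 :> R[i] by rewrite -expr2 sqr_i.
  have uu : star u * u = sc k'.
    rewrite su (_ : _ * u = W * W + 'i%C *: (W * V - V * W) - ('i%C * 'i%C) *: (V * V)).
      by rewrite WV subrr scaler0 addr0 i2 scaleN1r opprK VV; ncring.
    by rewrite /u; ncring.
  have nu : nrm u * nrm u = k'.
    by rewrite -expr2 -nrm_starM uu nrm_sc ger0_norm.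
  have -> : sc (k' / 2) - W * W = - (1/2)%:C *: ((1/2)%:C *: (u * u + star u * star u)).
    rewrite su (_ : u * u + _ = 2%:C *: (W * W) + (2%:C * ('i%C * 'i%C)) *: (V * V)).
      by rewrite i2 VV; ncring.
    by rewrite /u; ncring.
  rewrite scaleNr nrmN nrm_half nrm_half; have := nrmD (u * u) (star u * star u).
  have := nrmM u u; have := nrmM (star u) (star u); rewrite nrm_star nu; lra.
move=> hW; apply/ler_addgt0Pr => r r0.
have /strict : nrm (W * W) < k + r by rewrite ltr_pwDr.
have -> : sc ((k + r) / 2) - W * W = (sc (k / 2) - W * W) + sc (r / 2) by ncring.
set X := sc (k / 2) - W * W => h.
have := nrmB (X + sc (r / 2)) (sc (r / 2)); rewrite addrK nrm_sc ger0_norm; lra.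
Qed.

End FunctionalCalculus.

(** * Signs of self-adjoint elements *)

Section Signs.
Context {R : realType} {A : cstarAlgType R}.
Implicit Types (a b e f g p q r s v w x y z S T V W X : A) (d k t : R) (c : R[i]).
Local Notation sc r := (r%:C *: 1).

Lemma projM p : projection p -> p * p = p. Proof. by case. Qed.
Lemma projS p : projection p -> star p = p. Proof. by case. Qed.

Lemma proj_one : projection (1 : A).
Proof. by split; [exact: star1 | rewrite mul1r]. Qed.

Lemma selfadjoint_parts x : exists h g : A, [/\ star h = h, star g = g,
  x = h + 'i%C *: g, nrm h <= nrm x & nrm g <= nrm x].
Proof.
have i2 : 'i%C * 'i%C = -1 :> R[i] by rewrite -expr2 sqr_i.
exists ((1/2)%:C *: (x + star x)), ((- (1/2)%:C * 'i%C) *: (x - star x)); split.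
- by rewrite starZr starDr starK addrC.
- by rewrite -scalerA scaleNr starN starZr star_iZ starB starK; ncring.
- have -> : 'i%C *: ((- (1/2)%:C * 'i%C) *: (x - star x)) =
    (- (1/2)%:C * ('i%C * 'i%C)) *: (x - star x) by ncring.
  by rewrite i2; ncring.
- by rewrite nrm_half; have := nrmD x (star x); rewrite nrm_star; lra.
rewrite nrmZ cabsM cabsN cabs_real cabs_i mulr1 ger0_norm; last lra.
by have := nrmB x (star x); rewrite nrm_star; lra.
Qed.

Lemma proj_compl p : projection p -> projection (1 - p).
Proof.
move=> [sp pp]; split; first by rewrite /selfadjoint starB star1 sp.
by rewrite mulrBr mulr1 mulrBl mul1r pp subrr subr0.
Qed.

Lemma corner_sa p x : projection p -> star x = x -> p * x = x -> x * p = x.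
Proof. by move=> [sp _] sx px; rewrite -{1}sx -{1}sp -starMr px. Qed.

Lemma nrm_symmetry s : star s = s -> s * s = 1 -> nrm s = 1.
Proof.
move=> ss s1; have := nrm_sa ss; rewrite s1 nrm1 => /esym/eqP.
by rewrite sqrf_eq1 => /orP[/eqP //|/eqP n1]; have := nrm_ge0 s; lra.
Qed.

Lemma inverse_sa x b : star x = x -> x * b = 1 -> b * x = 1 -> star b = b.
Proof.
move=> sx xb bx; rewrite -[star b]mulr1 -xb mulrA -[X in _ * X * _]sx -starMr xb.
by rewrite star1 mul1r.
Qed.

Lemma inverse_bicommutes x b : x * b = 1 -> b * x = 1 -> bicommutes x b.
Proof.
move=> xb bx c cx.
by rewrite -[c * b]mul1r -bx -!mulrA (mulrA x) -cx -!mulrA xb mulr1.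
Qed.

(* [s = x / |x|] and [W = sqrt |x|]; [|x|] is reached through
   [K x^2 = (x w)^2 + 1], where [w^2 = K - x^-2]. *)
Lemma sign_invertible x b k :
    star x = x -> x * b = 1 -> b * x = 1 -> nrm x <= k ->
  exists s W, [/\ [/\ star s = s, s * s = 1 & bicommutes x s],
    [/\ star W = W, W * W = x * s & bicommutes x W] &
    nrm (sc (k / 2) - x * s) <= k / 2].
Proof.
move=> sx xb bx xk; have sb := inverse_sa sx xb bx.
have cb := inverse_bicommutes xb bx.
pose K := nrm b ^+ 2 + 1; have K0 : 0 < K by rewrite ltr_wpDl ?sqr_ge0.
have [||w [sw ww cw _]] := @sqrt_pos _ _ (sc K - b * b) K.
- by rewrite starB star_sc starMr sb.
- by rewrite opprB addrCA subrr addr0 (nrm_sa sb) ltrDl.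
have xw : x * w = w * x.
  apply: cw; rewrite mulrBr mulrBl !mulrA xb -[b * b * x]mulrA bx mulr1 mul1r.
  by rewrite -scalerAl -scalerAr mulr1 mul1r.
pose y := x * w; have sy : star y = y by rewrite starMr sx sw -xw.
have yy : y * y = K%:C *: (x * x) - 1.
  have -> : y * y = x * x * (w * w) by rewrite /y -mulrA (mulrA w) -xw !mulrA.
  rewrite ww mulrBr -scalerAr mulr1; congr (_ - _).
  by rewrite -mulrA (mulrA x b) xb mul1r.
have yk : nrm (y * y) <= K * k ^+ 2.
  rewrite nrm_sa //; have := normal_re_bound sy (star1 (A := A)).
  rewrite mulr1 mul1r mulr1 yy subrK => /(_ erefl) h; apply: le_trans h _.
  rewrite nrmZr gtr0_norm // ler_pM2l // nrm_sa // lerXn2r ?nnegrE ?nrm_ge0 //.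
  exact: le_trans (nrm_ge0 x) xk.
(* The summand 1 in K x^2 = y^2 + 1 provides the strict margin that [sqrt_pos] asks for. *)
have h1 : nrm (sc (K * k ^+ 2 / 2 + 1) - K%:C *: (x * x)) < K * k ^+ 2 / 2 + 1.
  have := square_bound sy yk; rewrite yy => h.
  rewrite (_ : _ - _ = sc (K * k ^+ 2 / 2) - (K%:C *: (x * x) - 1)); first by lra.
  by ncring.
(* [V] is sqrt K times |x|, and [W] its square root; the factor [u] below removes sqrt K. *)
have [|V [sV VV cV [r hr]]] := sqrt_pos _ h1.
  by rewrite starZr starMr sx.
have [W [sW WW cW _]] := sqrt_pos sV hr.
have cxV : bicommutes x V.
  by move=> c cx; apply: cV; rewrite -scalerAl -scalerAr mulrA cx -!mulrA cx.
have cxW : bicommutes x W by move=> c /cxV; exact: cW.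
pose u := (Num.sqrt K)^-1; have u0 : 0 < u by rewrite invr_gt0 sqrtr_gt0.
have uu : u * u * K = 1.
  by rewrite -expr2 /u exprVn sqr_sqrtr ?ltW // mulVf ?gt_eqF.
pose m := u%:C *: V.
have mm : m * m = x * x.
  rewrite -scalerAl -scalerAr VV !scalerA -!rmorphM /=.
  by rewrite uu scale1r.
have sm : star m = m by rewrite starZr sV.
have cm : bicommutes x m by move=> c /cxV; rewrite -scalerAl -scalerAr => ->.
have mb : m * b = b * m by apply/esym/cm; rewrite xb bx.
have xm : x * m = m * x by apply: cm.
have xmb : x * (m * b) = m by rewrite mulrA xm -mulrA xb mulr1.
pose W' := (Num.sqrt u)%:C *: W.
have W'W' : W' * W' = m.
  rewrite -scalerAl -scalerAr WW !scalerA -rmorphM /= -expr2 sqr_sqrtr //.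
  exact: ltW.
have sW' : star W' = W' by rewrite starZr sW.
have nm : nrm m = nrm x.
  by apply/eqP; rewrite -(@eqrXn2 _ 2) ?nrm_ge0 // -!nrm_sa // mm.
exists (m * b), W'; split; rewrite ?xmb //.
- split; first by rewrite starMr sm sb mb.
    have -> : m * b * (m * b) = m * (b * m) * b by rewrite !mulrA.
    rewrite -mb mulrA mm -!mulrA (mulrA x b) xb mul1r.
    exact: xb.
  by move=> c cx; rewrite mulrA (cm c cx) -mulrA (cb c cx) mulrA.
- split => // c cx.
  by rewrite -scalerAl -scalerAr (cxW c cx).
by rewrite -W'W'; apply: square_bound; rewrite // W'W' nm.
Qed.

Lemma rr0_approx x d : real_rank_zero A -> star x = x -> 0 < d ->
  exists y b, [/\ star y = y, y * b = 1, b * y = 1 & nrm (x - y) < d].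
Proof.
move=> rr0 sx d0; have /closure_nrmP/(_ d d0) := rr0 x sx.
by move=> [y [sy [b [yb by']]] xy]; exists y, b.
Qed.

(* The Schur complement of an invertible element is invertible, its inverse
   being the corner of the inverse. *)
Lemma corner_rr0_approx r x d : real_rank_zero A -> projection r ->
    star x = x -> r * x = x -> 0 < d ->
  exists y b, [/\ star y = y, r * y = y, r * b = b /\ b * r = b,
    y * b = r /\ b * y = r & nrm (x - y) <= d].
Proof.
move=> rr0 pr sx rx d0; have xr := corner_sa pr sx rx.
have rr := projM pr; have sr := projS pr.
pose q := 1 - r; have pq : projection q := proj_compl pr.
have qq := projM pq; have sq := projS pq.
have qr : q * r = 0 by rewrite mulrBl mul1r rr subrr.
have rq : r * q = 0 by rewrite mulrBr mulr1 rr subrr.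
have qx : q * x = 0 by rewrite mulrBl mul1r rx subrr.
have xq : x * q = 0 by rewrite mulrBr mulr1 xr subrr.
have rE : r = 1 - q by rewrite subKr.
(* [d' <= 1/2] bounds the inverse of the corner [q * z * q] by 2, so the Schur correction has norm
   at most 2 d'^2 <= d', and the total error is at most 2 d' <= d. *)
pose d' := Num.min (1/2) (d/2).
have d'0 : 0 < d' by rewrite lt_min; lra.
have d'1 : d' <= 1/2 by rewrite ge_min lexx.
have d'2 : d' <= d/2 by rewrite ge_min lexx orbT.
(* Approximating [x + q] instead of [x] makes the corner of [z] under [q] close to [q], hence
   invertible there. *)
have [|z [c [sz zc cz zE]]] := @rr0_approx (x + q) d' rr0 _ d'0.
  by rewrite starDr sx sq.
set E := x + q - z in zE; have nE : nrm E <= d' by exact: ltW.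
have zD : z = x + q - E by rewrite subKr.
have nr := nrm_proj pr; have nq := nrm_proj pq.
have corner u w : nrm u <= 1 -> nrm w <= 1 -> nrm (u * E * w) <= d'.
  by move=> hu hw; apply: nrm_contr => //; apply: nrm_contl.
have qzq : q * z * q = q - q * E * q.
  rewrite zD (_ : _ * q = q * x * q + q * q * q - q * E * q); last by ncring.
  by rewrite qx qq qq mul0r add0r.
have rzq : r * z * q = - (r * E * q).
  rewrite zD (_ : _ * q = r * (x * q) + r * q * q - r * E * q); last by ncring.
  by rewrite xq rq mulr0 mul0r !add0r.
have qzr : q * z * r = - (q * E * r).
  rewrite zD (_ : _ * r = q * x * r + q * (q * r) - q * E * r); last by ncring.
  by rewrite qx qr mulr0 mul0r !add0r.
have [|w [Mw wM nw _]] := @neumann _ _ (q * E * q).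
  by apply: le_lt_trans (corner _ _ nq nq) _; lra.
have {}nw : nrm w <= 2.
  apply: le_trans nw _; rewrite ler_pdivrMr; have := corner _ _ nq nq; lra.
have M_E : 1 - q * E * q = r + q * z * q by rewrite qzq rE; ncring.
rewrite M_E in Mw wM.
have sw : star w = w.
  apply: inverse_sa Mw wM; rewrite starDr !starMr sr sq sz !mulrA //.
have gamw : q * z * q * w = q.
  have := congr1 (fun a => q * a) Mw.
  by rewrite mulr1 mulrA mulrDr qr add0r !mulrA qq.
have wgam : w * (q * z * q) = q.
  have := congr1 (fun a => a * q) wM.
  by rewrite mul1r -(mulrA w) mulrDl rq add0r -(mulrA _ q q) qq.
pose g := q * w * q.
have gr : g * r = 0 by rewrite -mulrA qr mulr0.
have gq : g * q = g by rewrite -mulrA qq.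
have qg : q * g = g by rewrite !mulrA qq.
have ggam : g * z * q = q.
  have -> : g * z * q = q * (w * (q * z * q)) by rewrite !mulrA.
  by rewrite wgam.
have ng : nrm g <= 2 by apply: nrm_contr => //; apply: nrm_contl.
have sg : star g = g by rewrite !starMr sq sw mulrA.
clearbody g.
pose y := r * z * r - r * z * g * z * r.
have sy : star y = y by rewrite starB !starMr sr sz sg !mulrA.
have sc' : star c = c := inverse_sa sz zc cz.
have yb : y * (r * c * r) = r.
  have h1 : z * r * c = 1 - z * q * c by rewrite -[X in _ = X - _]zc {1}rE; ncring.
  have -> : y * (r * c * r) = r * (z * (r * r) * c) * r -
      r * z * (g * (z * (r * r) * c)) * r by rewrite /y; ncring.
  rewrite rr h1.
  have -> : g * (1 - z * q * c) = g - g * z * q * c by ncring.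
  rewrite ggam.
  have -> : r * (1 - z * q * c) * r - r * z * (g - q * c) * r =
    r * r - r * z * (g * r) by ncring.
  by rewrite gr mulr0 subr0.
exists y, (r * c * r); split => //.
- by rewrite mulrBr !mulrA rr.
- by rewrite !mulrA rr -!mulrA rr.
- by split; rewrite // -[RHS]sr -[in RHS]yb starMr sy !starMr sr sc' !mulrA.
have -> : x - y = r * E * r + (r * E * q) * (g * (q * E * r)).
  have -> : r * E * q = - (r * z * q) by rewrite rzq opprK.
  have -> : q * E * r = - (q * z * r) by rewrite qzr opprK.
  have -> : r * E * r = r * x * r + r * q * r - r * z * r by rewrite /E; ncring.
  rewrite rx xr rq mul0r /y -{1}gq -{1}qg; ncring.
apply: le_trans (nrmD _ _) _.
have := corner _ _ nr nr.
have := nrmM_le (corner _ _ nr nq) (nrmM_le ng (corner _ _ nq nr)).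
have : d' * (2 * d') <= d' by rewrite ler_piMr //; lra.
lra.
Qed.

(** An approximant of [x] invertible in the corner becomes invertible in the algebra after adding d
    (1 - r), and has a sign there. The approximation and this summand each cost [d], whence the
    bound k + 2 d. *)
Lemma corner_sign r x d k : real_rank_zero A -> projection r ->
    star x = x -> r * x = x -> nrm x <= k -> 0 < d ->
  exists X s W, [/\ [/\ star X = X, r * X = X * r & nrm (x - r * X) <= d],
    [/\ star s = s, s * s = 1, r * s = s * r & X * s = s * X],
    [/\ star W = W, W * W = X * s & bicommutes X W],
    bicommutes X s &
    nrm (sc ((k + 2 * d) / 2) - X * s) <= (k + 2 * d) / 2].
Proof.
move=> rr0 pr sx rx xk d0.
have [y [b [sy ry [rb br] [yb by'] xy]]] := corner_rr0_approx rr0 pr sx rx d0.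
have yr := corner_sa pr sy ry; have rr := projM pr; have sr := projS pr.
pose X := y + d%:C *: (1 - r); pose B := b + d^-1%:C *: (1 - r).
have dd : d%:C * d^-1%:C = 1 :> R[i] by rewrite -rmorphM /= mulfV // gt_eqF.
have sX : star X = X by rewrite starDr starZr starB star1 sr sy.
have XB : X * B = 1.
  have -> : X * B = y * b + d^-1%:C *: (y - y * r) + d%:C *: (b - r * b)
    + (d%:C * d^-1%:C) *: (1 - r - r + r * r) by rewrite /X /B; ncring.
  rewrite yb yr rb rr dd; ncring.
have BX : B * X = 1.
  have -> : B * X = b * y + d^-1%:C *: (y - r * y) + d%:C *: (b - b * r)
    + (d%:C * d^-1%:C) *: (1 - r - r + r * r) by rewrite /X /B; ncring.
  rewrite by' ry br rr dd; ncring.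
have rX : r * X = y.
  have -> : r * X = r * y + d%:C *: (r - r * r) by rewrite /X; ncring.
  by rewrite ry rr subrr scaler0 addr0.
have Xr : X * r = y.
  have -> : X * r = y * r + d%:C *: (r - r * r) by rewrite /X; ncring.
  by rewrite yr rr subrr scaler0 addr0.
have nX : nrm X <= k + 2 * d.
  have -> : X = x - (x - y) + d%:C *: (1 - r) by rewrite /X; ncring.
  have := nrmD (x - (x - y)) (d%:C *: (1 - r)); have := nrmB x (x - y).
  rewrite nrmZr gtr0_norm //; have : d * nrm (1 - r) <= d.
    by rewrite ler_piMr ?(nrm_proj (proj_compl pr)) // ltW.
  by lra.
have [s [W [[ss s1 cs] [sW WW cW] h]]] := sign_invertible sX XB BX nX.
exists X, s, W; split => //; first by rewrite rX Xr.
split=> //; [apply: cs | exact: cs].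
by rewrite rX Xr.
Qed.

(** Up to a perturbation, 2 e - r is the sign of [a] in the corner. Subtracting t times the sign
    changes |a| into the absolute value of |a| - t, which is at most k - t as soon as 2 t <= k. *)
Lemma halving r a t k d : real_rank_zero A -> projection r ->
    star a = a -> r * a = a -> nrm a <= k -> 0 <= t -> 2 * t <= k -> 0 < d ->
  exists e, [/\ projection e, r * e = e &
    nrm (a - t%:C *: (2%:C *: e - r)) <= k - t + d].
Proof.
move=> rr0 pr sa ra ak t0 tk d0; have d3 : 0 < d / 3 by lra.
have [X [s [W [[sX rX xX] [ss s1 rs Xs] _ _ h]]]] := corner_sign rr0 pr sa ra ak d3.
have rr := projM pr; have sr := projS pr.
exists ((1/2)%:C *: (r + r * s)); split.
- split; first by rewrite /selfadjoint starZr starDr starMr ss sr rs.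
  have rU : r * (r * s) = r * s by rewrite mulrA rr.
  have Ur : r * s * r = r * s by rewrite -mulrA -rs rU.
  have UU : r * s * (r * s) = r by rewrite mulrA Ur -mulrA s1 mulr1.
  move: (r * s) rU Ur UU => U rU Ur UU.
  rewrite (_ : _ * _ = (1/4)%:C *: (r * r + r * U + U * r + U * U)); last by ncring.
  by rewrite rr rU Ur UU; ncring.
- by rewrite -scalerAr mulrDr mulrA rr.
have -> : a - t%:C *: (2%:C *: ((1 / 2)%:C *: (r + r * s)) - r) =
    (a - r * X) + r * (s * (X * s - sc t)).
  rewrite mulrBr mulrA -Xs -[X * s * s]mulrA s1 mulr1; ncring.
apply: le_trans (nrmD _ _) _.
have h1 : nrm (s * (X * s - sc t)) <= k + 2 * (d / 3) - t.
  apply: nrm_contl; first by rewrite (nrm_symmetry ss s1).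
  rewrite (_ : _ - _ = - (sc ((k + 2 * (d / 3)) / 2) - X * s)
     + sc ((k + 2 * (d / 3)) / 2 - t)); last by ncring.
  apply: le_trans (nrmD _ _) _; rewrite nrmN nrm_sc ger0_norm; lra.
have := nrm_contl (nrm_proj pr) h1; lra.
Qed.

End Signs.

(** * Spectral projections *)

Section Cutting.
Context {R : realType} {A : cstarAlgType R}.
Implicit Types (a b e f g p q r s v w x y z S T V W X : A) (d k t mu : R) (c : R[i]).
Local Notation sc r := (r%:C *: 1).

(** With a, b the real and imaginary parts of [v], the sum a^2 + b^2 is half of
    [star v * v + v * star v], here minus half the sum of two projections. A sum of squares being
    positive, [e] must vanish; positivity is used through [square_bound]. *)
Lemma neg_proj_eq0 e v : projection e -> v * star v = - e -> e = 0.
Proof.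
move=> pe vv; have ee := projM pe; have se := projS pe.
have ev : e * v = v.
  apply/eqP; rewrite eq_sym -subr_eq0; apply/eqP/nrm_eq0/eqP.
  rewrite -sqrf_eq0 -nrm_Mstar starB starMr se.
  rewrite (_ : _ * _ = (1 - e) * (v * star v) * (1 - e)); last by ncring.
  by rewrite vv mulrN mulrBl mul1r ee subrr oppr0 mul0r nrm0.
pose Q := - (star v * v).
have QQ : Q * Q = Q.
  rewrite mulrNN mulrA -(mulrA (star v)) vv mulrN mulNr -mulrA ev //.
have sQ : star Q = Q by rewrite starN starMr starK.
pose a := (1/2)%:C *: (v + star v); pose b := (- (1/2)%:C * 'i%C) *: (v - star v).
have sa : star a = a by rewrite starZr starDr starK addrC.
have sb : star b = b.
  by rewrite /b -scalerA scaleNr starN starZr star_iZ starB starK; ncring.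
have i2 : 'i%C * 'i%C = -1 :> R[i] by rewrite -expr2 sqr_i.
have ab : a * a + b * b = (1/2)%:C *: (- Q - e).
  have -> : b * b = ((1/4)%:C * ('i%C * 'i%C)) *: ((v - star v) * (v - star v)).
    by rewrite /b; ncring.
  rewrite i2 -vv /a /Q; ncring.
have ha := square_bound sa (lexx _); have hb := square_bound sb (lexx _).
have hQ : nrm (sc (1/2) - Q) <= 1/2.
  rewrite -{1}QQ; apply: (square_bound sQ); rewrite QQ.
  exact: nrm_proj (conj sQ QQ).
(* [K] adds up the radii of the three norm estimates. Then K + e/2 has norm at most K, although it
   acts as K + 1/2 on [e]. *)
set K := nrm (a * a) / 2 + nrm (b * b) / 2 + 1/4.
have K0 : 0 <= K by rewrite !addr_ge0 ?divr_ge0 ?nrm_ge0 //; lra.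
have h : nrm (sc K + (1/2)%:C *: e) <= K.
  have -> : sc K + (1/2)%:C *: e = (sc (nrm (a * a) / 2) - a * a) +
    ((sc (nrm (b * b) / 2) - b * b) + (1/2)%:C *: (sc (1/2) - Q)).
    have -> : (1/2)%:C *: e = - (a * a + b * b) - (1/2)%:C *: Q.
      by rewrite ab; ncring.
    by rewrite /K; ncring.
  apply: le_trans (nrmD _ _) _; apply: le_trans (lerD ha (nrmD _ _)) _.
  by rewrite nrm_half /K; lra.
apply: nrm_proj_lt1 => //.
have := nrm_contl (nrm_proj pe) h.
have -> : e * (sc K + (1/2)%:C *: e) = (K + 1/2)%:C *: e.
  rewrite mulrDr -!scalerAr ee mulr1; ncring.
rewrite nrmZr gtr0_norm; last lra.
move=> h2; have : nrm e * (K + 1/2) < 1 * (K + 1/2) by lra.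
by rewrite ltr_pM2r //; lra.
Qed.

(** [h] is S^(-1/2) in the corner of [e]: writing S = mu (e - Y) with |Y| < 1, it is obtained by
    inverting the square root of 1 - Y. *)
Lemma inv_sqrt_corner e S mu : projection e -> star S = S -> e * S = S ->
  nrm (mu%:C *: e - S) < mu -> exists h, [/\ star h = h, e * h = h & h * S * h = e].
Proof.
move=> pe sS eS hS; have mu0 : 0 < mu by apply: le_lt_trans hS; rewrite nrm_ge0.
have ee := projM pe; have se := projS pe; have Se := corner_sa pe sS eS.
have mm : mu%:C * mu^-1%:C = 1 :> R[i] by rewrite -rmorphM /= mulfV // gt_eqF.
pose Y := e - mu^-1%:C *: S.
have sY : star Y = Y by rewrite starB starZr se sS.
have eY : e * Y = Y by rewrite mulrBr ee -scalerAr eS.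
have Ye : Y * e = Y by rewrite mulrBl ee -scalerAl Se.
have nY : nrm Y < 1.
  have -> : Y = mu^-1%:C *: (mu%:C *: e - S).
    by rewrite scalerBr scalerA mulrC mm scale1r.
  by rewrite nrmZr gtr0_norm ?invr_gt0 // mulrC ltr_pdivrMr // mul1r.
have [z [sz nz zz cz]] := sqrt_one_sub sY nY.
have [w [zw wz _ cw]] := neumann (le_lt_trans nz nY).
have s1z : star (1 - z) = 1 - z by rewrite starB star1 sz.
have sw := inverse_sa s1z zw wz.
have ew : e * w = w * e by apply/cw/cz; rewrite eY Ye.
have SE : S = mu%:C *: (e * ((1 - z) * (1 - z))).
  by rewrite zz mulrBr mulr1 eY /Y subKr scalerA mm scale1r.
pose u := (Num.sqrt mu)^-1; have uu : u%:C * u%:C * mu%:C = 1 :> R[i].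
  by rewrite -!rmorphM /= -expr2 exprVn sqr_sqrtr ?ltW // mulVf // gt_eqF.
exists (u%:C *: (e * w)); split.
- by rewrite starZr starMr se sw ew.
- by rewrite -scalerAr mulrA ee.
have -> : u%:C *: (e * w) * S * (u%:C *: (e * w)) =
  (u%:C * u%:C * mu%:C) *: (e * w * (e * ((1 - z) * (1 - z))) * (e * w)).
  by rewrite SE; move: (1 - z) => o; ncring.
rewrite uu scale1r [X in _ * X = _]ew; move: (1 - z) zw wz => o zw wz.
have -> : e * w * (e * (o * o)) * (w * e) = e * (w * e) * o * (o * w) * e.
  by rewrite !mulrA.
by rewrite zw mulr1 -ew !mulrA ee -(mulrA e w) wz mulr1 ee.
Qed.

End Cutting.

Section Cutting2.
Context {R : realType} {A : cstarAlgType R}.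
Implicit Types (a b c e f g p q r s v w x y z S T V W X : A) (d k t mu eta : R).
Local Notation sc r := (r%:C *: 1).

(* If the negative part of [y y^*] were nonzero, compressing to it and
   normalizing would give [v v^* = - e] with [e] a nonzero projection. *)
Lemma mul_star_bound y k : real_rank_zero A -> nrm (y * star y) <= k ->
  nrm (sc (k / 2) - y * star y) <= k / 2.
Proof.
move=> rr0; have [T TE] : exists T, T = y * star y by exists (y * star y).
rewrite -TE => yk.
have k0 : 0 <= k := le_trans (nrm_ge0 _) yk.
have sT : star T = T by rewrite TE starMr starK.
apply/ler_addgt0Pr => eta' eta'0; pose eta := eta' / 2.
have eta0 : 0 < eta by rewrite /eta; lra.
have p1 := proj_one (A := A).
have xk : nrm (T + sc eta) <= k + eta.
  by apply: le_trans (nrmD _ _) _; rewrite nrm_sc gtr0_norm // lerD2r.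
have sx : star (T + sc eta) = T + sc eta by rewrite starDr star_sc sT.
have [||X [s [W [[sX _ xX] [ss s1 _ Xs] [sW WW cW] _ h]]]] :=
  @corner_sign _ _ 1 (T + sc eta) (eta / 2) (k + eta) rr0 p1 sx _ xk.
- by rewrite mul1r.
- by lra.
rewrite mul1r in xX.
have sWc : s * W = W * s by apply: cW.
pose e := (1/2)%:C *: (1 - s).
have pe : projection e.
  split; first by rewrite /selfadjoint starZr starB star1 ss.
  rewrite (_ : e * e = (1/4)%:C *: (1 - s - s + s * s)); last by rewrite /e; ncring.
  by rewrite s1 /e; ncring.
have es : e * s = - e.
  rewrite (_ : e * s = (1/2)%:C *: (s - s * s)); last by rewrite /e; ncring.
  by rewrite s1 /e; ncring.
have se' : s * e = - e.
  rewrite (_ : s * e = (1/2)%:C *: (s - s * s)); last by rewrite /e; ncring.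
  by rewrite s1 /e; ncring.
have ne := nrm_proj pe; have ee := projM pe; have se := projS pe.
have kE : (k + eta + 2 * (eta / 2)) / 2 = k / 2 + eta by lra.
rewrite kE in h.
have XW : X = W * W * s by rewrite WW -mulrA s1 mulr1.
(* On [e], X is negative and T is within eta/2 of X - eta. The shift by eta thus bounds [S] below,
   which makes it invertible in the corner of [e]. *)
pose S := - (e * T * e).
have [|||h' [sh eh hS]] := @inv_sqrt_corner _ _ e S (k / 2 + 2 * eta) pe.
- by rewrite starN !starMr sT se mulrA.
- by rewrite mulrN !mulrA ee.
- have -> : (k / 2 + 2 * eta)%:C *: e - S =
      e * (sc (k / 2 + eta) - X * s) * e + e * (T + sc eta - X) * e.
    have -> : e * (sc (k / 2 + eta) - X * s) * e =
        (k / 2 + eta)%:C *: (e * e) - e * X * (s * e) by ncring.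
    rewrite se' ee (_ : e * (T + sc eta - X) * e =
        e * T * e + eta%:C *: (e * e) - e * X * e); last by ncring.
    by rewrite ee /S; ncring.
  apply: le_lt_trans (nrmD _ _) _.
  have := nrm_contr ne (nrm_contl ne h).
  have := nrm_contr ne (nrm_contl ne xX).
  lra.
have e0 : e = 0.
  apply: (@neg_proj_eq0 _ _ e (h' * y) pe).
  rewrite starMr sh (_ : _ * _ = h' * T * h'); last by rewrite TE !mulrA.
  have he : h' * e = h' by rewrite -sh -{1}se -starMr eh.
  by rewrite -[in RHS]hS /S mulrN mulNr opprK !mulrA he -[RHS]mulrA eh.
have s_1 : s = 1.
  have := congr1 (fun a => (2%:C : R[i]) *: a) e0; rewrite scaler0 /e => h0.
  by apply/eqP; rewrite eq_sym -subr_eq0 -h0; apply/eqP; ncring.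
rewrite s_1 mulr1 in h.
have -> : sc (k / 2) - T = (sc (k / 2 + eta) - X) - (T + sc eta - X) by ncring.
apply: le_trans (nrmB _ _) _; rewrite /eta in eta0 h xX *; lra.
Qed.

(* [e] is a spectral projection of [y y^*] for an interval [eta, oo), up to a
   small perturbation of [y y^*]. *)
Lemma spectral_cut r y d : real_rank_zero A -> projection r -> r * y = y -> 0 < d ->
  exists e c, [/\ projection e, r * e = e, c * y * star (c * y) = e &
    nrm ((r - e) * y) <= d].
Proof.
move=> rr0 pr ry d0.
have rr := projM pr; have sr := projS pr; have nr := nrm_proj pr.
have [T TY] : exists T, T = y * star y by exists (y * star y).
have sT : star T = T by rewrite TY starMr starK.
have rT : r * T = T by rewrite TY mulrA ry.
have Tr : T * r = T := corner_sa pr sT rT.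
(* The square of the final norm will be at most (2 + 1 + 1/2) eta, hence at most d^2. *)
pose eta := d ^+ 2 / 4; have eta0 : 0 < eta by rewrite divr_gt0 ?exprn_gt0.
have eta2 : 0 < eta / 2 by lra.
pose k := nrm T + eta.
have xk : nrm (T - eta%:C *: r) <= k.
  apply: le_trans (nrmB _ _) _; rewrite nrmZr gtr0_norm // lerD2l.
  by rewrite ler_piMr // ltW.
have sx : star (T - eta%:C *: r) = T - eta%:C *: r by rewrite starB starZr sT sr.
have rx : r * (T - eta%:C *: r) = T - eta%:C *: r.
  by rewrite mulrBr -scalerAr rT rr.
have [X [s [W [[sX rX xX] [ss s1 rs Xs] [sW WW cW] _ h]]]] :=
  corner_sign rr0 pr sx rx xk eta2.
have kE : (k + 2 * (eta / 2)) / 2 = nrm T / 2 + eta by rewrite /k; lra.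
rewrite kE in h.
have sWc : s * W = W * s by apply: cW.
have rW : r * W = W * r by apply: cW.
have XW : X = W * W * s by rewrite WW -mulrA s1 mulr1.
set err := _ - r * X in xX.
have TE : T = r * X + eta%:C *: r + err by rewrite /err; ncring.
pose e := (1/2)%:C *: (r + r * s).
have rsr : r * s * r = r * s by rewrite -mulrA -rs mulrA rr.
have re : r * e = e by rewrite -scalerAr mulrDr mulrA rr.
have er : e * r = e by rewrite -scalerAl mulrDl rr rsr.
have es : e * s = e by rewrite -scalerAl mulrDl -mulrA s1 mulr1 addrC.
have sse : s * e = e.
  by rewrite -scalerAr mulrDr mulrA -rs -[r * s * s]mulrA s1 mulr1 addrC.
have se : star e = e by rewrite starZr starDr starMr ss sr -rs.
have ee : e * e = e.
  rewrite {2}/e -scalerAr mulrDr mulrA er es; ncring.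
have pe : projection e by [].
have ne := nrm_proj pe.
pose S := e * T * e.
have SE : S = e * (X * s) * e + eta%:C *: e + e * err * e.
  rewrite /S TE (_ : _ * e = e * r * X * e + eta%:C *: (e * r * e) + e * err * e).
    rewrite er ee (_ : e * (X * s) * e = e * X * (s * e)); last by rewrite !mulrA.
    by rewrite sse.
  by ncring.
have [|||c [sc' ec cS]] := @inv_sqrt_corner _ _ e S (nrm T / 2 + eta + eta) pe.
- by rewrite !starMr sT se mulrA.
- by rewrite !mulrA ee.
- have -> : (nrm T / 2 + eta + eta)%:C *: e - S =
      e * (sc (nrm T / 2 + eta) - X * s) * e - e * err * e.
    rewrite SE (_ : e * (sc _ - _) * e = (nrm T / 2 + eta)%:C *: (e * e) -
      e * (X * s) * e); last by ncring.
    by rewrite ee; ncring.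
  apply: le_lt_trans (nrmB _ _) _.
  have := nrm_contr ne (nrm_contl ne h).
  have := nrm_contr ne (nrm_contl ne xX).
  lra.
exists e, c; split => //.
  rewrite starMr sc' (_ : _ * _ = c * T * c); last by rewrite TY !mulrA.
  have ce : c * e = c by rewrite -sc' -{1}se -starMr ec.
  by rewrite -[in RHS]cS /S !mulrA ce -[RHS]mulrA ec.
pose f := r - e.
have sf : star f = f by rewrite starB sr se.
have fr : f * r = f by rewrite mulrBl rr er.
have ff : f * f = f by rewrite mulrBr fr mulrBl re ee subrr subr0.
have pf : projection f by [].
have nf := nrm_proj pf.
have fs : f * s = - f.
  rewrite mulrBl es /f /e; ncring.
have sf' : s * f = - f.
  rewrite mulrBr sse -rs /f /e; ncring.
have eW : e * W = W * e.
  rewrite -scalerAl -scalerAr mulrDl mulrDr rW -mulrA sWc mulrA rW -mulrA //.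
have fW : f * W = W * f by rewrite mulrBl mulrBr rW eW.
have Xe : X * e = e * X.
  by rewrite -scalerAr -scalerAl mulrDr mulrDl mulrA -rX -mulrA Xs mulrA.
have Xf : X * f = f * X by rewrite mulrBr mulrBl Xe rX.
have fXs : f * (X * s) = - (f * X) by rewrite mulrA -Xf -mulrA fs mulrN Xf.
(* Positivity of [T] makes [Z] a square V^2. Under [f], where |X| = - X, the squares of f W and f V
   add up to 2 eta f, so that f W is small. *)
pose Z := r * X + sc (2 * eta).
have sZ : star Z = Z by rewrite starDr star_sc starMr sX sr -rX.
have [|V [sV VV cV _]] := @sqrt_pos _ _ Z (nrm T / 2 + 2 * eta) sZ.
  have -> : sc (nrm T / 2 + 2 * eta) - Z = (sc (nrm T / 2) - T) + (eta%:C *: r + err).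
    by rewrite [X in _ = _ - X + _]TE /Z; ncring.
  apply: le_lt_trans (nrmD _ _) _.
  have := @mul_star_bound y (nrm T) rr0; rewrite -TY lexx => /(_ isT) hT.
  have := nrmD (eta%:C *: r) err; rewrite nrmZr gtr0_norm //.
  have : eta * nrm r <= eta by rewrite ler_piMr // ltW.
  lra.
have cVX b : b * r = r * b -> b * X = X * b -> b * V = V * b.
  move=> br bX; apply: cV; rewrite /Z.
  have -> : b * (r * X + sc (2 * eta)) = b * r * X + (2 * eta)%:C *: b by ncring.
  by rewrite br -mulrA bX; ncring.
have fV : f * V = V * f.
  by apply: cVX; rewrite ?Xf // fr mulrBr rr re.
have WV : W * V = V * W by apply: cVX; rewrite ?rW // XW !mulrA -!mulrA -sWc !mulrA.
have sqf P : f * P = P * f -> f * P * (f * P) = f * (P * P).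
  by move=> fP; rewrite -(mulrA f) (mulrA P) -fP !mulrA ff.
have PQ : nrm (f * W) ^+ 2 <= 2 * eta.
  apply: (@le_trans _ _ (nrm ((f * W) * (f * W) + (f * V) * (f * V)))).
    apply: normal_re_bound; rewrite ?starMr ?sf ?sW ?sV //.
    by rewrite -!mulrA (mulrA W) -fW (mulrA V) -fV -!mulrA WV.
  rewrite (sqf _ fW) (sqf _ fV) WW VV /Z.
  have -> : f * (X * s) + f * (r * X + sc (2 * eta)) =
     X * f * s + f * r * X + (2 * eta)%:C *: f by rewrite Xf; ncring.
  rewrite -mulrA fs fr mulrN Xf addNr add0r nrmZr gtr0_norm; last lra.
  by rewrite ler_piMr //; lra.
rewrite -ler_sqr ?nnegrE ?nrm_ge0 ?(ltW d0) // -nrm_Mstar starMr sf.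
rewrite (_ : _ * _ = f * T * f); last by rewrite TY !mulrA.
have -> : f * T * f = - (f * W * (f * W)) + (eta%:C *: f + f * err * f).
  rewrite (sqf _ fW) WW -mulrA TE.
  have -> : f * ((r * X + eta%:C *: r + err) * f) =
    f * r * X * f + eta%:C *: (f * r * f) + f * err * f by ncring.
  rewrite fr fXs ff -(mulrA f X) Xf (mulrA f f) ff; ncring.
apply: le_trans (nrmD _ _) _; rewrite nrmN.
have := nrmD (eta%:C *: f) (f * err * f); rewrite nrmZr gtr0_norm //.
have : eta * nrm f <= eta by rewrite ler_piMr // ltW.
have := nrm_contr nf (nrm_contl nf xX).
have : nrm (f * W * (f * W)) <= 2 * eta.
  by apply: le_trans PQ; rewrite expr2 nrmM.
have : d ^+ 2 = 4 * eta by rewrite /eta; lra.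
lra.
Qed.

End Cutting2.

(** * Linear combinations of projections *)

Section ProjectionCombinations.
Context {R : realType} {A : cstarAlgType R}.
Implicit Types (a b e p q r s v w x y z E H J X Y : A) (d k t M : R) (c : R[i]).
Implicit Types (n N : nat).

(** With lists, a sum of combinations is a concatenation: the lengths add and the bound on
    coefficients is shared. *)
Definition proj_comb N M a := exists s : seq (R[i] * A),
  [/\ (size s <= N)%N, forall u, u \in s -> cabs u.1 <= M /\ projection u.2 &
      a = \sum_(u <- s) u.1 *: u.2].

Lemma proj_comb0 N M : proj_comb N M 0.
Proof. by exists [::]; split => //; rewrite big_nil. Qed.

Lemma proj_comb_proj p : projection p -> proj_comb 1 1 p.
Proof.
move=> pp; exists [:: (1, p)]; split => //; last by rewrite big_seq1 scale1r.
by move=> u; rewrite inE => /eqP -> /=; rewrite (cabs_real 1) normr1.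
Qed.

Lemma proj_comb_mono N N' M M' a : (N <= N')%N -> M <= M' ->
  proj_comb N M a -> proj_comb N' M' a.
Proof.
move=> NN MM [s [sN sp ->]]; exists s; split => //; first exact: leq_trans sN NN.
by move=> u /sp [uM up]; split => //; exact: le_trans uM MM.
Qed.

Lemma proj_combD N N' M a b : proj_comb N M a -> proj_comb N' M b ->
  proj_comb (N + N') M (a + b).
Proof.
move=> [s [sN sp ->]] [s' [sN' sp' ->]]; exists (s ++ s'); split.
- by rewrite size_cat leq_add.
- by move=> u; rewrite mem_cat => /orP[/sp|/sp'].
by rewrite big_cat.
Qed.

Lemma proj_combZ c N M a : proj_comb N M a -> proj_comb N (cabs c * M) (c *: a).
Proof.
move=> [s [sN sp ->]]; exists [seq (c * u.1, u.2) | u <- s]; split.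
- by rewrite size_map.
- move=> _ /mapP[u /sp [uM up] ->] /=; split => //.
  by rewrite cabsM ler_wpM2l ?cabs_ge0.
by rewrite big_map scaler_sumr; apply: eq_bigr => u _; rewrite scalerA.
Qed.

Lemma proj_combN N M a : proj_comb N M a -> proj_comb N M (- a).
Proof.
move/(proj_combZ (-1)); rewrite scaleN1r cabsN (_ : cabs 1 = 1) ?mul1r //.
by rewrite (cabs_real 1) normr1.
Qed.

Lemma proj_combB N N' M a b : proj_comb N M a -> proj_comb N' M b ->
  proj_comb (N + N') M (a - b).
Proof. by move=> ha hb; apply: proj_combD ha (proj_combN hb). Qed.

Lemma proj_comb_sum (I : Type) (s : seq I) N M (F : I -> A) :
  (forall i, proj_comb N M (F i)) ->
  proj_comb (size s * N) M (\sum_(i <- s) F i).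
Proof.
move=> h; elim: s => [|i s IHs]; first by rewrite big_nil; exact: proj_comb0.
by rewrite big_cons mulSn; apply: proj_combD.
Qed.

Lemma proj_comb_sum_ord n N M (F : 'I_n -> A) :
  (forall i, proj_comb N M (F i)) -> proj_comb (n * N) M (\sum_i F i).
Proof. by move=> h; have := proj_comb_sum (index_enum 'I_n) h; rewrite /index_enum -enumT size_enum_ord. Qed.

(* For a symmetry [J] anticommuting with [H], both elements
   [J sqrt(1 - 4 H^2) +- 2 H] are symmetries. *)
Lemma anticommuting_proj_comb J H : star J = J -> J * J = 1 -> star H = H ->
  J * H = - (H * J) -> nrm H <= 1 / 4 -> proj_comb 2 (1/2) H.
Proof.
move=> sJ J1 sH JH hH.
have sHH : star (4%:C *: (H * H)) = 4%:C *: (H * H) by rewrite starZr starMr sH.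
have nHH : nrm (4%:C *: (H * H)) < 1.
  rewrite nrmZr gtr0_norm; last by lra.
  by have := nrmM_le hH hH; lra.
have [z [sz _ zz cz]] := sqrt_one_sub sHH nHH.
pose o := 1 - z; have so : star o = o by rewrite starB star1 sz.
have oH : o * H = H * o.
  rewrite mulrBr mulrBl mulr1 mul1r -cz // -scalerAr -scalerAl !mulrA //.
have oJ : o * J = J * o.
  rewrite mulrBr mulrBl mulr1 mul1r -cz // -scalerAr -scalerAl.
  by rewrite mulrA JH mulNr -mulrA JH mulrN opprK mulrA.
have sq (H' : A) : star H' = H' -> J * H' = - (H' * J) -> o * H' = H' * o ->
    H' * H' = H * H -> projection ((1/2)%:C *: (1 + (J * o + 2%:C *: H'))).
  move=> sH' JH' oH' H'H; set U := J * o + _.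
  have sU : star U = U by rewrite starDr starZr starMr so sJ oJ sH'.
  have UU : U * U = 1.
    have -> : U * U = J * (o * J) * o + 2%:C *: (J * (o * H') + (H' * J) * o)
        + 4%:C *: (H' * H') by rewrite /U; ncring.
    rewrite oJ oH' (mulrA J H') JH' mulNr addNr scaler0 addr0 !mulrA J1 mul1r.
    by rewrite zz H'H subrK.
  split; first by rewrite /selfadjoint starZr starDr star1 sU.
  rewrite (_ : _ * _ = (1/4)%:C *: (1 + U + U + U * U)); last by ncring.
  by rewrite UU; ncring.
have hp := sq H sH JH oH erefl.
have hm : projection ((1/2)%:C *: (1 + (J * o + 2%:C *: - H))).
  by apply: sq; rewrite ?starN ?sH // ?mulrN ?mulNr ?JH ?oH // opprK.
have HD : H = (1/2)%:C *: ((1/2)%:C *: (1 + (J * o + 2%:C *: H))) -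
   (1/2)%:C *: ((1/2)%:C *: (1 + (J * o + 2%:C *: - H))) by ncring.
have half p : projection p -> proj_comb 1 (1/2) ((1/2)%:C *: p).
  move/proj_comb_proj/(proj_combZ (1/2)%:C); apply: proj_comb_mono => //.
  by rewrite cabs_real ger0_norm; lra.
by rewrite HD; apply: (@proj_combB 1 1); apply: half.
Qed.

(** The symmetry 2 E - 1 anticommutes with elements off-diagonal for [E]. Dividing by 8 |y| brings y
    + y^* to norm at most 1/4; multiplying back turns the coefficients 1/2 into 4 |y|. *)
Lemma hermitian_offdiag_proj_comb E y : projection E -> E * y = y -> y * E = 0 ->
  proj_comb 2 (4 * nrm y) (y + star y).
Proof.
move=> pE Ey yE; have sE := projS pE; have EE := projM pE.
have [->|y0] := eqVneq y 0; first by rewrite star0 addr0; apply: proj_comb0.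
have ny : 0 < nrm y.
  by rewrite lt_neqAle nrm_ge0 andbT eq_sym; apply: contraNneq y0 => /nrm_eq0 ->.
have yE' : star y * E = star y by rewrite -{1}sE -starMr Ey.
have Ey' : E * star y = 0 by rewrite -{1}sE -starMr yE star0.
have l0 : 0 < (8 * nrm y)^-1 by rewrite invr_gt0; lra.
have h : proj_comb 2 (1/2) ((8 * nrm y)^-1%:C *: (y + star y)).
  apply: (@anticommuting_proj_comb (2%:C *: E - 1)).
  - by rewrite starB starZr sE star1.
  - rewrite (_ : _ * _ = 4%:C *: (E * E) - 4%:C *: E + 1); last by ncring.
    by rewrite EE subrr add0r.
  - by rewrite starZr starDr starK addrC.
  - move: ((8 * nrm y)^-1%:C) => l.
    rewrite (_ : _ * _ = l *: (2%:C *: (E * y + E * star y) - y - star y)); last by ncring.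
    rewrite (_ : _ * (_ - 1) = l *: (2%:C *: (y * E + star y * E) - y - star y)); last by ncring.
    by rewrite Ey Ey' yE yE'; ncring.
  rewrite nrmZr gtr0_norm //; have := nrmD y (star y); rewrite nrm_star => hy.
  rewrite ler_pdivrMl; last lra.
  by lra.
have := proj_combZ (8 * nrm y)%:C h; rewrite scalerA -rmorphM /= divff; last first.
  by rewrite mulf_neq0 ?gt_eqF //; lra.
rewrite scale1r; apply: proj_comb_mono => //; rewrite cabs_real ger0_norm; lra.
Qed.

Lemma offdiag_proj_comb E y : projection E -> E * y = y -> y * E = 0 ->
  proj_comb 4 (2 * nrm y) y.
Proof.
move=> pE Ey yE.
have h1 := hermitian_offdiag_proj_comb pE Ey yE.
have h2 : proj_comb 2 (4 * nrm y) ('i%C *: y + star ('i%C *: y)).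
  have := @hermitian_offdiag_proj_comb E ('i%C *: y) pE.
  by rewrite -scalerAr Ey -scalerAl yE scaler0 nrmZ cabs_i mul1r; apply.
have i2 : 'i%C * 'i%C = -1 :> R[i] by rewrite -expr2 sqr_i.
have yD : y = (1/2)%:C *: (y + star y) - ((1/2)%:C * 'i%C) *: ('i%C *: y + star ('i%C *: y)).
  rewrite star_iZ (_ : _ *: ('i%C *: y - _) = ((1/2)%:C * ('i%C * 'i%C)) *: (y - star y)).
    by rewrite i2; ncring.
  by ncring.
rewrite [X in proj_comb _ _ X]yD; apply: (@proj_combB 2 2).
  have := proj_combZ (1/2)%:C h1; apply: proj_comb_mono => //.
  by rewrite cabs_real ger0_norm; lra.
have := proj_combZ ((1/2)%:C * 'i%C) h2; apply: proj_comb_mono => //.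
by rewrite cabsM cabs_i mulr1 cabs_real ger0_norm; lra.
Qed.

(* [p Y - Y p] is off-diagonal with respect to [p], so the linear span of the
   projections is a Lie ideal. *)
Lemma commutator_proj_comb N M X Y : proj_comb N M X ->
  proj_comb (N * 8) (M * (2 * nrm Y)) (X * Y - Y * X).
Proof.
move=> [s [sN sp ->]].
have comm p : projection p -> proj_comb 8 (2 * nrm Y) (p * Y - Y * p).
  move=> pp; have pq := proj_compl pp; have np := nrm_proj pp; have nq := nrm_proj pq.
  have pp' := projM pp.
  have qq : (1 - p) * p = 0 by rewrite mulrBl mul1r pp' subrr.
  have qq' : p * (1 - p) = 0 by rewrite mulrBr mulr1 pp' subrr.
  have -> : p * Y - Y * p = p * Y * (1 - p) - (1 - p) * Y * p by ncring.
  apply: (@proj_combB 4 4).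
    apply: (@proj_comb_mono 4 _ (2 * nrm (p * Y * (1 - p)))) => //.
      by rewrite ler_pM2l //; apply: nrm_contr => //; apply: nrm_contl.
    apply: (offdiag_proj_comb pp); first by rewrite !mulrA pp'.
    by rewrite -(mulrA _ (1 - p)) qq mulr0.
  apply: (@proj_comb_mono 4 _ (2 * nrm ((1 - p) * Y * p))) => //.
    by rewrite ler_pM2l //; apply: nrm_contr => //; apply: nrm_contl.
  apply: (offdiag_proj_comb pq); first by rewrite !mulrA (projM pq).
  by rewrite -(mulrA _ p) qq' mulr0.
apply: (@proj_comb_mono (size s * 8)) (lexx _) _; first by rewrite leq_mul2r sN orbT.
rewrite mulr_suml mulr_sumr -sumrB big_seq.
elim: s {sN} sp => [|u s IHs] sp; first by rewrite big_nil; apply: proj_comb0.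
rewrite -big_seq big_cons mulSn big_seq; apply: proj_combD; last first.
  by apply: IHs => v vs; apply: sp; rewrite inE vs orbT.
have [uM up] := sp u (mem_head _ _).
have -> : u.1 *: u.2 * Y - Y * (u.1 *: u.2) = u.1 *: (u.2 * Y - Y * u.2) by ncring.
have := proj_combZ u.1 (comm _ up); apply: proj_comb_mono => //.
by rewrite ler_wpM2r // mulr_ge0 ?nrm_ge0.
Qed.

Lemma offdiag_commutator_proj_comb E X Y : projection E -> E * X = X -> X * E = 0 ->
  proj_comb 32 (4 * (nrm X * nrm Y)) (X * Y - Y * X).
Proof.
move=> pE EX XE; have := commutator_proj_comb Y (offdiag_proj_comb pE EX XE).
by apply: proj_comb_mono => //; rewrite mulrACA (_ : 2 * 2 = 4) //; lra.
Qed.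

End ProjectionCombinations.

(** * Tracial states *)

Section Traces.
Context {R : realType} {A : cstarAlgType R}.
Implicit Types (a b e p q r s v w x y : A) (d k t : R) (c : R[i]) (tau : A -> R[i]).
Local Notation sc r := (r%:C *: 1).

Definition tr tau a : R := complex.Re (tau a).

Section TracialState.
Context {tau : A -> R[i]} (T : tracial_state tau).

Lemma tauD a b : tau (a + b) = tau a + tau b.
Proof. by case: T => lin _ _ _; rewrite -[a]scale1r lin mul1r scale1r. Qed.

Lemma tau0 : tau 0 = 0.
Proof. by apply: (addrI (tau 0)); rewrite -tauD !addr0. Qed.

Lemma tauZ c a : tau (c *: a) = c * tau a.
Proof. by case: T => lin _ _ _; rewrite -[c *: a]addr0 lin tau0 addr0. Qed.

Lemma tauN a : tau (- a) = - tau a.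
Proof. by rewrite -scaleN1r tauZ mulN1r. Qed.

Lemma tauB a b : tau (a - b) = tau a - tau b.
Proof. by rewrite tauD tauN. Qed.

Lemma tauC a b : tau (a * b) = tau (b * a).
Proof. by case: T. Qed.

Lemma tau1 : tau 1 = 1.
Proof. by case: T. Qed.

Lemma tau_ge0 a : 0 <= tau (star a * a).
Proof. by case: T. Qed.

Lemma trD a b : tr tau (a + b) = tr tau a + tr tau b.
Proof. by rewrite /tr tauD; case: (tau a) (tau b) => x y []. Qed.

Lemma tr0 : tr tau 0 = 0.
Proof. by rewrite /tr tau0. Qed.

Lemma trN a : tr tau (- a) = - tr tau a.
Proof. by rewrite /tr tauN; case: (tau a). Qed.

Lemma trB a b : tr tau (a - b) = tr tau a - tr tau b.
Proof. by rewrite trD trN. Qed.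

Lemma trZ t a : tr tau (t%:C *: a) = t * tr tau a.
Proof. by rewrite /tr tauZ; case: (tau a) => x y /=; rewrite mul0r subr0. Qed.

Lemma tr1 : tr tau 1 = 1.
Proof. by rewrite /tr tau1. Qed.

Lemma trC a b : tr tau (a * b) = tr tau (b * a).
Proof. by rewrite /tr tauC. Qed.

Lemma tr_sum (I : Type) (s : seq I) (P : pred I) (F : I -> A) :
  tr tau (\sum_(i <- s | P i) F i) = \sum_(i <- s | P i) tr tau (F i).
Proof. by elim/big_ind2: _ => [|a u b v <- <-|//]; rewrite ?tr0 ?trD. Qed.

Lemma tr_ge0 a : 0 <= tr tau (star a * a).
Proof. by have := tau_ge0 a; rewrite lecE => /andP[]. Qed.

Lemma tr_proj_ge0 p : projection p -> 0 <= tr tau p.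
Proof. by move=> [sp pp]; have := tr_ge0 p; rewrite sp pp. Qed.

Lemma tr_mvn v : tr tau (star v * v) = tr tau (v * star v).
Proof. exact: trC. Qed.

(** A multiple of 1 minus [x] is the square of a self-adjoint element, whose trace is real. *)
Lemma tau_sa x : star x = x -> tau x = (tr tau x)%:C.
Proof.
move=> sx; pose K := nrm x + 1.
have [||V [sV VV _ _]] := @sqrt_pos _ _ (sc K - x) K.
- by rewrite starB star_sc sx.
- by rewrite opprB addrCA subrr addr0 ltrDl.
have := tau_ge0 V; rewrite sV VV tauB tauZ tau1 mulr1 /tr.
case: (tau x) => u w; by rewrite lecE /= sub0r oppr_eq0 => /andP[/eqP -> _].
Qed.

(** If V^2 = K - x then V commutes with [r], and K r - x is the square of V r. The trace of the
    support [r] in the bound, instead of 1, is what makes remainders in a small corner negligible in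
    trace. *)
Lemma tr_le r x : projection r -> star x = x -> r * x = x ->
  tr tau x <= nrm x * tr tau r.
Proof.
move=> pr sx rx; have rr := projM pr; have sr := projS pr.
have xr := corner_sa pr sx rx; have tr0' := tr_proj_ge0 pr.
apply/ler_addgt0Pr => e e0; pose d := e / (tr tau r + 1).
have d0 : 0 < d by rewrite divr_gt0 // ltr_wpDl.
have dE : e = d * (tr tau r + 1) by rewrite mulfVK // gt_eqF // ltr_wpDl.
pose K := nrm x + d.
have [||V [sV VV cV _]] := @sqrt_pos _ _ (sc K - x) K.
- by rewrite starB star_sc sx.
- by rewrite opprB addrCA subrr addr0 ltrDl.
have rV : r * V = V * r by apply: cV; rewrite mulrBr mulrBl rx xr; ncring.
have := tr_ge0 (V * r); rewrite starMr sV sr.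
have -> : r * V * (V * r) = K%:C *: r - x.
  have -> : r * V * (V * r) = r * (V * V) * r by rewrite !mulrA.
  rewrite VV (_ : r * _ * r = K%:C *: (r * r) - r * x * r); last by ncring.
  by rewrite rr rx xr.
rewrite trB trZ /K dE; nra.
Qed.

Lemma tr_abs_le r x : projection r -> star x = x -> r * x = x ->
  `|tr tau x| <= nrm x * tr tau r.
Proof.
move=> pr sx rx; rewrite ler_norml tr_le // andbT lerNl -trN -nrmN.
by apply: tr_le; rewrite ?starN ?sx // mulrN rx.
Qed.

Lemma tr_bound x : `|tr tau x| <= nrm x.
Proof.
have [h [g [sh sg xE hx _]]] := selfadjoint_parts x.
have -> : tr tau x = tr tau h.
  rewrite {1}xE trD -[RHS]addr0; congr (_ + _).
  by rewrite /tr tauZ (tau_sa sg) /=; ring.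
apply: le_trans (tr_abs_le (proj_one (A := A)) sh _) _; first by rewrite mul1r.
by rewrite tr1 mulr1.
Qed.

Lemma tau_bound x : cabs (tau x) <= 2 * nrm x.
Proof.
apply: le_trans (cabs_ReIm _) _; have := tr_bound x.
have := tr_bound ((- 'i%C) *: x); rewrite nrmZ cabsN cabs_i mul1r {1}/tr tauZ.
have -> : complex.Re (- 'i%C * tau x) = complex.Im (tau x).
  by case: (tau x) => u w /=; ring.
by rewrite /tr; lra.
Qed.

End TracialState.

Lemma comparison_tr p q : strict_comparison A -> projection p -> projection q ->
    (forall tau, tracial_state tau -> tr tau p < tr tau q) ->
  exists v, star v * v = p /\ q * (v * star v) = v * star v.
Proof.
move=> [_ cmp] pp pq h.
have [tau T|r [[v [vp vr]] [_ qr] _]] := cmp p q pp pq; last first.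
  by exists v; rewrite vr.
by rewrite (tau_sa T (projS pp)) (tau_sa T (projS pq)) ltcR; exact: h.
Qed.

End Traces.

(** * Limits along an ultrafilter *)

Section UltraLimits.
Context {R : realType} {U : set_system nat} {UU : UltraFilter U}.
Implicit Types (x : nat -> R) (z : nat -> R[i]).

(** Ultralimits stand in for weak* compactness of the trace space: bounded sequences converge along
    [U] at all elements of the algebra simultaneously. *)
Definition ulim z (l : R[i]) :=
  forall e : R, 0 < e -> U [set n | cabs (z n - l) < e].

Lemma ulim_real_exists x (B : R) : (forall n, `|x n| <= B) ->
  exists l, forall e, 0 < e -> U [set n | `|x n - l| < e].
Proof.
move=> xB; pose S := [set t | U [set n | t <= x n]].
have S1 : S (- B) by apply: filterS filterT => n _ /=; have := xB n; rewrite ler_norml => /andP[].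
have S2 : ubound S B.
  move=> t St; have [n /= tn] := filter_ex St.
  by apply: le_trans tn _; have := xB n; rewrite ler_norml => /andP[].
have hS : has_sup S by split; [exists (- B) | exists B].
exists (sup S) => e e0.
have h1 : U [set n | x n < sup S + e].
  have [h|] := in_ultra_setVsetC [set n | x n < sup S + e] UU; first by [].
  move=> h; have : S (sup S + e).
    by apply: filterS h => n /= /negP; rewrite -leNgt.
  by move/(ub_le_sup (ex_intro _ B S2)); lra.
have [t St lt_t] := sup_adherent e0 hS.
apply: filterS2 h1 St => n /= h2 h3; rewrite ltr_norml; lra.
Qed.

Lemma ulim_exists z (B : R) : (forall n, cabs (z n) <= B) -> exists l, ulim z l.
Proof.
move=> zB.
have [|l1 h1] := @ulim_real_exists (fun n => complex.Re (z n)) B.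
  move=> n; apply: le_trans (zB n); rewrite ler_norml Re_le_cabs andbT lerNl.
  by have := Re_le_cabs (- z n); rewrite cabsN; case: (z n).
have [|l2 h2] := @ulim_real_exists (fun n => complex.Im (z n)) B.
  move=> n; apply: le_trans (zB n).
  have := Re_le_cabs ('i%C * z n); have := Re_le_cabs (- ('i%C * z n)).
  rewrite cabsN cabsM cabs_i mul1r; case: (z n) => u w /=; rewrite ler_norml; lra.
exists (Complex l1 l2) => e e0; have e2 : 0 < e / 2 by lra.
apply: filterS2 (h1 _ e2) (h2 _ e2) => n /=.
have := cabs_ReIm (z n - Complex l1 l2); case: (z n) => u w /=; lra.
Qed.

Lemma ulim_unique z l l' : ulim z l -> ulim z l' -> l = l'.
Proof.
move=> h h'; apply/eqP; rewrite -subr_eq0 -normr_eq0 cabsE.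
suff : cabs (l - l') <= 0.
  by move=> le0; have := cabs_ge0 (l - l'); move=> ge0; apply/eqP; congr _%:C; lra.
apply/ler_addgt0Pr => e e0; rewrite add0r; have e2 : 0 < e / 2 by lra.
have [n [/= hn hn']] : [set n | cabs (z n - l) < e / 2] `&`
    [set n | cabs (z n - l') < e / 2] !=set0.
  exact: (filter_ex (filterI (h _ e2) (h' _ e2))).
have := cabsD (z n - l') (- (z n - l)); rewrite cabsN.
have -> : z n - l' - (z n - l) = l - l' by ring.
lra.
Qed.

Lemma ulim_lin (c : R[i]) z z' l l' : ulim z l -> ulim z' l' ->
  ulim (fun n => c * z n + z' n) (c * l + l').
Proof.
move=> h h' e e0; pose d := e / (cabs c + 1).
have c1 : 0 < cabs c + 1 by rewrite ltr_wpDl ?cabs_ge0.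
have d0 : 0 < d by rewrite divr_gt0.
have dE : e = d * (cabs c + 1) by rewrite mulfVK // gt_eqF.
apply: filterS2 (h _ d0) (h' _ d0) => n /= h1 h2.
have -> : c * z n + z' n - (c * l + l') = c * (z n - l) + (z' n - l') by ring.
apply: le_lt_trans (cabsD _ _) _; rewrite cabsM dE.
have := cabs_ge0 c; have := cabs_ge0 (z n - l); nra.
Qed.

Lemma ulim_cst l : ulim (fun=> l) l.
Proof.
move=> e e0; apply: filterS filterT => n _ /=.
by rewrite subrr /cabs normr0.
Qed.

Lemma ulim_Re z l e : ulim z l -> 0 < e ->
  U [set n | `|complex.Re (z n) - complex.Re l| < e].
Proof.
move=> h e0; apply: filterS (h e e0) => n /=.
have := Re_le_cabs (z n - l); have := Re_le_cabs (- (z n - l)); rewrite cabsN.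
by case: (z n) l {h} => u w [u' w'] /=; rewrite ltr_norml; lra.
Qed.

Lemma ulim_ge0 z l : (forall n, 0 <= z n) -> ulim z l -> 0 <= l.
Proof.
move=> z0 h.
have Re_ge : 0 <= complex.Re l.
  apply/ler_addgt0Pr => e e0; have [n /=] := filter_ex (ulim_Re h e0).
  by have := z0 n; rewrite lecE => /andP[_ /=]; rewrite ltr_norml; lra.
have lE : l = (complex.Re l)%:C.
  apply: (ulim_unique h) => e e0; apply: filterS (ulim_Re h e0) => n /=.
  by rewrite -{2}(ge0_Re (z0 n)) -rmorphB /= cabs_real.
by rewrite lE ler0c.
Qed.

End UltraLimits.

(** * Extreme tracial states *)

Section ExtremeTraces.
Context {R : realType} {A : cstarAlgType R}.
Implicit Types (a b x : A) (tau sigma : A -> R[i]).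

Lemma tracial_ulim (U : set_system nat) (UU : UltraFilter U) (taus : nat -> A -> R[i]) :
    (forall n, tracial_state (taus n)) ->
  exists2 tau, tracial_state tau & forall a, ulim (U := U) (taus ^~ a) (tau a).
Proof.
move=> Ts; have ex a : exists l, ulim (U := U) (taus ^~ a) l.
  by apply: (@ulim_exists _ U _ _ (2 * nrm a)) => n; exact: tau_bound.
have [tau h] := choice ex; exists tau => //; split.
- move=> c u v; apply: (ulim_unique (h _)).
  have -> : (taus ^~ (c *: u + v)) = (fun n => c * taus n u + taus n v).
    by apply/funext => n; rewrite (tauD (Ts n)) (tauZ (Ts n)).
  exact: ulim_lin.
- by move=> a; apply: ulim_ge0 (h _) => n; exact: tau_ge0.
- apply: (ulim_unique (h _)).
  have -> : (taus ^~ 1) = (fun=> 1) by apply/funext => n; rewrite (tau1 (Ts n)).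
  exact: ulim_cst.
move=> a b; apply: (ulim_unique (h _)).
have -> : (taus ^~ (a * b)) = (taus ^~ (b * a)).
  by apply/funext => n; rewrite (tauC (Ts n)).
exact: h.
Qed.

Fixpoint lexmax (c : nat -> A) n : set (A -> R[i]) :=
  if n is n'.+1 then
    [set tau | lexmax c n' tau /\
      forall sigma, lexmax c n' sigma -> tr sigma (c n') <= tr tau (c n')]
  else tracial_states A.

Lemma lexmax_sub c n m tau : (n <= m)%N -> lexmax c m tau -> lexmax c n tau.
Proof.
move=> /subnK <-; elim: (m - n)%N => [|k IHk] //= [h _]; exact: IHk.
Qed.

(** Only a tail of the sequence has to lie in the n-th set, so a diagonal sequence has its limit in
    all of these sets at once. *)
Lemma lexmax_ulim (U : set_system nat) (UU : UltraFilter U) c n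
    (taus : nat -> A -> R[i]) tau :
    (forall m, U [set k | (m <= k)%N]) -> tracial_state tau ->
    (forall a, ulim (U := U) (taus ^~ a) (tau a)) ->
    (forall m, (n <= m)%N -> lexmax c n (taus m)) ->
  lexmax c n tau.
Proof.
move=> Uoo T lim h.
suff ind k : (k <= n)%N -> lexmax c k tau by exact: ind.
elim: k => [|k IHk] kn //=; split; first exact/IHk/ltnW.
move=> sigma hs; apply/ler_addgt0Pr => e e0.
have [m [/= nm hm]] := filter_ex (filterI (Uoo n) (ulim_Re (lim (c k)) e0)).
have [_ /(_ _ hs)] := lexmax_sub kn (h m nm).
by move: hm; rewrite /tr ltr_norml; lra.
Qed.

Lemma lexmax_nonempty c n : tracial_states A !=set0 -> lexmax c n !=set0.
Proof.
move=> T0; elim: n => [//|n [tau0 h0]].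
pose S := [set tr tau (c n) | tau in lexmax c n].
have S0 : S !=set0 by exists (tr tau0 (c n)); exists tau0.
have Sb : has_ubound S.
  exists (nrm (c n)) => _ [tau /(lexmax_sub (leq0n n)) T <-].
  by apply: le_trans (ler_norm _) (tr_bound T _).
have ex m : exists tau, lexmax c n tau /\ sup S - (1/2) ^+ m < tr tau (c n).
  have [|t [tau h <-] lt_t] := @sup_adherent _ S ((1/2) ^+ m) _ (conj S0 Sb).
    by rewrite exprn_gt0 //; lra.
  by exists tau.
have [taus htaus] := choice ex.
have [U [UU Uoo]] := ultraFilterLemma eventually_filter.
have Um m : U [set k | (m <= k)%N] by apply: Uoo; exists m.
have [tau T lim] := @tracial_ulim U UU taus
  (fun m => lexmax_sub (leq0n n) (htaus m).1).
exists tau; split; first by apply: (@lexmax_ulim U UU c n taus tau Um T lim) => m _; case: (htaus m).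
move=> sigma hs; apply: (@le_trans _ _ (sup S)).
  by apply: ub_le_sup => //; exists sigma.
apply/ler_addgt0Pr => e e0; have e2 : 0 < e / 2 by lra.
have [|N hN] := @pow_small R (1/2) 1 (e/2) _ ler01 e2; first lra.
have [m [/= Nm hm]] := filter_ex (filterI (Um N) (ulim_Re (lim (c n)) e2)).
have [_ lt1] := htaus m; have : (1/2 : R) ^+ m <= (1/2) ^+ N.
  by apply: ler_wiXn2l => //; lra.
by move: hm lt1; rewrite /tr ltr_norml; lra.
Qed.

(* Maximizing successively along a dense sequence leaves a single tracial
   state, which is therefore extreme; starting with [a] makes it maximize at
   [a]. *)
Lemma extreme_maximizer a : separable A -> tracial_states A !=set0 ->
  exists2 tau, extreme_points (tracial_states A) tau &
    forall sigma, tracial_states A sigma -> tr sigma a <= tr tau a.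
Proof.
move=> [S [/countable_injP [f finj] dS]] T0.
(* [d] inverts an injection of [S] into the natural numbers. Numbers coding no element give 0, at
   which all traces agree. *)
pose d n := xget 0 [set x | S x /\ f x = n].
have dE x : S x -> d (f x) = x.
  move=> Sx; apply: xget_unique => // y [Sy fy].
  by apply: finj; rewrite ?inE.
pose c n := if n is n'.+1 then d n' else a.
have [taus htaus] := choice (fun n => lexmax_nonempty c n T0).
have [U [UU Uoo]] := ultraFilterLemma eventually_filter.
have Um m : U [set k | (m <= k)%N] by apply: Uoo; exists m.
have [tau T lim] := @tracial_ulim U UU taus (fun m => lexmax_sub (leq0n m) (htaus m)).
have all_max n : lexmax c n tau.
  by apply: (@lexmax_ulim U UU c n taus tau Um T lim) => m nm; exact: lexmax_sub nm (htaus m).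
exists tau; last by move=> sigma Ts; have [_] := all_max 1%N; exact.
split=> // tau1 tau2 t T1 T2 t01 tauE.
have split_tr x : tr tau x = t * tr tau1 x + (1 - t) * tr tau2 x.
  rewrite /tr [in LHS]tauE; case: (tau1 x) (tau2 x) => u w [u' w'] /=; ring.
(* Each set of maximizers is a face: as 0 < t < 1, a convex combination is maximal only if both of
   its terms are. *)
have max12 n : lexmax c n tau1 /\ lexmax c n tau2.
  elim: n => [//|n [h1 h2]]; have [_ hm] := all_max n.+1.
  have m1 := hm _ h1; have m2 := hm _ h2; have := split_tr (c n).
  have /andP[t0 t1] := t01 => E.
  have e1 : tr tau1 (c n) = tr tau (c n) by apply/eqP; rewrite eq_le m1 /=; nra.
  have e2 : tr tau2 (c n) = tr tau (c n) by apply/eqP; rewrite eq_le m2 /=; nra.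
  by split; split => //= sigma hs; rewrite ?e1 ?e2; exact: hm.
suff uniq sigma : (forall n, lexmax c n sigma) -> sigma = tau.
  by split; apply: uniq => n; case: (max12 n).
move=> hs; have Ts : tracial_state sigma := hs 0%N.
have eqd n : tr sigma (c n) = tr tau (c n).
  have [h1 m1] := all_max n.+1; have [h2 m2] := hs n.+1.
  by apply/eqP; rewrite eq_le m1 // m2.
have eqtr x : tr sigma x = tr tau x.
  apply/eqP; rewrite -subr_eq0 -normr_eq0 eq_le normr_ge0 andbT.
  apply/ler_addgt0Pr => e e0; rewrite add0r; have e2 : 0 < e / 2 by lra.
  have [y Sy xy] := dense_nrm dS x e2.
  have : tr sigma y = tr tau y by rewrite -(dE y Sy); exact: (eqd (f y).+1).
  have := tr_bound Ts (x - y); have := tr_bound T (x - y).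
  rewrite (trB Ts) (trB T) => h1 h2 E; move: h1 h2; rewrite E !ler_norml; lra.
apply/funext => x; have := eqtr x; have := eqtr ((- 'i%C) *: x).
rewrite /tr (tauZ Ts) (tauZ T); case: (sigma x) (tau x) => u w [u' w'] /= h ->.
by congr Complex; lra.
Qed.

End ExtremeTraces.

(** * Consequences of simplicity *)

Section Simplicity.
Context {R : realType} {A : cstarAlgType R}.
Implicit Types (a b c e f g p q r s v w x y z : A) (d k t : R) (tau : A -> R[i]).

Lemma coisometryE v : projection (v * star v) -> v * star v * v = v.
Proof.
move=> pe; set e := v * star v in pe *; have ee := projM pe; have se := projS pe.
apply/eqP; rewrite eq_sym -subr_eq0; apply/eqP/nrm_eq0/eqP.
rewrite -sqrf_eq0 -nrm_Mstar starB starMr se.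
rewrite (_ : _ * _ = (1 - e) * e * (1 - e)); last by rewrite /e; ncring.
by rewrite mulrBl mul1r ee subrr mul0r nrm0.
Qed.

Lemma coisometry_proj v : projection (v * star v) -> projection (star v * v).
Proof.
move=> pe; split; first by rewrite /selfadjoint starMr starK.
by rewrite -mulrA (mulrA v) coisometryE.
Qed.

Lemma proj_sub p q : projection p -> projection q -> p * q = q -> projection (p - q).
Proof.
move=> pp pq pq'; have qp := corner_sa pp (projS pq) pq'.
split; first by rewrite /selfadjoint starB (projS pp) (projS pq).
rewrite (_ : _ * _ = p * p - p * q - q * p + q * q); last by ncring.
by rewrite (projM pp) pq' qp (projM pq); ncring.
Qed.

Lemma proj_add p q : projection p -> projection q -> p * q = 0 -> projection (p + q).
Proof.
move=> pp pq pq'.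
have qp : q * p = 0 by rewrite -(projS pq) -(projS pp) -starMr pq' star0.
split; first by rewrite /selfadjoint starDr (projS pp) (projS pq).
by rewrite mulrDr !mulrDl pq' qp (projM pp) (projM pq) addr0 add0r.
Qed.

Lemma tr_sub_le tau p q : tracial_state tau -> projection p -> projection q ->
  p * q = q -> tr tau q <= tr tau p.
Proof.
move=> T pp pq pq'; have := tr_proj_ge0 T (proj_sub pp pq pq').
by rewrite (trB T) subr_ge0.
Qed.

Lemma tr_coisometry_le tau v g : tracial_state tau -> projection g ->
  projection (v * star v) -> v * g = v -> tr tau (v * star v) <= tr tau g.
Proof.
move=> T pg pv vg; rewrite -(tr_mvn T); apply: (tr_sub_le T pg).
  exact: coisometry_proj.
by rewrite mulrA -{1}(projS pg) -starMr vg.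
Qed.

(** The closed ideal generated by [g] contains 1. The bound 1/2 leaves the other half for the errors
    made in [peel]. *)
Lemma simple_approx_unit g : simple A -> g <> 0 ->
  exists s : seq (A * A), nrm (1 - \sum_(u <- s) u.1 * g * u.2) < 1/2.
Proof.
move=> sA g0; pose J := [set x | exists s : seq (A * A), x = \sum_(u <- s) u.1 * g * u.2].
have JD x y : J x -> J y -> J (x + y).
  by move=> [s ->] [s' ->]; exists (s ++ s'); rewrite big_cat.
have Jl b x : J x -> J (b * x).
  move=> [s ->]; exists [seq (b * u.1, u.2) | u <- s].
  by rewrite big_map mulr_sumr; apply: eq_bigr => u _; rewrite !mulrA.
have Jr b x : J x -> J (x * b).
  move=> [s ->]; exists [seq (u.1, u.2 * b) | u <- s].
  by rewrite big_map mulr_suml; apply: eq_bigr => u _; rewrite !mulrA.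
have J0 : J 0 by exists [::]; rewrite big_nil.
have Jg : J g by exists [:: (1, 1)]; rewrite big_seq1 mul1r mulr1.
have subJ x : J x -> closure J x.
  by move=> Jx; apply/closure_nrmP => r r0; exists x; rewrite ?subrr ?nrm0.
have ideal : two_sided_ideal (closure J).
  split; first exact: subJ.
  - move=> a b /closure_nrmP ha /closure_nrmP hb; apply/closure_nrmP => r r0.
    have r2 : 0 < r / 2 by lra.
    have [x Jx ax] := ha _ r2; have [y Jy by'] := hb _ r2.
    exists (x + y); first exact: JD.
    rewrite (_ : _ - _ = (a - x) + (b - y)); last by ncring.
    by apply: le_lt_trans (nrmD _ _) _; lra.
  - move=> c a /closure_nrmP ha; apply/closure_nrmP => r r0.
    have c1 : 0 < cabs c + 1 by rewrite ltr_wpDl ?cabs_ge0.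
    have r2 : 0 < r / (cabs c + 1) by rewrite divr_gt0.
    have [x Jx ax] := ha _ r2; exists (c *: x).
      by rewrite -[c *: x]mulr1 -scalerAl scalerAr; exact: Jr.
    rewrite -scalerBr nrmZ; rewrite ltr_pdivlMr // in ax.
    by have := nrm_ge0 (a - x); nra.
  - move=> a b /closure_nrmP ha; split; apply/closure_nrmP => r r0;
    have c1 : 0 < nrm b + 1 by rewrite ltr_wpDl ?nrm_ge0.
    + have r2 : 0 < r / (nrm b + 1) by rewrite divr_gt0.
      have [x Jx ax] := ha _ r2; exists (b * x); first exact: Jl.
      rewrite -mulrBr; apply: le_lt_trans (nrmM _ _) _.
      by rewrite ltr_pdivlMr // in ax; have := nrm_ge0 (a - x); nra.
    have r2 : 0 < r / (nrm b + 1) by rewrite divr_gt0.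
    have [x Jx ax] := ha _ r2; exists (x * b); first exact: Jr.
    rewrite -mulrBl; apply: le_lt_trans (nrmM _ _) _.
    by rewrite ltr_pdivlMr // in ax; have := nrm_ge0 (a - x); nra.
have [Z|full] := sA _ (@closed_closure _ J) ideal.
  by exfalso; apply: g0; have : closure J g := subJ g Jg; rewrite Z.
have half : (0 : R) < 1/2 by lra.
have : closure J 1 by rewrite full.
by move=> /closure_nrmP/(_ _ half) [_ [s ->] h]; exists s.
Qed.

(** For each [x] in turn, the spectral projection of the current remainder on which [x * g] is
    bounded below is cut off; it is equivalent to a subprojection of [g]. The last remainder nearly
    annihilates every [x * g], and the number of pieces does not depend on [r]. *)
Lemma peel g (s : seq A) d r : real_rank_zero A -> projection g -> 0 < d -> projection r ->
  exists (v : nat -> A) p,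
    [/\ projection p, r * p = p,
      forall i, (i < size s)%N ->
        [/\ projection (v i * star (v i)), r * v i = v i & v i * g = v i],
      forall i j, (i < size s)%N -> (j < size s)%N -> i <> j -> star (v i) * v j = 0 &
      r = p + \sum_(i < size s) v i * star (v i) /\
      forall x, x \in s -> nrm (p * x * g) <= d].
Proof.
move=> rr0 pg d0; elim: s r => [|x s IHs] r pr.
  exists (fun=> 0), r; split=> //; first exact: projM.
  by rewrite big_ord0 addr0.
have rr := projM pr; have gg := projM pg.
have [|e [c [pe re ce small]]] := @spectral_cut _ _ r (r * x * g) d rr0 pr _ d0.
  by rewrite !mulrA rr.
set w := c * (r * x * g) in ce.
have pr' := proj_sub pr pe re; have er := corner_sa pr (projS pe) re.
have [v [p [pp rp hv orth [rE hp]]]] := IHs _ pr'.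
have ew : e * w = w by rewrite -ce coisometryE // ce.
have wg : w * g = w by rewrite /w -!mulrA gg.
have er' : e * (r - e) = 0 by rewrite mulrBr er (projM pe) subrr.
have wv i : (i < size s)%N -> star w * v i = 0.
  move=> /hv [_ rv _]; rewrite -ew starMr (projS pe) -rv -mulrA (mulrA e) er'.
  by rewrite mul0r mulr0.
exists (fun i => if i is i'.+1 then v i' else w), p; split => //.
- by rewrite -rp mulrA mulrBr rr re.
- move=> [|i] /=.
    by move=> _; rewrite ce; split => //; rewrite -ew mulrA re.
  rewrite ltnS => /hv [h1 h2 h3]; split => //.
  by rewrite -h2 mulrA mulrBr rr re.
- move=> [|i] [|j] //=; rewrite !ltnS; first by move=> _ js _; apply: wv.
    by move=> /wv h _ _; rewrite -[w]starK -starMr h star0.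
  by move=> si sj ij; apply: orth => // /(congr1 S).
split.
  by rewrite big_ord_recl /= ce addrCA -rE addrC subrK.
move=> y; rewrite inE => /orP[/eqP ->|/hp //].
have pr'' := corner_sa pr' (projS pp) rp.
have -> : p * x * g = p * ((r - e) * (r * x * g)).
  by rewrite !mulrA pr'' -[in p * r]pr'' -(mulrA p _ r) mulrBl rr er pr''.
by apply: nrm_contl => //; exact: nrm_proj.
Qed.

(* A norm below one forces the projection left over by [peel] to vanish. *)
Lemma subordinate_decomposition g : real_rank_zero A -> simple A ->
    projection g -> g <> 0 ->
  exists m, forall r, projection r -> exists v : nat -> A,
    [/\ forall i, (i < m)%N ->
        [/\ projection (v i * star (v i)), r * v i = v i & v i * g = v i],
      forall i j, (i < m)%N -> (j < m)%N -> i <> j -> star (v i) * v j = 0 &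
      r = \sum_(i < m) v i * star (v i)].
Proof.
move=> rr0 sA pg g0; have [s hs] := simple_approx_unit sA g0.
pose S := [seq u.1 | u <- s]; exists (size S) => r pr.
pose B := \sum_(u <- s) nrm u.2.
have B0 : 0 <= B by apply: sumr_ge0 => u _; exact: nrm_ge0.
pose d := 1 / (2 * (B + 1)); have d0 : 0 < d by rewrite divr_gt0 //; lra.
have dB : d * (B + 1) = 1/2 by rewrite /d; field; rewrite gt_eqF //; lra.
have [v [p [pp rp hv orth [rE hp]]]] := peel S rr0 pg d0 pr.
have p0 : p = 0.
  apply: nrm_proj_lt1 => //.
  have pD : p = p * (1 - \sum_(u <- s) u.1 * g * u.2) + \sum_(u <- s) p * u.1 * g * u.2.
    rewrite mulrBr mulr1 mulr_sumr -[LHS](subrK (\sum_(u <- s) p * (u.1 * g * u.2))).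
    by congr (_ + _); apply: eq_bigr => u _; rewrite !mulrA.
  rewrite pD; apply: le_lt_trans (nrmD _ _) _.
  have h1 := nrm_contl (nrm_proj pp) (ltW hs).
  have h2 : nrm (\sum_(u <- s) p * u.1 * g * u.2) <= d * B.
    apply: le_trans (nrm_sum _ _ _) _; rewrite mulr_sumr.
    rewrite !big_seq; apply: ler_sum => u us; apply: nrmM_le => //.
    by apply: hp; apply: map_f.
  by lra.
by exists v; split => //; rewrite rE {1}p0 add0r.
Qed.

(** 1 is a sum of [m] projections subequivalent to [g], so 1 <= m tau(g). Using m + 1 avoids a
    division by zero. *)
Lemma tr_proj_lower_bound g : real_rank_zero A -> simple A -> projection g -> g <> 0 ->
  exists2 d, 0 < d & forall tau, tracial_state tau -> d <= tr tau g.
Proof.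
move=> rr0 sA pg g0; have [m hm] := subordinate_decomposition rr0 sA pg g0.
have p1 := proj_one (A := A).
have [v [hv _ E]] := hm 1 p1; exists (m%:R + 1)^-1.
  by rewrite invr_gt0 ltr_wpDl.
move=> tau T; rewrite -[_^-1]mul1r ler_pdivrMr ?ltr_wpDl //.
have le : 1 <= m%:R * tr tau g.
  rewrite -[leLHS](tr1 T) [X in tr tau X <= _]E (tr_sum T).
  have -> : m%:R * tr tau g = \sum_(i < m) tr tau g.
    by rewrite sumr_const card_ord mulr_natl.
  apply: ler_sum => i _; have [h1 _ h2] := hv i (ltn_ord i).
  exact: tr_coisometry_le.
have := tr_proj_ge0 T pg; nra.
Qed.

Definition minimal_proj q :=
  [/\ projection q, q <> 0 & forall e, projection e -> q * e = e -> e = 0 \/ e = q].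

(** Under a minimal projection, [halving] can only return 0 or [q], so it approximates [x] by
    multiples of [q], with a gain of 3/4 = 1 - 1/2 + 1/4 each time. The approximating scalars need
    not be coherent: the limit is identified as the quotient of the traces of [x] and [q]. *)
Lemma minimal_proj_scalar q x tau : real_rank_zero A -> simple A -> tracial_state tau ->
    minimal_proj q -> star x = x -> q * x = x ->
  exists2 t, `|t| <= nrm x & x = t%:C *: q.
Proof.
move=> rr0 sA T [pq q0 minq] sx qx.
have [d d0 /(_ _ T) hd] := tr_proj_lower_bound rr0 sA pq q0.
have tq0 : 0 < tr tau q by lra.
have approx n : exists t, nrm (x - t%:C *: q) <= nrm x * (3/4) ^+ n.
  elim: n => [|n [t ht]]; first by exists 0; rewrite scale0r subr0 expr0 mulr1.
  set k := nrm x * _ in ht.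
  have k0 : 0 <= k := le_trans (nrm_ge0 _) ht.
  have [k_0|kn0] := eqVneq k 0.
    by exists t; rewrite exprS mulrCA -/k k_0 mulr0 -k_0.
  have kp : 0 < k by rewrite lt_neqAle eq_sym kn0.
  have [|||||e [pe qe he]] := @halving _ _ q (x - t%:C *: q) (k / 2) k (k / 4) rr0 pq _ _ ht.
  - by rewrite starB starZr sx (projS pq).
  - by rewrite mulrBr qx -scalerAr (projM pq).
  - lra.
  - lra.
  - lra.
  rewrite exprS mulrCA -/k.
  have [e0|eq] := minq e pe qe.
    exists (t - k / 2); apply: le_trans (_ : k - k / 2 + k / 4 <= _); last lra.
    rewrite e0 in he; apply: le_trans he; rewrite le_eqVlt; apply/orP; left.
    by apply/eqP; congr nrm; ncring.
  exists (t + k / 2); apply: le_trans (_ : k - k / 2 + k / 4 <= _); last lra.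
  rewrite eq in he; apply: le_trans he; rewrite le_eqVlt; apply/orP; left.
  by apply/eqP; congr nrm; ncring.
have nq : nrm q = 1.
  have [//|n1] := eqVneq (nrm q) 1; exfalso; apply/q0/nrm_proj_lt1 => //.
  by rewrite lt_neqAle n1 nrm_proj.
pose t := tr tau x / tr tau q.
have xE : x = t%:C *: q.
  apply/eqP; rewrite -subr_eq0; apply/eqP.
  apply: (@eq0_geometric _ _ _ (2 * nrm x) (3/4)).
  - by rewrite mulr_ge0 ?nrm_ge0.
  - by lra.
  move=> n; have [t' ht'] := approx n; rewrite -mulrA.
  have h : `|t - t'| <= nrm x * (3/4) ^+ n.
    apply: le_trans ht'.
    have := tr_abs_le T pq (_ : star (x - t'%:C *: q) = _) _.
    move=> /(_ _ _); rewrite starB starZr sx (projS pq) mulrBr qx -scalerAr (projM pq).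
    move=> /(_ erefl erefl); rewrite (trB T) (trZ T).
    have -> : tr tau x = t * tr tau q by rewrite /t divfK // gt_eqF.
    by rewrite -mulrBl normrM (gtr0_norm tq0) ler_pM2r.
  rewrite (_ : x - t%:C *: q = (x - t'%:C *: q) - (t - t')%:C *: q); last by ncring.
  by apply: le_trans (nrmB _ _) _; rewrite nrmZr nq mulr1; lra.
by exists t => //; rewrite [in leRHS]xE nrmZr nq mulr1.
Qed.

Lemma block_proj_comb e f a : projection e -> projection f -> e * f = 0 ->
  proj_comb 4 (2 * nrm a) (e * a * f).
Proof.
move=> pe pf ef.
have fe : f * e = 0 by rewrite -(projS pf) -(projS pe) -starMr ef star0.
apply: (@proj_comb_mono _ _ 4 _ (2 * nrm (e * a * f))) => //.
  rewrite ler_pM2l //; apply: nrm_contr; first exact: nrm_proj.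
  by apply: nrm_contl => //; exact: nrm_proj.
apply: (offdiag_proj_comb pe); first by rewrite !mulrA (projM pe).
by rewrite -mulrA fe mulr0.
Qed.

Lemma block_diag_proj_comb (q : nat -> A) n a :
    (forall i, (i < n)%N -> projection (q i)) ->
    (forall i j, (i < n)%N -> (j < n)%N -> i <> j -> q i * q j = 0) ->
  projection (\sum_(i < n) q i) /\
  proj_comb (n * 8) (2 * nrm a)
    ((\sum_(i < n) q i) * a * (\sum_(i < n) q i) - \sum_(i < n) q i * a * q i).
Proof.
elim: n => [|n IHn] pq orth.
  rewrite !big_ord0 !mul0r subr0; split; last exact: proj_comb0.
  by split; rewrite /selfadjoint ?star0 ?mul0r.
have [||ps h] := IHn.
- by move=> i /ltnW; exact: pq.
- by move=> i j /ltnW hi /ltnW hj; exact: orth.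
rewrite !big_ord_recr /=; set s := \sum_(i < n) q i in ps h *.
set t := \sum_(i < n) q i * a * q i in h *.
have sq : s * q n = 0.
  rewrite mulr_suml big1 // => i _; apply: orth => //; first by rewrite ltnS ltnW.
  by move=> e; have := ltn_ord i; rewrite e ltnn.
have pn := pq n (ltnSn n).
have qs : q n * s = 0 by rewrite -(projS pn) -(projS ps) -starMr sq star0.
split; first exact: proj_add.
rewrite (_ : _ - _ = (s * a * s - t) +
   (s * a * q n + q n * a * s)); last by ncring.
rewrite mulSn addnC; apply: proj_combD h _.
by apply: (@proj_combD _ _ 4 4); apply: block_proj_comb.
Qed.

(* When the traces of nonzero projections are bounded below, every projection
   is a finite orthogonal sum of minimal ones. *)
Lemma atomic_proj_comb (ts : seq (A -> R[i])) d : real_rank_zero A -> simple A ->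
    tracial_states A !=set0 -> 0 < d ->
    (forall tau, tau \in ts -> tracial_state tau) ->
    (forall g, projection g -> g <> 0 -> exists2 tau, tau \in ts & d <= tr tau g) ->
  exists N, forall a, star a = a -> proj_comb N (2 * nrm a) a.
Proof.
move=> rr0 sA [tau0 T0] d0 Ts low.
pose phi p := \sum_(tau <- ts) tr tau p.
have phi_ge p : projection p -> p <> 0 -> d <= phi p.
  move=> pp /(low p pp) [tau tts h]; apply: le_trans h _.
  rewrite /phi (big_rem tau) //= lerDl big_seq; apply: sumr_ge0 => sigma /mem_rem hs.
  exact: (tr_proj_ge0 (Ts _ hs) pp).
have phiB p e : phi (p - e) = phi p - phi e.
  by rewrite /phi -sumrB big_seq [RHS]big_seq; apply: eq_bigr => tau /Ts h; rewrite (trB h).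
(* [phi] is additive and at least [d] on nonzero projections: splitting [p] into two nonzero parts
   lowers [phi] by at least [d] on both. *)
have ind n p : projection p -> phi p < n%:R * d ->
    exists N, forall a, star a = a -> proj_comb N (2 * nrm a) (p * a * p).
  elim: n p => [|n IHn] p pp hp.
    exists 0%N => a _.
    have [->|/eqP p0] := eqVneq p 0; first by rewrite !mul0r; exact: proj_comb0.
    by have := phi_ge p pp p0; rewrite mul0r in hp; lra.
  have [->|/eqP p0] := eqVneq p 0.
    by exists 0%N => a _; rewrite !mul0r; exact: proj_comb0.
  have [minp|] := pselect (forall e, projection e -> p * e = e -> e = 0 \/ e = p).
    exists 1%N => a sa.
    have [|||t ht ->] := @minimal_proj_scalar p (p * a * p) tau0 rr0 sA T0.
    - by split.
    - by rewrite !starMr sa (projS pp) mulrA.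
    - by rewrite !mulrA (projM pp).
    have := proj_combZ t%:C (proj_comb_proj pp); apply: proj_comb_mono => //.
    rewrite cabs_real mulr1; apply: le_trans ht _.
    have := nrm_contr (nrm_proj pp) (nrm_contl (nrm_proj pp) (lexx (nrm a))).
    by have := nrm_ge0 a; lra.
  move=> /existsNP [e /not_implyP [pe /not_implyP [re /not_orP [e0 ep]]]].
  have pf := proj_sub pp pe re.
  have f0 : p - e <> 0 by move=> /eqP; rewrite subr_eq0 => /eqP /esym.
  have ef : e * (p - e) = 0.
    by rewrite mulrBr (corner_sa pp (projS pe) re) (projM pe) subrr.
  have fe : (p - e) * e = 0 by rewrite mulrBl re (projM pe) subrr.
  have l1 := phi_ge _ pe e0; have l2 := phi_ge _ pf f0.
  rewrite phiB in l2; rewrite -natr1 in hp.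
  have [|N1 h1] := IHn e pe; first lra.
  have [|N2 h2] := IHn _ pf; first by rewrite phiB; lra.
  exists (N1 + N2 + (4 + 4))%N => a sa.
  rewrite (_ : p * a * p = (e * a * e + (p - e) * a * (p - e)) +
     (e * a * (p - e) + (p - e) * a * e)); last by ncring.
  apply: proj_combD; first by apply: proj_combD; [exact: h1 | exact: h2].
  by apply: proj_combD; apply: block_proj_comb.
have p1 := proj_one (A := A).
have [n hn] : exists n, phi 1 < n%:R * d.
  exists (Num.bound `|phi 1 / d|); rewrite -ltr_pdivrMr //.
  apply: le_lt_trans (ler_norm _) _; exact: (archi_boundP (normr_ge0 _)).
have [N hN] := ind n 1 p1 hn.
by exists N => a sa; have := hN a sa; rewrite mul1r mulr1.
Qed.

End Simplicity.

(** * Halving projections *)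

(* Merge classes of vectors with the same sign pattern, the second one with the
   opposite sign: the class sums stay bounded, and at most [2^k] classes remain. *)
Lemma balanced_signs (R : realType) (k m : nat) (v : 'I_m -> 'I_k -> R) (d : R) :
    0 <= d -> (forall i j, `|v i j| <= d) ->
  exists s : 'I_m -> bool, forall j,
    `|\sum_i (-1) ^+ s i * v i j| <= (2 ^ k)%:R * d.
Proof.
move=> d0 hv.
pose S (s : 'I_m -> bool) (c : 'I_m -> 'I_m) l j := \sum_(i | c i == l) (-1) ^+ s i * v i j.
pose im (c : 'I_m -> 'I_m) := [set c i | i in [set: 'I_m]]%SET.
suff [s [c [hS card]]] : exists s c, (forall l j, `|S s c l j| <= d) /\ (#|im c| <= 2 ^ k)%N.
  exists s => j; rewrite (partition_big c (mem (im c))) /=; last first.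
    by move=> i _; apply: imset_f; rewrite inE.
  apply: le_trans (ler_norm_sum _ _ _) _.
  apply: le_trans (_ : \sum_(l in im c) d <= _).
    by apply: ler_sum => l _; exact: hS.
  by rewrite sumr_const -[leLHS]mulr_natl ler_wpM2r // ler_nat.
suff ind n s c : (forall l j, `|S s c l j| <= d) -> (#|im c| <= n + 2 ^ k)%N ->
    exists s c, (forall l j, `|S s c l j| <= d) /\ (#|im c| <= 2 ^ k)%N.
  apply: (ind m xpred0 id); last first.
    by rewrite (leq_trans (max_card _)) // card_ord leq_addr.
  by move=> l j; rewrite /S big_pred1_eq expr0 mul1r.
elim: n s c => [|n IHn] s c hS hc; first by exists s, c.
have [le|gt] := leqP #|im c| (2 ^ k); first by exists s, c.
pose pat l : {ffun 'I_k -> bool} := [ffun j => 0 <= S s c l j].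
have [inj|] := boolP (dinjectiveb pat (mem (im c))).
  have : (#|im c| <= #|{: {ffun 'I_k -> bool}}|)%N.
    rewrite -(card_in_imset (f := pat) (D := im c)) ?max_card //.
    by move=> x y; exact: (dinjectiveP _ _ inj).
  by rewrite card_ffun card_bool card_ord leqNgt gt.
case/dinjectivePn => a ca [b /andP[/= ba cb] pab].
have ab : a == b = false by rewrite eq_sym (negbTE ba).
pose c' i := if c i == b then a else c i.
pose s' i := if c i == b then ~~ s i else s i.
have Sa j : S s' c' a j = S s c a j - S s c b j.
  rewrite /S (bigID (fun i => c i == b)) /= addrC; congr (_ + _).
    apply: eq_big => [i|i]; rewrite /c' /s'; have [e|ne] := eqVneq (c i) b.
    - by rewrite andbF e eq_sym ab.
    - by rewrite andbT.
    - by rewrite andbF.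
    - by [].
  rewrite -sumrN; apply: eq_big => [i|i]; rewrite /c' /s'; have [e|ne] := eqVneq (c i) b.
  - by rewrite eqxx.
  - by rewrite andbF.
  - by rewrite signrN mulNr.
  - by rewrite andbF.
apply: (IHn s' c').
  move=> l j; have [->|la] := eqVneq l a.
    rewrite Sa; have := hS a j; have := hS b j.
    move/ffunP/(_ j): pab; rewrite !ffunE.
    move: (S s c a j) (S s c b j) => x y xy; rewrite !ler_norml.
    by case: (lerP 0 x) xy; case: (lerP 0 y) => // hy hx _; lra.
  have [->|lb] := eqVneq l b.
    rewrite /S big_pred0 ?normr0 // => i; rewrite /c'.
    by have [_|/negbTE //] := eqVneq (c i) b; rewrite ab.
  apply: le_trans (hS l j); rewrite le_eqVlt; apply/orP; left; apply/eqP; congr `|_|.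
  have al : a == l = false by rewrite eq_sym (negbTE la).
  have bl : b == l = false by rewrite eq_sym (negbTE lb).
  apply: eq_big => [i|i]; rewrite /c' /s'; have [e|//] := eqVneq (c i) b.
    by rewrite e al bl.
  by rewrite al.
have sub : im c' \subset (im c :\ b)%SET.
  apply/fintype.subsetP => _ /imsetP[i _ ->]; rewrite !inE /c'.
  have [_|ne] := eqVneq (c i) b; first by rewrite ab.
  by rewrite ?ne /=; apply: imset_f; rewrite inE.
have := subset_leq_card sub; rewrite (cardsD1 b (im c)) cb in hc.
by move/leq_trans; apply; rewrite -(leq_add2l 1) addnA add1n.
Qed.

Section Halving.
Context {R : realType} {A : cstarAlgType R}.
Implicit Types (a b c e f g h p q r v w x y z : A) (d k t : R) (tau sigma : A -> R[i]).


Lemma sum_orthogonal_proj (I : finType) (P : pred I) (q : I -> A) :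
    (forall i, projection (q i)) -> (forall i j, i != j -> q i * q j = 0) ->
  projection (\sum_(i | P i) q i).
Proof.
move=> pq orth; split.
  by rewrite /selfadjoint star_sum; apply: eq_bigr => i _; exact: projS.
rewrite mulr_suml; apply: eq_bigr => i Pi.
rewrite mulr_sumr (bigD1 i) //= (projM (pq i)) big1 ?addr0 // => j /andP[_ ji].
by apply: orth; rewrite eq_sym.
Qed.

(** What is used of the list of extreme traces: an inequality checked on [ts] holds for all
    traces. *)
Definition maximized_on (ts : seq (A -> R[i])) :=
  (forall tau, tau \in ts -> tracial_state tau) /\
  forall sigma, tracial_state sigma -> forall a,
    exists2 tau, tau \in ts & tr sigma a <= tr tau a.

(** [p] is cut into pieces of trace below [d], which are shared out by balanced signs. Their number
    is not controlled, but the imbalance is at most 2^k d = c/4 with [c] a lower bound for the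
    traces of [p], so each half has between 3/8 and 5/8 of the trace. *)
Lemma trace_halving ts p : real_rank_zero A -> simple A -> maximized_on ts ->
    (forall d, 0 < d -> exists g, [/\ projection g, g <> 0 &
      forall tau, tracial_state tau -> tr tau g < d]) ->
    projection p -> p <> 0 ->
  exists h, [/\ projection h, p * h = h & forall tau, tracial_state tau ->
    tr tau p / 3 < tr tau h /\ tr tau h < 2 * tr tau p / 3].
Proof.
move=> rr0 sA [Ts maxts] small pp p0.
have [c c0 hc] := tr_proj_lower_bound rr0 sA pp p0.
pose k := size ts; pose B : R := (2 ^ k)%:R.
have B0 : 0 < B by rewrite ltr0n expn_gt0.
pose d := c / (4 * B); have d0 : 0 < d by rewrite divr_gt0 // mulr_gt0.
have dB : B * d = c / 4 by rewrite /d; field; rewrite gt_eqF.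
have [g [pg g0 hg]] := small d d0.
have [m /(_ p pp) [v [hv orth pE]]] := subordinate_decomposition rr0 sA pg g0.
pose f (i : 'I_m) := v i * star (v i).
have pf i : projection (f i) by have [] := hv i (ltn_ord i).
have of_ i j : i != j -> f i * f j = 0.
  move=> ij; rewrite /f -mulrA (mulrA (star _)) orth ?mul0r ?mulr0 //.
  by move=> e; move/eqP: ij; apply; exact: val_inj.
pose tau_ (j : 'I_k) := nth 0 ts j.
have T_ j : tracial_state (tau_ j) by apply: Ts; exact: mem_nth.
have fd i j : `|tr (tau_ j) (f i)| <= d.
  have [_ _ vg] := hv i (ltn_ord i).
  rewrite ger0_norm; last exact: tr_proj_ge0.
  by apply: le_trans (ltW (hg _ (T_ j))); exact: (tr_coisometry_le (T_ j) pg (pf i) vg).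
have [s hs] := balanced_signs (ltW d0) fd.
pose h (b : bool) := \sum_(i | s i == b) f i.
have ph (b : bool) : projection (h b) by apply: sum_orthogonal_proj.
have hE : p = h false + h true.
  rewrite pE (bigID s) /= addrC; congr (_ + _); apply: eq_bigl => i.
    by rewrite eqbF_neg.
  by rewrite eqb_id.
have sgnE : h false - h true = \sum_i ((-1) ^+ s i)%:C *: f i.
  rewrite [RHS](bigID s) /= addrC -sumrN; congr (_ + _).
    by apply: eq_big => [i|i]; rewrite ?eqbF_neg // => /negbTE ->; rewrite expr0 scale1r.
  apply: eq_big => [i|i]; rewrite ?eqb_id // => ->.
  by rewrite expr1 -scaleN1r; congr (_ *: _); rewrite rmorphN.
have close tau : tracial_state tau -> `|tr tau (h false) - tr tau (h true)| <= c / 4.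
  move=> T.
  have bound sigma : sigma \in ts -> `|tr sigma (h false - h true)| <= c / 4.
    move=> hsig; have hi : (index sigma ts < k)%N by rewrite index_mem.
    have := hs (Ordinal hi); rewrite /tau_ /= nth_index // -dB.
    rewrite sgnE (tr_sum (Ts _ hsig)).
    by under [in X in _ -> X]eq_bigr do rewrite (trZ (Ts _ hsig)).
  rewrite -(trB T); have [t1 ht1 h1] := maxts _ T (h false - h true).
  have [t2 ht2 h2] := maxts _ T (- (h false - h true)).
  rewrite (trN T) (trN (Ts _ ht2)) in h2.
  by have := bound _ ht1; have := bound _ ht2; rewrite !ler_norml; lra.
exists (h false); split => //.
  by rewrite hE mulrDl (projM (ph false)) -[RHS]addr0; congr (_ + _);
     rewrite mulr_suml big1 // => i /eqP si; rewrite mulr_sumr big1 // => j /eqP sj;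
     apply: of_; apply: contra_eq_neq sj => <-; rewrite si.
move=> tau T; have := close tau T; have := hc tau T.
by rewrite hE (trD T) ler_norml; lra.
Qed.

End Halving.

(** * Descent through a sequence of smaller corners *)

Section Slots.
Context {R : realType} {A : cstarAlgType R}.
Implicit Types (a b c e f g h p q r v w x y z : A) (d k t : R) (tau sigma : A -> R[i]).

(** Partial isometries from [e] onto [L] orthogonal projections, like the first column of a system
    of matrix units. Slot 0 is [e] itself, so the ranges of the others are orthogonal to [e]. *)
Definition slots (L : nat) e (u : nat -> A) :=
  u 0%N = e /\
  forall i j, (i < L)%N -> (j < L)%N -> star (u i) * u j = if i == j then e else 0.

Lemma isometryE e v : projection e -> star v * v = e -> v * e = v.
Proof.
move=> pe vv; have pv : projection (star v * star (star v)) by rewrite starK vv.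
by have := congr1 star (coisometryE pv); rewrite !starMr !starK -vv.
Qed.

(** The next copy of [e] is found by comparison inside the complement of the previous ones, whose
    trace still exceeds that of [e]. *)
Lemma slots_exist (L : nat) e : strict_comparison A -> projection e -> (0 < L)%N ->
    (forall tau, tracial_state tau -> L%:R * tr tau e < 1) ->
  exists u, slots L e u.
Proof.
move=> cmp pe; have ee := projM pe; have se := projS pe.
case: L => // L _; elim: L => [|n IHn] hL.
  by exists (fun=> e); split=> // -[|i] // [|j] // _ _; rewrite se ee.
have [tau T|u [u0 hu]] := IHn.
  apply: le_lt_trans (hL tau T); rewrite ler_wpM2r ?tr_proj_ge0 // ler_nat //.
have ue i : (i < n.+1)%N -> u i * e = u i.
  by move=> hi; apply: isometryE => //; rewrite hu // eqxx.
pose s := \sum_(i < n.+1) u i * star (u i).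
have uu i j : (i < n.+1)%N -> (j < n.+1)%N -> i <> j -> u i * star (u i) * (u j * star (u j)) = 0.
  move=> hi hj /eqP ij; rewrite -mulrA (mulrA (star _)) hu // (negbTE ij).
  by rewrite mul0r mulr0.
have pu i : (i < n.+1)%N -> projection (u i * star (u i)).
  move=> hi; split; first by rewrite /selfadjoint starMr starK.
  by rewrite -mulrA (mulrA (star _)) hu // eqxx mulrA ue.
have ps : projection s.
  apply: sum_orthogonal_proj => [i|i j ij]; first exact: pu.
  by apply: uu => // e0; move/eqP: ij; apply; exact: val_inj.
have us i : (i < n.+1)%N -> star (u i) * s = star (u i).
  move=> hi; rewrite mulr_sumr (bigD1 (Ordinal hi)) //= big1 ?addr0.
    by rewrite mulrA hu // eqxx -{2}(ue i hi) starMr se.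
  move=> j /eqP ji; rewrite mulrA hu //; case: eqP => [ij|]; last by rewrite mul0r.
  by exfalso; apply: ji; apply: val_inj.
have [|v [vv hv]] := comparison_tr cmp pe (proj_compl ps).
  move=> tau T; rewrite (trB T) (tr1 T) (tr_sum T).
  under eq_bigr => i _ do rewrite -(tr_mvn T) hu // eqxx.
  rewrite sumr_const card_ord -mulr_natl; have := hL tau T; rewrite -natr1; lra.
have ve := isometryE pe vv.
have vvv : v * star v * v = v by rewrite -mulrA vv ve.
have qv : (1 - s) * v = v by rewrite -{1}vvv mulrA hv vvv.
have uv i : (i < n.+1)%N -> star (u i) * v = 0.
  by move=> hi; rewrite -qv mulrA mulrBr mulr1 us // subrr mul0r.
exists (fun i => if i == n.+1 then v else u i); split => // i j hi hj.
have cases l : (l < n.+2)%N -> l = n.+1 \/ (l < n.+1)%N.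
  by rewrite ltnS leq_eqVlt => /orP[/eqP|]; [left | right].
case: (cases i hi) => [->|{}hi]; case: (cases j hj) => [->|{}hj]; rewrite ?eqxx //.
- by rewrite (gtn_eqF hj) (ltn_eqF hj) -[u j]starK -starMr uv // star0.
- by rewrite (ltn_eqF hi) uv.
by rewrite (ltn_eqF hi) (ltn_eqF hj); exact: hu.
Qed.

(* [r n] is roughly half of what remains of [e] after [r 0, ..., r (n - 1)]. *)
Lemma orthogonal_sequence e : tracial_states A !=set0 -> projection e -> e <> 0 ->
    (forall p, projection p -> p <> 0 ->
      exists h, [/\ projection h, p * h = h & forall tau, tracial_state tau ->
      tr tau p / 3 < tr tau h /\ tr tau h < 2 * tr tau p / 3]) ->
    (forall p, projection p -> p <> 0 ->
      forall tau, tracial_state tau -> 0 < tr tau p) ->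
  exists r : nat -> A,
    [/\ forall n, projection (r n) /\ e * r n = r n,
      forall n m, n <> m -> r n * r m = 0 &
      forall n tau, tracial_state tau ->
        0 < tr tau (r n) /\ tr tau (r n) < 6 * tr tau (r n.+1)].
Proof.
move=> [tau0 T0] pe e0 half pos.
have ex p : exists h, projection p -> p <> 0 ->
    [/\ projection h, p * h = h & forall tau, tracial_state tau ->
      tr tau p / 3 < tr tau h /\ tr tau h < 2 * tr tau p / 3].
  have [pp|npp] := pselect (projection p /\ p <> 0); last first.
    by exists 0 => pp p0; case: npp.
  by have [h hh] := half p pp.1 pp.2; exists h.
have [H hH] := choice ex.
pose E := fix E n := if n is n'.+1 then E n' - H (E n') else e.
have EP n : [/\ projection (E n), E n <> 0 & e * E n = E n].
  elim: n => [|n [pE E0 eE]] /=; first by rewrite (projM pe).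
  have [ph Eh htr] := hH _ pE E0; split.
  - exact: proj_sub.
  - move=> Z; have [_] := htr _ T0; have := pos _ pE E0 _ T0.
    have := congr1 (tr tau0) Z; rewrite (trB T0) (tr0 T0); lra.
  - by rewrite mulrBr eE -{1}Eh mulrA eE Eh.
pose r n := H (E n).
have rP n := let: And3 pE E0 _ := EP n in hH (E n) pE E0.
have Emono n m : (n <= m)%N -> E n * E m = E m.
  move=> /subnK <-; elim: (m - n)%N => [|k IHk]; first by have [/projM] := EP n.
  have [_ Eh _] := rP (k + n)%N.
  by rewrite addSn /= mulrBr IHk -{1}Eh mulrA IHk Eh.
have lt_orth n m : (n < m)%N -> r n * r m = 0.
  move=> nm; have [ph Eh _] := rP n; have [_ Em _] := rP m; have [pE _ _] := EP n.
  rewrite /r -Em -(Emono _ _ nm) /= !mulrA mulrBr (projM ph).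
  by rewrite (corner_sa pE (projS ph) Eh) subrr !mul0r.
exists r; split.
- move=> n; have [ph Eh _] := rP n; have [_ _ eE] := EP n; split => //.
  by rewrite /r -Eh mulrA eE.
- move=> n m /eqP; rewrite neq_ltn => /orP[/lt_orth //|mn].
  have [pn _ _] := rP n; have [pm _ _] := rP m.
  by rewrite /r -(projS pn) -(projS pm) -starMr lt_orth // star0.
move=> n tau T; have [pE E0 _] := EP n; have [_ _ /(_ tau T) h1] := rP n.
have [_ _ /(_ tau T) h2] := rP n.+1.
(* The trace of [r n] is below 2/3 of that of [E n]; that of [r n.+1] is above 1/3 of that of
   [E n.+1], hence above 1/9 of that of [E n]. This is the factor 6. *)
have := pos _ pE E0 _ T; move: h1 h2; rewrite -/(r n) -/(r n.+1) /= -/(r n) (trB T); lra.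
Qed.

(* The first factors are off-diagonal with respect to [e]. The supports [p] and
   [q] of the factors serve to make the mixed products vanish in a series of
   such sums with pairwise orthogonal supports. *)
Definition commutators e p q k (M : nat) z := exists s : seq (A * A),
  [/\ (size s <= M)%N,
    forall u, u \in s -> [/\ e * u.1 = u.1 /\ u.1 * e = 0,
      p * u.1 = u.1 /\ u.1 * q = u.1, q * u.2 = u.2 /\ u.2 * p = u.2,
      nrm u.1 <= k & nrm u.2 <= 1] &
    z = \sum_(u <- s) (u.1 * u.2 - u.2 * u.1)].

Lemma commutatorsD e p q k M N z z' : commutators e p q k M z ->
  commutators e p q k N z' -> commutators e p q k (M + N) (z + z').
Proof.
move=> [s [sM hs ->]] [s' [sN hs' ->]]; exists (s ++ s'); split.
- by rewrite size_cat leq_add.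
- by move=> u; rewrite mem_cat => /orP[/hs|/hs'].
by rewrite big_cat.
Qed.

Lemma commutators1 e p q k x y :
    e * x = x -> x * e = 0 -> p * x = x -> x * q = x -> q * y = y -> y * p = y ->
    nrm x <= k -> nrm y <= 1 ->
  commutators e p q k 1 (x * y - y * x).
Proof.
move=> *; exists [:: (x, y)]; split; rewrite ?big_seq1 // => u.
by rewrite inE => /eqP ->.
Qed.

Lemma commutators_sum e p q k M (n : nat) (z : 'I_n -> A) :
    (forall i, commutators e p q k M (z i)) ->
  commutators e p q k (n * M) (\sum_i z i).
Proof.
elim: n z => [|n IHn] z hz.
  by exists [::]; rewrite big_ord0 big_nil.
by rewrite big_ord_recl mulSn; apply: commutatorsD => //; exact: IHn.
Qed.

Lemma tr_commutators e p q k M z tau : tracial_state tau ->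
  commutators e p q k M z -> tr tau z = 0.
Proof.
move=> T [s [_ _ ->]]; rewrite (tr_sum T) big1 // => u _.
by rewrite (trB T) (trC T) subrr.
Qed.

End Slots.

(** * Approximation by projections and exchanges between copies of a corner *)

Section Step.
Context {R : realType} {A : cstarAlgType R}.
Implicit Types (a b c e f g h p q r v w x y z : A) (d k t : R) (tau sigma : A -> R[i]).

(** [M] halvings with the same step [t] lower the bound (M + 1) t by t each, up to errors d = t / M
    that add up to t. Before each halving the bound is still at least 2 t, as [halving] requires. *)
Lemma projection_approx r a t (M : nat) : real_rank_zero A -> projection r ->
    star a = a -> r * a = a -> 0 < t -> (0 < M)%N -> nrm a <= (M%:R + 1) * t ->
  exists q : nat -> A, (forall i, projection (q i) /\ r * q i = q i) /\
    nrm (a - t%:C *: (2%:C *: (\sum_(i < M) q i) - M%:R%:C *: r)) <= 2 * t.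
Proof.
move=> rr0 pr sa ra t0 M0 ha.
pose d := t / M%:R; have M0' : (0 : R) < M%:R by rewrite ltr0n.
have d0 : 0 < d by rewrite divr_gt0.
have dM : M%:R * d = t by rewrite /d mulrC divfK // gt_eqF.
have ind n : (n <= M)%N -> exists qs : seq A,
    [/\ size qs = n, forall q, q \in qs -> projection q /\ r * q = q &
    nrm (a - t%:C *: (2%:C *: (\sum_(q <- qs) q) - n%:R%:C *: r)) <=
      (M%:R + 1) * t - n%:R * (t - d)].
  elim: n => [_|n IHn nM].
    exists [::]; split=> //; rewrite big_nil; set b := _ - _.
    suff -> : b = a by lra.
    by rewrite /b scaler0 scale0r subrr scaler0 subr0.
  have [qs [sqs hqs hn]] := IHn (ltnW nM).
  set b := a - _ in hn; set k := _ - _ in hn.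
  have nM' : n%:R + 1 <= M%:R :> R by rewrite natr1 ler_nat.
  have tk : 2 * t <= k.
    have h1 : (n%:R + 1) * t <= M%:R * t by rewrite ler_wpM2r // ltW.
    have h2 : 0 <= n%:R * d by rewrite mulr_ge0 // ltW.
    by rewrite /k mulrBr; lra.
  have sqs_ : star (\sum_(q <- qs) q) = \sum_(q <- qs) q.
    by rewrite star_sum big_seq [RHS]big_seq; apply: eq_bigr => q /hqs [/projS].
  have sb : star b = b.
    by rewrite starB starZr starB !starZr sa sqs_ (projS pr).
  have rb : r * b = b.
    have -> : r * b = r * a - t%:C *: (2%:C *: (r * \sum_(q <- qs) q) - n%:R%:C *: (r * r)).
      by rewrite /b; ncring.
    rewrite ra (projM pr) mulr_sumr (eq_big_seq (fun q => q)) // => q /hqs [] //.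
  have [f [pf rf hf]] := halving rr0 pr sb rb hn (ltW t0) tk d0.
  exists (f :: qs); split; first by rewrite /= sqs.
    by move=> q; rewrite inE => /orP[/eqP ->|/hqs].
  have -> : \sum_(q <- f :: qs) q = f + \sum_(q <- qs) q by rewrite big_cons.
  rewrite -[in leRHS](natr1 n) (_ : _ - (n%:R + 1) * (t - d) = k - t + d); last first.
    by rewrite /k; ring.
  apply: le_trans hf; rewrite le_eqVlt; apply/orP; left; apply/eqP; congr nrm.
  by rewrite /b -[n.+1%:R]natr1; ncring.
have [qs [sqs hqs hM]] := ind M (leqnn M).
exists (fun i => qs`_i); split.
  move=> i; have [lt|ge] := ltnP i (size qs); first by apply/hqs/mem_nth.
  by rewrite nth_default // mulr0; split=> //; split; rewrite /selfadjoint ?star0 ?mulr0.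
move: hM; rewrite (big_nth 0) sqs big_mkord => /le_trans; apply.
by rewrite mulrBr dM; lra.
Qed.

(** The copies of [r] in all slots together: the common support of the exchanges made around [r].
    Orthogonal projections under [e] have orthogonal levels. *)
Definition level (L : nat) (u : nat -> A) r := \sum_(i < L) u i * r * star (u i).

Section Slots.
Context {L : nat} {e : A} {u : nat -> A} (hu : slots L e u) (pe : projection e).

Lemma slot0 : u 0%N = e. Proof. by case: hu. Qed.

Lemma slotM i j : (i < L)%N -> (j < L)%N -> star (u i) * u j = if i == j then e else 0.
Proof. by case: hu => _; apply. Qed.

Lemma slot_e i : (i < L)%N -> u i * e = u i.
Proof. by move=> hi; apply: isometryE => //; rewrite slotM // eqxx. Qed.

Lemma e_slot i : (i.+1 < L)%N -> e * u i.+1 = 0.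
Proof.
by move=> hi; have := slotM (ltn_trans (ltn0Sn i) hi) hi; rewrite slot0 (projS pe).
Qed.

Lemma nrm_slot i : (i < L)%N -> nrm (u i) <= 1.
Proof.
move=> hi; rewrite -ler_sqr ?nnegrE ?nrm_ge0 ?ler01 // -nrm_starM slotM // eqxx.
by rewrite expr1n nrm_proj.
Qed.

Lemma slot_sum_proj (q : nat -> A) (I : finType) (s : I -> nat) :
    injective s -> (forall i, s i < L)%N -> (forall i, projection (q (s i))) ->
    (forall i, e * q (s i) = q (s i)) ->
  projection (\sum_i u (s i) * q (s i) * star (u (s i))).
Proof.
move=> injs sL pq eq; apply: sum_orthogonal_proj => [i|i j ij].
  split; first by rewrite /selfadjoint !starMr starK (projS (pq i)) mulrA.
  rewrite -mulrA (mulrA (star _)) (mulrA (star _)) slotM // eqxx eq mulrA.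
  by rewrite -(mulrA (u _)) (projM (pq i)).
rewrite -mulrA (mulrA (star _)) (mulrA (star _)) slotM //.
by rewrite (inj_eq injs) (negbTE ij) !mul0r mulr0.
Qed.

Lemma level_proj r : projection r -> e * r = r -> projection (level L u r).
Proof.
move=> pr er; apply: (@slot_sum_proj (fun=> r) 'I_L (@nat_of_ord L)) => //.
exact: val_inj.
Qed.

Lemma level_slot r i : (i < L)%N -> projection r -> e * r = r -> level L u r * u i = u i * r.
Proof.
move=> hi pr er; rewrite mulr_suml (bigD1 (Ordinal hi)) //= big1 ?addr0.
  by rewrite -!mulrA slotM // eqxx (corner_sa pe (projS pr) er).
move=> j /eqP ji; rewrite -mulrA slotM //; case: eqP => [ij|]; last by rewrite mulr0.
by exfalso; apply: ji; apply: val_inj.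
Qed.

Lemma level_base r : (0 < L)%N -> projection r -> e * r = r -> level L u r * r = r.
Proof.
by move=> L0 pr er; rewrite -{2}er mulrA -slot0 level_slot // slot0 -mulrA (projM pr).
Qed.

Lemma level_orth r r' : projection r -> e * r = r -> projection r' -> e * r' = r' ->
  r * r' = 0 -> level L u r * level L u r' = 0.
Proof.
move=> pr er pr' er' rr'; rewrite [X in _ * X]/level mulr_sumr big1 // => i _.
by rewrite !mulrA level_slot // -(mulrA (u i)) rr' mulr0 mul0r.
Qed.

Section SlotSum.
Context {n : nat} (nL : (n < L)%N) {q : nat -> A}.
Context (pq : forall i, projection (q i)) (eq : forall i, e * q i = q i).

(** Slot 0 is left out, which makes [W] orthogonal to [e]: elements running between the two are
    off-diagonal. *)
Let W := \sum_(i < n) u i.+1 * q i * star (u i.+1).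

Let slt (i : 'I_n) : (i.+1 < L)%N. Proof. exact: leq_ltn_trans (ltn_ord i) nL. Qed.

Lemma slot_sum_projS : projection W.
Proof.
apply: (@slot_sum_proj (fun i => q i.-1) 'I_n (fun i => i.+1)) => //.
by move=> i j [] /val_inj.
Qed.

Lemma slot_sum_e : W * e = 0.
Proof.
rewrite mulr_suml big1 // => i _; rewrite -mulrA -{1}(projS pe) -starMr e_slot //.
by rewrite star0 mulr0.
Qed.

Lemma slot_sum_tr tau : tracial_state tau -> tr tau W = \sum_(i < n) tr tau (q i).
Proof.
move=> T; rewrite (tr_sum T); apply: eq_bigr => i _.
by rewrite (trC T) mulrA slotM // eqxx eq.
Qed.

Lemma star_slot_sum i : (i < n)%N -> star (u i.+1) * W = q i * star (u i.+1).
Proof.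
move=> hi; rewrite mulr_sumr (bigD1 (Ordinal hi)) //= big1 ?addr0.
  by rewrite !mulrA slotM ?eqxx ?eq // (slt (Ordinal hi)).
move=> j /eqP ji; rewrite !mulrA slotM //; last exact: (slt (Ordinal hi)).
rewrite eqSS; case: eqP => [ij|]; last by rewrite !mul0r.
by exfalso; apply: ji; apply: val_inj.
Qed.

Lemma level_slot_sum r : projection r -> e * r = r -> (forall i, r * q i = q i) ->
  level L u r * W = W.
Proof.
move=> pr er rq; rewrite mulr_sumr; apply: eq_bigr => i _.
by rewrite !mulrA level_slot // -(mulrA (u _)) rq.
Qed.

End SlotSum.

(* Compress [c] from the corner of [f] to that of the smaller projection [r],
   [f] being subequivalent to [S] copies of [r]. *)
Lemma compress (S : nat) f c r p k : strict_comparison A -> (S < L)%N ->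
    projection r -> e * r = r -> projection f -> f * e = 0 ->
    (forall tau, tracial_state tau -> tr tau f < S%:R * tr tau r) ->
    projection p -> p * f = f -> star c = c -> f * c = c -> 0 < k -> nrm c <= k ->
  exists b, [/\ star b = b, r * b = b, nrm b <= S%:R * nrm c &
    commutators e (level L u r) p k S (c - b)].
Proof.
move=> cmp SL pr er pf fe hf pp pf' sc fc k0 ck.
have cf := corner_sa pf sc fc; have fp := corner_sa pp (projS pf) pf'.
have re := corner_sa pe (projS pr) er.
pose H := \sum_(i < S) u i.+1 * r * star (u i.+1).
have pH : projection H by exact: (@slot_sum_projS S SL (fun=> r)).
have [|w [ww Hw]] := comparison_tr cmp pf pH.
  move=> tau T; have -> : tr tau H = S%:R * tr tau r; last exact: hf.
  rewrite (@slot_sum_tr S SL (fun=> r)) // sumr_const card_ord mulr_natl //.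
have wf := isometryE pf ww.
have www : w * star w * w = w by rewrite -mulrA ww wf.
have {}Hw : H * w = w by rewrite -{1}www mulrA Hw www.
have nw : nrm w <= 1.
  by rewrite -ler_sqr ?nnegrE ?nrm_ge0 ?ler01 // -nrm_starM ww expr1n nrm_proj.
have sl (i : 'I_S) : (i.+1 < L)%N by exact: leq_ltn_trans (ltn_ord i) SL.
(* The rows of [w], moved to slot 0: [f] is the sum of the [star (y i) * y i], and [c] is carried to
   the sum of the [y i * c * star (y i)] in the corner of [r]. *)
pose y (i : 'I_S) := r * star (u i.+1) * w.
have sy i : star (y i) = star w * u i.+1 * r.
  by rewrite !starMr starK (projS pr) mulrA.
have ny i : nrm (y i) <= 1.
  apply: nrm_contl; last by [].
  by apply: nrm_contl; [exact: nrm_proj | rewrite nrm_star; exact: nrm_slot].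
have yf i : y i * f = y i by rewrite -mulrA wf.
have ye i : y i * e = 0 by rewrite -yf -mulrA fe mulr0.
have ey i : e * y i = y i by rewrite !mulrA er.
have yp i : y i * p = y i by rewrite -yf -mulrA fp.
have L0 : (0 < L)%N by exact: leq_ltn_trans SL.
have ly i : level L u r * y i = y i by rewrite !mulrA level_base.
have rl : r * level L u r = r.
  by rewrite -{1}(projS pr) -(projS (level_proj pr er)) -starMr level_base // projS.
exists (\sum_i y i * c * star (y i)); split.
- by rewrite star_sum; apply: eq_bigr => i _; rewrite (starMr (y i * c)) starK (starMr (y i)) sc mulrA.
- by rewrite mulr_sumr; apply: eq_bigr => i _; rewrite !mulrA (projM pr).
- apply: le_trans (nrm_sum _ _ _) _; apply: le_trans (_ : \sum_(i < S) nrm c <= _).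
    apply: ler_sum => i _; apply: nrm_contr; first by rewrite nrm_star.
    by apply: nrm_contl.
  by rewrite sumr_const card_ord mulr_natl.
have yy : \sum_i star (y i) * y i = f.
  rewrite -ww -[X in star w * X]Hw mulrA mulr_sumr mulr_suml; apply: eq_bigr => i _.
  by rewrite sy /y !mulrA -(mulrA _ r r) (projM pr).
have kk : k%:C * k^-1%:C = 1 :> R[i] by rewrite -rmorphM /= mulfV // gt_eqF.
(* The minus sign brings the off-diagonal factor [y i] to the first place; the scalar [k] gives the
   two factors norms at most [k] and 1. *)
have -> : c - \sum_i y i * c * star (y i) = \sum_(i < S)
   ((- k%:C *: y i) * (k^-1%:C *: (c * star (y i))) -
    (k^-1%:C *: (c * star (y i))) * (- k%:C *: y i)).
  rewrite -{1}cf -yy mulr_sumr -sumrB; apply: eq_bigr => i _.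
  transitivity ((k%:C * k^-1%:C) *: (c * (star (y i) * y i) - y i * c * star (y i))).
    by rewrite kk scale1r.
  by move: (k%:C) (k^-1%:C) => l l'; ncring.
rewrite -[S in commutators _ _ _ _ S]muln1; apply: commutators_sum => i.
apply: commutators1.
- by rewrite -scalerAr ey.
- by rewrite -scalerAl ye scaler0.
- by rewrite -scalerAr ly.
- by rewrite -scalerAl yp.
- by rewrite -scalerAr mulrA -{1}fc mulrA pf' fc.
- by rewrite -scalerAl sy -!mulrA rl.
- by rewrite scaleNr nrmN nrmZr gtr0_norm // ler_piMr // ltW.
rewrite nrmZr gtr0_norm ?invr_gt0 // mulrC ler_pdivrMr // mul1r.
by apply: nrm_contr => //; rewrite nrm_star.
Qed.

End Slots.

End Step.

(** * One step of the descent *)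

Section Descent.
Context {R : realType} {A : cstarAlgType R}.
Implicit Types (a b c e f g h p q r v w x y z : A) (d k t : R) (tau sigma : A -> R[i]).

Section Slots.
Context {L : nat} {e : A} {u : nat -> A} (hu : slots L e u) (pe : projection e).

(** The sum of the [q i] has trace within tau(r) of m tau(r), hence embeds in m + 2 copies of [r]
    and leaves there a defect of trace at most 3 tau(r) < 18 tau(r'). The defect, with coefficient 2
    t, and the remainder, of norm at most 6 t, are each compressed through 18 copies of [r']: the
    result has norm at most 18 (2 t + 6 t) = 144 t. As k = (2 m + 1) t, the bound 576 = 4 * 144
    makes this at most k / 4. *)
Lemma descent_step (m : nat) r r' a k : real_rank_zero A -> strict_comparison A ->
    576 <= (2 * m)%:R + 1 :> R -> (2 * m < L)%N -> (m + 2 < L)%N -> (18 < L)%N ->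
    projection r -> e * r = r -> projection r' -> e * r' = r' ->
    (forall tau, tracial_state tau -> 0 < tr tau r /\ tr tau r < 6 * tr tau r') ->
    star a = a -> r * a = a -> (forall tau, tracial_state tau -> tr tau a = 0) ->
    0 < k -> nrm a <= k ->
  exists b, [/\ star b = b, r' * b = b, forall tau, tracial_state tau -> tr tau b = 0,
    nrm b <= k / 4 & exists z z', [/\ a - b = z + z',
      commutators e (level L u r) (level L u r) k (2 * m + (m + 2) + 1) z &
      commutators e (level L u r') (level L u r) k (18 + 18) z']].
Proof.
move=> rr0 cmp m576 mL mL2 L18 pr er pr' er' trr sa ra ta k0 ak.
have rr := projM pr; have sr := projS pr; have ee := projM pe; have se := projS pe.
have ar := corner_sa pr sa ra.
have L0 : (0 < L)%N by exact: leq_ltn_trans L18.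
have L1 : (1 < L)%N by exact: leq_ltn_trans L18.
have m0 : (0 < 2 * m)%N.
  by rewrite lt0n; apply/eqP => m0; move: m576; rewrite m0; lra.
pose M := (2 * m)%N; pose t := k / (M%:R + 1).
have M1 : (0 : R) < M%:R + 1 by rewrite ltr_wpDl.
have t0 : 0 < t by rewrite divr_gt0.
have kE : k = (M%:R + 1) * t by rewrite /t mulrC divfK // gt_eqF.
have kt : 576 * t <= k by rewrite kE ler_pM2r.
clearbody t.
have [|q [hq ha']] := projection_approx rr0 pr sa ra t0 m0; first by rewrite -kE.
have pq i := (hq i).1; have rq i := (hq i).2.
have eq i : e * q i = q i by rewrite -(rq i) mulrA er.
set a' := a - _ in ha'.
have MR : M%:R = 2 * m%:R :> R by rewrite natrM.
pose Sq := \sum_(i < M) q i.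
have aE : a = (2 * t)%:C *: Sq - (2 * t * m%:R)%:C *: r + a'.
  by rewrite /a' -/M -/Sq MR; ncring.
have sSq : star Sq = Sq by rewrite star_sum; apply: eq_bigr => i _; exact: projS.
have rSq : r * Sq = Sq by rewrite mulr_sumr; apply: eq_bigr => i _; rewrite rq.
have sa' : star a' = a'.
  by rewrite /a' starB starZr starB !starZr sa sr -/M -/Sq sSq.
have ra' : r * a' = a'.
  rewrite (_ : r * a' = r * a - t%:C *: (2%:C *: (r * Sq) - M%:R%:C *: (r * r))).
    by rewrite ra rSq rr.
  by rewrite /a' -/M -/Sq; ncring.
pose R0 := level L u r; have pR0 : projection R0 := level_proj hu pr er.
have R0r : R0 * r = r := level_base hu pe L0 pr er.
have rR0 : r * R0 = r := corner_sa pR0 sr R0r.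
have R0q i : R0 * q i = q i by rewrite -(rq i) mulrA R0r.
have qR0 i : q i * R0 = q i := corner_sa pR0 (projS (pq i)) (R0q i).
have sR i : (i < L)%N -> star (u i) * R0 = r * star (u i).
  move=> hi; rewrite -{1}(projS pR0) -starMr (level_slot hu pe hi pr er) starMr sr //.
pose P := \sum_(i < M) u i.+1 * q i * star (u i.+1).
pose Q := \sum_(i < m + 2) u i.+1 * r * star (u i.+1).
have pP : projection P by exact: (slot_sum_projS hu mL pq eq).
have pQ : projection Q.
  by apply: (slot_sum_projS hu mL2 (q := fun=> r)).
have trP tau : tracial_state tau -> tr tau P = \sum_(i < M) tr tau (q i).
  by move=> T; exact: (slot_sum_tr hu mL eq T).
have trQ tau : tracial_state tau -> tr tau Q = (m%:R + 2) * tr tau r.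
  move=> T; rewrite (slot_sum_tr hu mL2 (q := fun=> r)) //.
  by rewrite sumr_const card_ord -[LHS]mulr_natl natrD.
(* As tau(a) = 0, the trace of [a'] compensates 2 t times the difference; it is at most 2 t tau(r)
   because [a'] lives under [r]. *)
have trq tau : tracial_state tau -> `|\sum_(i < M) tr tau (q i) - m%:R * tr tau r| <= tr tau r.
  move=> T; have := ta tau T; rewrite aE (trD T) (trB T) !(trZ T) (tr_sum T).
  have h1 := tr_abs_le T pr sa' ra'; have [h2 _] := trr tau T.
  have h3 : nrm a' * tr tau r <= 2 * t * tr tau r by rewrite ler_wpM2r // ltW.
  set X := \sum_(i < M) _; set y := tr tau r in h1 h2 h3 *; move=> h4.
  have h5 : tr tau a' = - (2 * t * (X - m%:R * y)) by lra.
  rewrite h5 normrN normrM gtr0_norm in h1; last lra.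
  by rewrite -(ler_pM2l (_ : 0 < 2 * t)); lra.
have [|v [vv Qv]] := comparison_tr cmp pP pQ.
  move=> tau T; rewrite trP // trQ //; have := trq tau T; have [h _] := trr tau T.
  by rewrite ler_norml; lra.
have vP := isometryE pP vv.
have vvv : v * star v * v = v by rewrite -mulrA vv vP.
have {}Qv : Q * v = v by rewrite -{1}vvv mulrA Qv vvv.
have nv : nrm v <= 1.
  by rewrite -ler_sqr ?nnegrE ?nrm_ge0 ?ler01 // -nrm_starM vv expr1n nrm_proj.
have Qe : Q * e = 0 by exact: (slot_sum_e hu pe mL2).
have eQ : e * Q = 0 by rewrite -se -(projS pQ) -starMr Qe star0.
have ev : e * v = 0 by rewrite -Qv mulrA eQ mul0r.
have ve : star v * e = 0 by rewrite -{1}se -starMr ev star0.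
have R0Q : R0 * Q = Q by exact: (level_slot_sum hu pe mL2 (q := fun=> r)).
have R0v : R0 * v = v by rewrite -Qv mulrA R0Q.
have vR0 : star v * R0 = star v by rewrite -{1}(projS pR0) -starMr R0v.
have sl (i : 'I_M) : (i.+1 < L)%N by exact: leq_ltn_trans (ltn_ord i) mL.
have sl2 (i : 'I_(m + 2)) : (i.+1 < L)%N by exact: leq_ltn_trans (ltn_ord i) mL2.
have nr := nrm_proj pr.
pose P' := v * star v.
pose z1 := (2 * t)%:C *: Sq - (2 * t)%:C *: P'.
have hz1 : commutators e R0 R0 k (M * 1) z1.
  have -> : z1 = \sum_(i < M) (((2 * t)%:C *: (q i * star (u i.+1) * star v)) * (v * u i.+1 * q i)
     - (v * u i.+1 * q i) * ((2 * t)%:C *: (q i * star (u i.+1) * star v))).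
    rewrite sumrB; congr (_ - _).
      rewrite scaler_sumr; apply: eq_bigr => i _; rewrite -scalerAl; congr (_ *: _).
      rewrite !mulrA -(mulrA _ (star v)) vv -(mulrA (q i)) (star_slot_sum hu mL eq) //.
      by rewrite mulrA (projM (pq i)) -(mulrA (q i)) (slotM hu) // eqxx -mulrA eq (projM (pq i)).
    rewrite /P' -{1}vP /P mulr_sumr mulr_suml scaler_sumr; apply: eq_bigr => i _.
    by rewrite -scalerAr; congr (_ *: _); rewrite !mulrA -(mulrA _ (q i) (q i)) (projM (pq i)).
  apply: commutators_sum => i; apply: commutators1.
  - by rewrite -scalerAr !mulrA eq.
  - by rewrite -[LHS]scalerAl -[X in _ *: X]mulrA ve mulr0 scaler0.
  - by rewrite -scalerAr !mulrA R0q.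
  - by rewrite -[LHS]scalerAl -[X in _ *: X = _]mulrA vR0.
  - by rewrite !mulrA R0v.
  - by rewrite -mulrA qR0.
  - rewrite nrmZr gtr0_norm; last lra.
    have : nrm (q i * star (u i.+1) * star v) <= 1.
      apply: nrm_contr; rewrite ?nrm_star //; apply: nrm_contr; last exact: nrm_proj.
      by rewrite nrm_star; exact: (nrm_slot hu).
    by move=> h; apply: le_trans (_ : 2 * t * 1 <= _); [rewrite ler_pM2l //; lra | lra].
  apply: nrm_contr; first exact: nrm_proj.
  by apply: nrm_contr => //; exact: (nrm_slot hu).
pose z2 := (2 * t)%:C *: Q - (2 * t * (m%:R + 2))%:C *: r.
have hz2 : commutators e R0 R0 k ((m + 2) * 1) z2.
  have -> : z2 = \sum_(i < m + 2) ((- (2 * t)%:C *: (r * star (u i.+1))) * (u i.+1 * r)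
     - (u i.+1 * r) * (- (2 * t)%:C *: (r * star (u i.+1)))).
    have hX : \sum_(i < m + 2) (- (2 * t)%:C *: (r * star (u i.+1))) * (u i.+1 * r) =
        - (2 * t * (m%:R + 2))%:C *: r.
      transitivity (\sum_(i < m + 2) - (2 * t)%:C *: r).
        apply: eq_bigr => i _; rewrite -[LHS]scalerAl; congr (_ *: _).
        by rewrite -mulrA (mulrA (star _)) (slotM hu) // eqxx er.
      rewrite sumr_const card_ord -scaler_nat scalerA; congr (_ *: _).
      by rewrite natrD; ring.
    have hY : \sum_(i < m + 2) (u i.+1 * r) * (- (2 * t)%:C *: (r * star (u i.+1))) =
        - (2 * t)%:C *: Q.
      rewrite scaler_sumr; apply: eq_bigr => i _.
      by rewrite -[LHS]scalerAr; congr (_ *: _); rewrite !mulrA -(mulrA _ r r) rr.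
    by rewrite sumrB hX hY /z2; ncring.
  apply: commutators_sum => i; apply: commutators1.
  - by rewrite -scalerAr !mulrA er.
  - by rewrite -[LHS]scalerAl -[X in _ *: X]mulrA -{1}se -starMr (e_slot hu pe) // star0 mulr0 scaler0.
  - by rewrite -scalerAr !mulrA R0r.
  - by rewrite -[LHS]scalerAl -[X in _ *: X = _]mulrA sR // mulrA rr.
  - by rewrite mulrA (level_slot hu pe (sl2 i) pr er) -mulrA rr.
  - by rewrite -mulrA rR0.
  - rewrite scaleNr nrmN nrmZr gtr0_norm; last lra.
    have : nrm (r * star (u i.+1)) <= 1.
      by apply: nrm_contr => //; rewrite nrm_star; exact: (nrm_slot hu).
    by move=> h; apply: le_trans (_ : 2 * t * 1 <= _); [rewrite ler_pM2l //; lra | lra].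
  by apply: nrm_contr => //; exact: (nrm_slot hu).
(* The comparison used m + 2 copies of [r] where the approximation has m; the two extra ones, with
   coefficient 2 t, are restored here. *)
pose a2 := a' + (4 * t)%:C *: r.
have sa2 : star a2 = a2 by rewrite starDr starZr sr sa'.
have ra2 : r * a2 = a2 by rewrite mulrDr -scalerAr ra' rr.
have a2r := corner_sa pr sa2 ra2.
have na2 : nrm a2 <= 6 * t.
  apply: le_trans (nrmD _ _) _; rewrite nrmZr gtr0_norm; last lra.
  have : 4 * t * nrm r <= 4 * t by rewrite ler_piMr //; lra.
  by lra.
pose w := u 1%N; have nw : nrm w <= 1 by exact: (nrm_slot hu pe L1).
have ww : star w * w = e by rewrite (slotM hu L1 L1) eqxx.
have we : w * e = w by exact: (slot_e hu pe L1).
have ew : e * w = 0 by exact: (e_slot hu pe L1).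
(* Moved to slot 1, the remainder becomes orthogonal to [e], as [compress] requires. *)
pose c2 := w * a2 * star w.
have hz3 : commutators e R0 R0 k 1 (a2 - c2).
  have -> : a2 - c2 = (a2 * star w) * (w * r) - (w * r) * (a2 * star w).
    congr (_ - _); first by rewrite -mulrA (mulrA (star w)) ww er a2r.
    by rewrite /c2 !mulrA -(mulrA w r) ra2.
  apply: commutators1.
  - by rewrite mulrA -{1}ra2 mulrA er ra2.
  - by rewrite -mulrA -{1}se -starMr ew star0 mulr0.
  - by rewrite mulrA -{1}ra2 mulrA R0r ra2.
  - by rewrite -mulrA sR // mulrA a2r.
  - by rewrite mulrA (level_slot hu pe L1 pr er) -mulrA rr.
  - by rewrite -mulrA rR0.
  - by apply: nrm_contr; [rewrite nrm_star | lra].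
  by apply: nrm_contl.
pose D := Q - P'; pose c1 := - (2 * t)%:C *: D.
have pP' : projection P'.
  have := coisometry_proj (v := star v); rewrite starK vv; exact.
have QP' : Q * P' = P' by rewrite mulrA Qv.
have pD : projection D := proj_sub pQ pP' QP'.
have De : D * e = 0 by rewrite mulrBl Qe -mulrA ve mulr0 subrr.
have R0D : R0 * D = D by rewrite mulrBr R0Q mulrA R0v.
have sc1 : star c1 = c1 by rewrite /c1 scaleNr starN starZr (projS pD).
have Dc1 : D * c1 = c1 by rewrite -scalerAr (projM pD).
have nc1 : nrm c1 <= 2 * t.
  rewrite /c1 scaleNr nrmN nrmZr gtr0_norm; last lra.
  by rewrite ler_piMr ?nrm_proj //; lra.
have trD' tau : tracial_state tau -> tr tau D < 18%:R * tr tau r'.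
  move=> T; rewrite (trB T) trQ // -(tr_mvn T) vv trP //; have := trq tau T.
  by have [h1 h2] := trr tau T; rewrite ler_norml; lra.
have c1k : nrm c1 <= k by lra.
have [b1 [sb1 rb1 nb1 hb1]] :=
  compress hu pe cmp L18 pr' er' pD De trD' pR0 R0D sc1 Dc1 k0 c1k.
pose f := w * r * star w.
have pf : projection f.
  split; first by rewrite /selfadjoint !starMr starK sr mulrA.
  rewrite -mulrA (mulrA (star w)) (mulrA (star w)) ww er mulrA -(mulrA w) rr //.
have fe : f * e = 0 by rewrite -mulrA -{1}se -starMr ew star0 mulr0.
have trf tau : tracial_state tau -> tr tau f < 18%:R * tr tau r'.
  move=> T; rewrite (trC T) mulrA ww er; have [h1 h2] := trr tau T; lra.
have R0f : R0 * f = f.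
  by rewrite !mulrA (level_slot hu pe L1 pr er) -(mulrA w) rr.
have sc2 : star c2 = c2 by rewrite !starMr starK sa2 mulrA.
have fc2 : f * c2 = c2.
  rewrite /f /c2 -mulrA (mulrA (star w)) (mulrA (star w)) ww.
  have ea2 : e * a2 = a2 by rewrite -{1}ra2 mulrA er ra2.
  by rewrite ea2 mulrA -(mulrA w r) ra2.
have nc2 : nrm c2 <= 6 * t.
  by apply: nrm_contr; [rewrite nrm_star | exact: nrm_contl].
have c2k : nrm c2 <= k by lra.
have [b2 [sb2 rb2 nb2 hb2]] :=
  compress hu pe cmp L18 pr' er' pf fe trf pR0 R0f sc2 fc2 k0 c2k.
have hz : commutators e R0 R0 k (2 * m + (m + 2) + 1) (z1 + z2 + (a2 - c2)).
  apply: commutatorsD hz3; rewrite -[(2 * m)%N]muln1 -[(m + 2)%N]muln1.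
  exact: commutatorsD.
have hz' := commutatorsD hb1 hb2.
have zE : a - (b1 + b2) = z1 + z2 + (a2 - c2) + ((c1 - b1) + (c2 - b2)).
  by rewrite [in LHS]aE /z1 /z2 /a2 /c1 /D; ncring.
exists (b1 + b2); split.
- by rewrite starDr sb1 sb2.
- by rewrite mulrDr rb1 rb2.
- move=> tau T; have := congr1 (tr tau) zE.
  rewrite (trB T) [in RHS](trD T) (tr_commutators T hz) (tr_commutators T hz') ta //.
  lra.
- by apply: le_trans (nrmD _ _) _; lra.
by exists (z1 + z2 + (a2 - c2)), ((c1 - b1) + (c2 - b2)).
Qed.


End Slots.
End Descent.

(** * Summing the commutators of all steps *)

Section Telescoping.
Context {R : realType} {A : cstarAlgType R}.
Implicit Types (a b c e f g h p q r v w z : A) (d k t : R) (tau sigma : A -> R[i]).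

Lemma half_pow_le (n : nat) : (0 : R) <= (1/2) ^+ n.
Proof. by rewrite exprn_ge0 //; lra. Qed.

Lemma half_series (x : nat -> A) : (forall n, nrm (x n) <= (1/2) ^+ n) ->
  exists l, forall n, nrm (l - \sum_(i < n) x i) <= 2 * (1/2) ^+ n.
Proof.
move=> hx; have [|||l hl] := @geometric_limit R A (fun n => \sum_(i < n) x i) 1 (1/2).
- exact: ler01.
- lra.
- by move=> n; rewrite big_ord_recr /= [X in X - _]addrC addrK mul1r.
exists l => n; apply: le_trans (hl n) _.
by rewrite (_ : 1 - 1 / 2 = 2^-1 :> R) ?div1r ?invrK //; lra.
Qed.

(** Since mixed products vanish, the partial sums of the commutators are the commutators of the
    partial sums, and the whole series becomes one commutator. The partial sums have norm at most 4
    and the limits at most 2, whence 24 = 2 (2 * 2 + 4 * 2). *)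
Lemma commutator_series (x y : nat -> A) e : projection e ->
    (forall n, [/\ nrm (x n) <= (1/2) ^+ n, nrm (y n) <= (1/2) ^+ n,
      e * x n = x n & x n * e = 0]) ->
    (forall m n, m <> n -> x m * y n = 0 /\ y m * x n = 0) ->
  exists X Y, [/\ e * X = X, X * e = 0, nrm X <= 2, nrm Y <= 2 &
    forall n, nrm (X * Y - Y * X - \sum_(i < n) (x i * y i - y i * x i))
      <= 24 * (1/2) ^+ n].
Proof.
move=> pe hxy cross.
have [|X hX] := @half_series x; first by move=> n; case: (hxy n).
have [|Y hY] := @half_series y; first by move=> n; case: (hxy n).
pose Xs n := \sum_(i < n) x i; pose Ys n := \sum_(i < n) y i.
have eXs n : e * Xs n = Xs n.
  by rewrite mulr_sumr; apply: eq_bigr => i _; case: (hxy i).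
have Xse n : Xs n * e = 0.
  by rewrite mulr_suml big1 // => i _; case: (hxy i).
have half01 : 0 <= (1/2 : R) < 1 by lra.
have ne := nrm_proj pe.
have nX : nrm X <= 2 by have := hX 0%N; rewrite big_ord0 subr0 expr0 mulr1.
have nY : nrm Y <= 2 by have := hY 0%N; rewrite big_ord0 subr0 expr0 mulr1.
have nXs n : nrm (Xs n) <= 4.
  have -> : Xs n = X - (X - Xs n) by rewrite subKr.
  apply: le_trans (nrmB _ _) _; have := hX n; rewrite -/(Xs n).
  have : (1/2 : R) ^+ n <= 1 by apply: exprn_ile1; lra.
  by lra.
have nYs n : nrm (Ys n) <= 4.
  have -> : Ys n = Y - (Y - Ys n) by rewrite subKr.
  apply: le_trans (nrmB _ _) _; have := hY n; rewrite -/(Ys n).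
  have : (1/2 : R) ^+ n <= 1 by apply: exprn_ile1; lra.
  by lra.
exists X, Y; split => //.
- apply/eqP; rewrite -subr_eq0; apply/eqP.
  apply: (@eq0_geometric _ _ _ 4 (1/2)) => // n.
  have -> : e * X - X = e * (X - Xs n) - (X - Xs n) by rewrite mulrBr eXs; ncring.
  apply: le_trans (nrmB _ _) _; have := nrm_contl ne (hX n); have := hX n.
  by rewrite -/(Xs n); lra.
- apply: (@eq0_geometric _ _ _ 2 (1/2)) => // n.
  have -> : X * e = (X - Xs n) * e by rewrite mulrBl Xse subr0.
  exact: (nrm_contr ne (hX n)).
move=> n.
have -> : \sum_(i < n) (x i * y i - y i * x i) = Xs n * Ys n - Ys n * Xs n.
  rewrite sumrB /Xs /Ys !mulr_suml; congr (_ - _); apply: eq_bigr => i _;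
  rewrite mulr_sumr (bigD1 i) //= big1 ?addr0 // => j ji.
    by case: (cross i j) => // ij; move/eqP: ji; apply; exact/esym/val_inj.
  by case: (cross i j) => // ij; move/eqP: ji; apply; exact/esym/val_inj.
have -> : X * Y - Y * X - (Xs n * Ys n - Ys n * Xs n) =
   ((X - Xs n) * Y + Xs n * (Y - Ys n)) - ((Y - Ys n) * X + Ys n * (X - Xs n)) by ncring.
apply: le_trans (nrmB _ _) _.
have := nrmD ((X - Xs n) * Y) (Xs n * (Y - Ys n)).
have := nrmD ((Y - Ys n) * X) (Ys n * (X - Xs n)).
have := nrmM_le (hX n) nY; have := nrmM_le (nXs n) (hY n).
have := nrmM_le (hY n) nX; have := nrmM_le (nYs n) (hX n).
rewrite -/(Xs n) -/(Ys n); have := half_pow_le n.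
lra.
Qed.

(* Balancing the factors of the [n]-th commutators, of norms [4^-n] and [1], to
   norms [2^-n] makes both series of factors converge. *)
Lemma commutators_series (z : nat -> A) e (p q : nat -> A) (M : nat) : projection e ->
    (forall n, commutators e (p n) (q n) ((1/4) ^+ n) M (z n)) ->
    (forall m n, m <> n -> p m * p n = 0) -> (forall m n, m <> n -> q m * q n = 0) ->
  exists W, proj_comb (M * 32) 16 W /\
    forall n, nrm (W - \sum_(i < n) z i) <= (M%:R * 24) * (1/2) ^+ n.
Proof.
move=> pe hz orthp orthq; have [s hs] := choice hz.
(* For fixed [j], the j-th commutators of all steps form one series; the default (0, 0) completes
   the steps that have fewer than [M]. *)
pose x j n : A := (2 ^+ n)%:C *: (nth (0, 0) (s n) j).1.
pose y j n : A := ((1/2) ^+ n)%:C *: (nth (0, 0) (s n) j).2.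
have pow n : ((2 : R) ^+ n)%:C * ((1/2 : R) ^+ n)%:C = 1 :> R[i].
  rewrite -rmorphM /= -exprMn (_ : 2 * (1/2) = 1) ?expr1n //; lra.
have facts j n : [/\ e * (nth (0, 0) (s n) j).1 = (nth (0, 0) (s n) j).1 /\
      (nth (0, 0) (s n) j).1 * e = 0,
    p n * (nth (0, 0) (s n) j).1 = (nth (0, 0) (s n) j).1 /\
      (nth (0, 0) (s n) j).1 * q n = (nth (0, 0) (s n) j).1,
    q n * (nth (0, 0) (s n) j).2 = (nth (0, 0) (s n) j).2 /\
      (nth (0, 0) (s n) j).2 * p n = (nth (0, 0) (s n) j).2,
    nrm (nth (0, 0) (s n) j).1 <= (1/4) ^+ n & nrm (nth (0, 0) (s n) j).2 <= 1].
  have [lt|ge] := ltnP j (size (s n)).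
    by have [_ h _] := hs n; apply: h; exact: mem_nth.
  rewrite nth_default //= !mulr0 !mul0r nrm0; split=> //; apply: exprn_ge0; lra.
have ex j : exists XY : A * A, [/\ e * XY.1 = XY.1, XY.1 * e = 0, nrm XY.1 <= 2, nrm XY.2 <= 2 &
    forall n, nrm (XY.1 * XY.2 - XY.2 * XY.1 - \sum_(i < n) (x j i * y j i - y j i * x j i))
      <= 24 * (1/2) ^+ n].
  have [||X [Y h]] := @commutator_series (x j) (y j) e pe; last by exists (X, Y).
    move=> n; have [[h1 h2] _ _ h3 h4] := facts j n; split.
    - rewrite nrmZr ger0_norm ?exprn_ge0 //.
      have -> : (1/2 : R) ^+ n = 2 ^+ n * (1/4) ^+ n.
        by rewrite -exprMn; congr (_ ^+ _); lra.
      by rewrite ler_wpM2l ?exprn_ge0.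
    - by rewrite nrmZr ger0_norm ?half_pow_le // ler_piMr ?half_pow_le.
    - by rewrite -scalerAr h1.
    - by rewrite -scalerAl h2 scaler0.
  move=> m n mn; have [_ [px xq] [qy yp] _ _] := facts j m.
  have [_ [px' xq'] [qy' yp'] _ _] := facts j n.
  rewrite /x /y; split.
    by rewrite -xq -qy' -scalerAl -scalerAr -mulrA (mulrA (q m)) orthq // mul0r mulr0 !scaler0.
  by rewrite -yp -px' -scalerAl -scalerAr -mulrA (mulrA (p m)) orthp // mul0r mulr0 !scaler0.
have [XY hXY] := choice ex.
exists (\sum_(j < M) ((XY j).1 * (XY j).2 - (XY j).2 * (XY j).1)); split.
  apply: proj_comb_sum_ord => j; have [h1 h2 h3 h4 _] := hXY j.
  apply: (proj_comb_mono (leqnn _) _ (offdiag_commutator_proj_comb _ pe h1 h2)).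
  by have := nrm_ge0 (XY j).1; have := nrm_ge0 (XY j).2; nra.
move=> n.
have zE i : z i = \sum_(j < M) (x j i * y j i - y j i * x j i).
  have [sM _ ->] := hs i; rewrite (big_nth (0, 0)) big_mkord.
  rewrite (big_ord_widen M (fun j => (nth (0, 0) (s i) j).1 * (nth (0, 0) (s i) j).2 -
    (nth (0, 0) (s i) j).2 * (nth (0, 0) (s i) j).1)) // big_mkcond /=.
  apply: eq_bigr => j _; rewrite /x /y.
  have bal (c c' : R[i]) (v w : A) : c * c' = 1 ->
      c *: v * (c' *: w) - c' *: w * (c *: v) = v * w - w * v.
    move=> cc; transitivity ((c * c') *: (v * w - w * v)); first by ncring.
    by rewrite cc scale1r.
  rewrite bal; last exact: pow.
  by case: ltnP => // ge; rewrite nth_default //= mul0r subr0.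
have -> : \sum_(i < n) z i = \sum_(j < M) \sum_(i < n) (x j i * y j i - y j i * x j i).
  by rewrite exchange_big; apply: eq_bigr.
rewrite -sumrB; apply: le_trans (nrm_sum _ _ _) _.
apply: le_trans (_ : \sum_(j < M) 24 * (1/2) ^+ n <= _).
  by apply: ler_sum => j _; case: (hXY j).
by rewrite sumr_const card_ord -[leLHS]mulr_natl mulrA.
Qed.

(* [a = a_0], where [a_n] lies in the corner of [r_n], has norm at most [4^-n],
   and differs from [a_(n+1)] by a bounded number of commutators. *)
Lemma corner_traceless_proj_comb (L : nat) e (u r : nat -> A) (m : nat) :
    real_rank_zero A -> strict_comparison A -> slots L e u -> projection e ->
    576 <= (2 * m)%:R + 1 :> R -> (2 * m < L)%N -> (m + 2 < L)%N -> (18 < L)%N ->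
    (forall n, projection (r n) /\ e * r n = r n) ->
    (forall n n', n <> n' -> r n * r n' = 0) ->
    (forall n tau, tracial_state tau ->
      0 < tr tau (r n) /\ tr tau (r n) < 6 * tr tau (r n.+1)) ->
  exists N, forall a, star a = a -> r 0%N * a = a ->
    (forall tau, tracial_state tau -> tr tau a = 0) -> nrm a <= 1 ->
    proj_comb N 16 a.
Proof.
move=> rr0 cmp hu pe m576 mL mL2 L18 pr orth trr.
pose M1 := (2 * m + (m + 2) + 1)%N; pose M2 := (18 + 18)%N.
exists (M1 * 32 + M2 * 32)%N => a sa ra ta na.
pose good n b := [/\ star b = b, r n * b = b,
  forall tau, tracial_state tau -> tr tau b = 0 & nrm b <= (1/4) ^+ n].
pose lev n := level L u (r n).
(* Commutators inside level n and those between levels n + 1 and n have different supports; they are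
   summed as two separate families. *)
pose linked n b c := exists z z', [/\ b - c = z + z',
  commutators e (lev n) (lev n) ((1/4) ^+ n) M1 z &
  commutators e (lev n.+1) (lev n) ((1/4) ^+ n) M2 z'].
have next n b : exists c, good n b -> good n.+1 c /\ linked n b c.
  have [[sb rb tb nb]|ng] := pselect (good n b); last by exists 0.
  have [pn en] := pr n; have [pn' en'] := pr n.+1.
  have pow0 : (0 : R) < (1/4) ^+ n by rewrite exprn_gt0 //; lra.
  have [c [sc rc tc nc lk]] := descent_step hu pe rr0 cmp m576 mL mL2 L18 pn en
    pn' en' (trr n) sb rb tb pow0 nb.
  exists c => _; split => //; split => //.
  by apply: le_trans nc _; rewrite exprS; lra.
have [f hf] := choice (fun nb : nat * A => next nb.1 nb.2).
pose s := fix s n := if n is n'.+1 then f (n', s n') else a.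
have goods n : good n (s n).
  elim: n => [|n IHn]; first by split; rewrite ?expr0.
  by have [] := hf (n, s n) IHn.
have links n : linked n (s n) (s n.+1) by have [] := hf (n, s n) (goods n).
have s0 : s 0%N = a by [].
clearbody s.
have [z hz] := choice links; have [z' hz'] := choice hz.
have orthl n n' : n <> n' -> lev n * lev n' = 0.
  by move=> nn; have [p1 e1] := pr n; have [p2 e2] := pr n'; apply: (level_orth hu pe) => //; exact: orth.
have [|||W [cW hW]] := @commutators_series z e lev lev M1 pe.
- by move=> n; case: (hz' n).
- exact: orthl.
- exact: orthl.
have [|||W' [cW' hW']] := @commutators_series z' e (fun n => lev n.+1) lev M2 pe.
- by move=> n; case: (hz' n).
- by move=> n n' nn; apply: orthl => - [].
- exact: orthl.
suff -> : a = W + W' by exact: proj_combD.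
apply/eqP; rewrite -subr_eq0; apply/eqP.
apply: (@eq0_geometric _ _ _ (1 + M1%:R * 24 + M2%:R * 24) (1/2)) => [||n].
- by rewrite !addr_ge0 ?mulr_ge0.
- by lra.
have aE : a = s n + (\sum_(i < n) z i + \sum_(i < n) z' i).
  elim: n => [|n IHn]; first by rewrite !big_ord0 !addr0 s0.
  rewrite !big_ord_recr /= [LHS]IHn; have [h _ _] := hz' n.
  rewrite -[X in X + _ = _](subrK (s n.+1)) h.
  by move: (s n.+1) (z n) (z' n) (\sum_(i < n) z i) (\sum_(i < n) z' i) => *; ncring.
rewrite [in X in X - _]aE.
rewrite (_ : _ - _ = s n - (W - \sum_(i < n) z i) - (W' - \sum_(i < n) z' i)); last first.
  by move: (s n) (\sum_(i < n) z i) (\sum_(i < n) z' i) => *; ncring.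
apply: le_trans (nrmB _ _) _; have := nrmB (s n) (W - \sum_(i < n) z i).
have [_ _ _ hs] := goods n; have := hW n; have := hW' n.
have : (1/4 : R) ^+ n <= (1/2) ^+ n by apply: lerXn2r; rewrite ?nnegrE; lra.
rewrite !mulrDl; lra.
Qed.

End Telescoping.

(** * Reduction to traceless elements of a corner *)

Section Assembly.
Context {R : realType} {A : cstarAlgType R}.
Implicit Types (a b c e f g h p q r v w x y z : A) (d k t : R) (tau sigma : A -> R[i]).

(** By [halving], [a] is a limit of real combinations of projections, whose trace vectors lie in the
    row space of [H]. This space is the kernel of [cokermx H], hence closed. *)
Lemma trace_approx (n : nat) (taus : 'I_n -> A -> R[i]) (d : nat) (H : 'M[R]_(d, n)) a :
    real_rank_zero A -> (forall j, tracial_state (taus j)) ->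
    (forall p, projection p -> (\row_j tr (taus j) p <= H)%MS) -> star a = a ->
  (\row_j tr (taus j) a <= H)%MS.
Proof.
move=> rr0 T Hp sa; pose tv x : 'rV[R]_n := \row_j tr (taus j) x.
have approx m : exists y, [/\ star y = y, nrm (a - y) <= nrm a * (3/4) ^+ m & (tv y <= H)%MS].
  elim: m => [|m [y [sy ny Hy]]].
    exists 0; rewrite star0 subr0 expr0 mulr1; split=> //.
    rewrite (_ : tv 0 = 0) ?sub0mx //.
    by apply/rowP => j; rewrite !mxE (tr0 (T j)).
  set k := nrm a * _ in ny; have k0 : 0 <= k := le_trans (nrm_ge0 _) ny.
  rewrite exprS mulrCA -/k.
  have [k_0|kn0] := eqVneq k 0.
    by exists y; rewrite k_0 mulr0 -{1}k_0.
  have kp : 0 < k by rewrite lt_neqAle eq_sym kn0.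
  have [|||||q [pq _ hq]] := @halving _ _ 1 (a - y) (k / 2) k (k / 4) rr0 proj_one _ _ ny.
  - by rewrite starB sa sy.
  - by rewrite mul1r.
  - lra.
  - lra.
  - lra.
  exists (y + (k / 2)%:C *: (2%:C *: q - 1)); split.
  - by rewrite starDr starZr starB starZr star1 (projS pq) sy.
  - by rewrite opprD addrA; lra.
  rewrite (_ : tv _ = tv y + (k *: tv q - (k / 2) *: tv 1)).
    by rewrite addmx_sub // addmx_sub ?scalemx_sub ?eqmx_opp ?scalemx_sub ?Hp //; exact: proj_one.
  apply/rowP => j; rewrite !mxE (trD (T j)) (trZ (T j)) (trB (T j)) (trZ (T j)); lra.
rewrite submxE; apply/eqP/rowP => j; rewrite !mxE.
pose B := \sum_i `|cokermx H i j|.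
apply/eqP; rewrite -normr_eq0 eq_le normr_ge0 andbT; apply/ler_addgt0Pr => e e0; rewrite add0r.
have half01 : 0 <= (3/4 : R) < 1 by lra.
have B0 : 0 <= B by apply: sumr_ge0 => i _; exact: normr_ge0.
have [m hm] := pow_small half01 (mulr_ge0 B0 (nrm_ge0 a)) e0.
have [y [sy ny Hy]] := approx m; apply/ltW; apply: le_lt_trans hm.
have -> : \sum_j0 (\row_j1 tr (taus j1) a) 0 j0 * cokermx H j0 j =
    \sum_i tr (taus i) (a - y) * cokermx H i j.
  have := Hy; rewrite submxE => /eqP/rowP/(_ j); rewrite mxE [RHS]mxE => hy.
  transitivity (\sum_i tv a 0 i * cokermx H i j - \sum_i tv y 0 i * cokermx H i j).
    by rewrite hy subr0.
  rewrite -sumrB; apply: eq_bigr => i _.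
  by rewrite !mxE (trB (T i)) mulrBl.
apply: le_trans (ler_norm_sum _ _ _) _; rewrite -mulrA mulr_suml; apply: ler_sum => i _.
rewrite normrM mulrC ler_wpM2l //; exact: le_trans (tr_bound (T i) _) ny.
Qed.

(** Projections whose matrix of traces has maximal rank account for the trace vectors of all
    projections. The coefficients come from a fixed pseudo-inverse, which bounds them by a multiple
    of |a|. *)
Lemma trace_subtraction (ts : seq (A -> R[i])) : real_rank_zero A -> maximized_on ts ->
  exists (d : nat) (h : 'I_d -> A) (C : R), [/\ forall i, projection (h i), 0 <= C &
    forall a, star a = a -> exists beta : 'I_d -> R,
      (forall i, `|beta i| <= C * nrm a) /\
      forall tau, tracial_state tau -> tr tau (a - \sum_i (beta i)%:C *: h i) = 0].
Proof.
move=> rr0 [Ts maxts]; pose k := size ts.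
pose taus (j : 'I_k) := nth 0 ts j.
have T j : tracial_state (taus j) by apply: Ts; exact: mem_nth.
pose mat (d : nat) (h : 'I_d -> A) : 'M[R]_(d, k) := \matrix_(i, j) tr (taus j) (h i).
pose P n := `[< exists (d : nat) (h : 'I_d -> A), (forall i, projection (h i)) /\ \rank (mat d h) = n >].
have P0 : exists n, P n.
  exists (\rank (mat 0%N (fun=> 0))); apply/asboolP; exists 0%N, (fun=> 0); split=> //.
  by case.
have Pk n : P n -> (n <= k)%N by move=> /asboolP[d [h [_ <-]]]; exact: rank_leq_col.
have [n /asboolP [d [h [ph hn]]] maxn] := ex_maxnP P0 Pk.
have Hp p : projection p -> (\row_j tr (taus j) p <= mat d h)%MS.
  move=> pp; pose h' (i : 'I_(1 + d)) := match fintype.split i with inl _ => p | inr i' => h i' end.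
  have hE : mat _ h' = col_mx (\row_j tr (taus j) p) (mat d h).
    by apply/matrixP => i j; rewrite !mxE /h'; case: (fintype.split i) => i'; rewrite !mxE.
  have : P (\rank (mat _ h')).
    apply/asboolP; exists (1 + d)%N, h'; split=> // i; rewrite /h'.
    by case: (fintype.split i).
  move=> /maxn; rewrite -hn hE => le_rank.
  have sub : (mat d h <= col_mx (\row_j tr (taus j) p) (mat d h))%MS.
    by rewrite -addsmxE addsmxSr.
  have [le_r eq_r] := mxrank_leqif_sup sub.
  have : (col_mx (\row_j tr (taus j) p) (mat d h) <= mat d h)%MS.
    by rewrite -eq_r eqn_leq le_r.
  by apply: submx_trans; rewrite -addsmxE addsmxSl.
pose C := \sum_i \sum_j `|pinvmx (mat d h) j i|.
exists d, h, C; split => //.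
  by apply: sumr_ge0 => i _; apply: sumr_ge0 => j _; exact: normr_ge0.
move=> a sa; have Ha := trace_approx rr0 T Hp sa.
set va := \row_j _ in Ha; pose beta := va *m pinvmx (mat d h).
exists (fun i => beta 0 i); split.
  move=> i; rewrite mxE; apply: le_trans (ler_norm_sum _ _ _) _.
  apply: le_trans (_ : (\sum_j `|pinvmx (mat d h) j i|) * nrm a <= _).
    rewrite mulr_suml; apply: ler_sum => j _; rewrite normrM mulrC.
    by rewrite ler_wpM2l // mxE tr_bound.
  rewrite ler_wpM2r ?nrm_ge0 // /C (bigD1 i) //= lerDl.
  by apply: sumr_ge0 => i' _; apply: sumr_ge0 => j _; exact: normr_ge0.
set b := a - _.
have zero tau : tau \in ts -> tr tau b = 0.
  move=> hts; have hi : (index tau ts < k)%N by rewrite index_mem.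
  have tE : taus (Ordinal hi) = tau by rewrite /taus /= nth_index.
  have := mulmxKpV Ha => /rowP/(_ (Ordinal hi)); rewrite -/beta mxE [RHS]mxE tE => E.
  rewrite /b (trB (Ts _ hts)) -E (tr_sum (Ts _ hts)) -sumrB big1 // => i _.
  by rewrite (trZ (Ts _ hts)) [mat d h _ _]mxE tE subrr.
move=> tau T'; have [t1 h1 l1] := maxts _ T' b; have [t2 h2 l2] := maxts _ T' (- b).
by rewrite (trN T') (trN (Ts _ h2)) (zero _ h2) in l2; rewrite (zero _ h1) in l1; lra.
Qed.

(** 1 - r is cut into pieces subequivalent to [r]. The diagonal blocks of [b] over these pieces are
    moved under [r] by commutators with off-diagonal factors, and the off-diagonal blocks are
    themselves combinations of projections. *)
Lemma compress_to_corner r : real_rank_zero A -> simple A -> projection r -> r <> 0 ->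
  exists m N, forall b, star b = b -> exists b', [/\ star b' = b', r * b' = b',
    forall tau, tracial_state tau -> tr tau b' = tr tau b,
    nrm b' <= m%:R * nrm b & proj_comb N (4 * nrm b) (b - b')].
Proof.
move=> rr0 sA pr r0; have rr := projM pr; have sr := projS pr.
have [m hm] := subordinate_decomposition rr0 sA pr r0.
have pr' := proj_compl pr; have [v [hv orth vE]] := hm _ pr'.
have rr' : r * (1 - r) = 0 by rewrite mulrBr mulr1 rr subrr.
pose f i := v i * star (v i).
have pf i : (i < m)%N -> projection (f i) by move=> /hv[].
have of_ i j : (i < m)%N -> (j < m)%N -> i <> j -> f i * f j = 0.
  by move=> hi hj ij; rewrite /f -mulrA (mulrA (star _)) orth // mul0r mulr0.
have rf i : (i < m)%N -> r * f i = 0.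
  by move=> /hv [_ h _]; rewrite /f -h !mulrA rr' !mul0r.
have nv i : (i < m)%N -> nrm (v i) <= 1.
  move=> hi; rewrite -ler_sqr ?nnegrE ?nrm_ge0 ?ler01 // -nrm_Mstar expr1n nrm_proj //.
  exact: pf.
exists m.+1, (m * 8 + (4 + 4) + m * 32)%N => b sb.
have [_ cdiag] := block_diag_proj_comb b pf of_.
rewrite -vE in cdiag.
exists (r * b * r + \sum_(i < m) star (v i) * b * v i); split.
- rewrite starDr star_sum !starMr sr sb mulrA; congr (_ + _); apply: eq_bigr => i _.
  by rewrite !starMr starK sb mulrA.
- rewrite mulrDr !mulrA rr; congr (_ + _); rewrite mulr_sumr; apply: eq_bigr => i _.
  have [_ _ vr] := hv i (ltn_ord i).
  by rewrite !mulrA -{1}sr -starMr vr.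
- move=> tau T; rewrite (trD T) (tr_sum T) (trC T) mulrA rr.
  under eq_bigr => i _ do rewrite -mulrA (trC T) -mulrA.
  rewrite -(tr_sum T) -mulr_sumr -vE -[X in X + _](trC T) -(trD T) -mulrDr.
  by rewrite addrC subrK mulr1.
- apply: le_trans (nrmD _ _) _; rewrite -natr1 mulrDl mul1r addrC; apply: lerD.
    apply: le_trans (nrm_sum _ _ _) _; apply: le_trans (_ : \sum_(i < m) nrm b <= _).
      apply: ler_sum => i _; have := nv i (ltn_ord i) => h.
      by apply: nrm_contr => //; apply: nrm_contl; rewrite ?nrm_star.
    by rewrite sumr_const card_ord mulr_natl.
  by apply: nrm_contr; [exact: nrm_proj | apply: nrm_contl => //; exact: nrm_proj].
have -> : b - (r * b * r + \sum_(i < m) star (v i) * b * v i) =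
  ((1 - r) * b * (1 - r) - \sum_(i < m) f i * b * f i) +
  (r * b * (1 - r) + (1 - r) * b * r) +
  \sum_(i < m) (f i * b * f i - star (v i) * b * v i).
  have -> : \sum_(i < m) (f i * b * f i - star (v i) * b * v i) =
      \sum_(i < m) f i * b * f i - \sum_(i < m) star (v i) * b * v i by rewrite sumrB.
  by ncring.
have b24 : 2 * nrm b <= 4 * nrm b by have := nrm_ge0 b; lra.
apply: proj_combD; first apply: proj_combD.
- exact: proj_comb_mono (leqnn _) b24 cdiag.
- have r'r : (1 - r) * r = 0 by rewrite mulrBl mul1r rr subrr.
  by apply: (@proj_combD _ _ 4 4); apply: (proj_comb_mono (leqnn _) b24);
    apply: block_proj_comb.
apply: proj_comb_sum_ord => i; have hi := ltn_ord i; have [_ _ vr] := hv i hi.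
have fv : f i * v i = v i by apply: coisometryE; exact: pf.
have ff := projM (pf i hi).
have vf : star (v i) * f i = star (v i) by rewrite -{1}(projS (pf i hi)) -starMr fv.
rewrite (_ : _ - _ = (f i * b * v i) * star (v i) - star (v i) * (f i * b * v i)); last first.
  congr (_ - _); first by rewrite -[RHS]mulrA.
  by rewrite (mulrA (star (v i))) (mulrA (star (v i))) vf.
apply: (proj_comb_mono (leqnn _) _ (offdiag_commutator_proj_comb _ (pf i hi) _ _)).
- have h1 : nrm (f i * b * v i) <= nrm b.
    by apply: nrm_contr; [exact: nv | apply: nrm_contl => //; exact/nrm_proj/pf].
  have h2 : nrm (star (v i)) <= 1 by rewrite nrm_star nv.
  have := nrm_ge0 (f i * b * v i); have := nrm_ge0 (star (v i)); nra.
- by rewrite (mulrA (f i)) (mulrA (f i)) ff.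
have vf0 : v i * f i = 0 by rewrite -vr -mulrA rf // mulr0.
by rewrite -[LHS]mulrA vf0 mulr0.
Qed.

Lemma selfadjoint_proj_comb : simple A -> separable A -> real_rank_zero A ->
    strict_comparison A -> finite_set (extreme_points (tracial_states A)) ->
  exists N V, 0 <= V /\ forall a, star a = a -> proj_comb N (V * nrm a) a.
Proof.
move=> sA sepA rr0 cmp /finite_seqP [ts tsE]; have [T0 _] := cmp.
have maxts : maximized_on ts.
  split=> [tau hts|sigma Ts a].
    by have : [set` ts] tau by []; rewrite -tsE => -[].
  have [tau ext h] := extreme_maximizer a sepA T0.
  by exists tau; [have : [set` ts] tau by rewrite -tsE | exact: h].
have Ts := maxts.1.
have [[d [d0 low]]|nolow] := pselect (exists d, 0 < d /\ forall g, projection g ->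
    g <> 0 -> exists2 tau, tau \in ts & d <= tr tau g).
  have [N hN] := atomic_proj_comb rr0 sA T0 d0 Ts low.
  by exists N, 2.
have small d : 0 < d -> exists g, [/\ projection g, g <> 0 &
    forall tau, tracial_state tau -> tr tau g < d].
  move=> d0; apply: contrapT => none; apply: nolow; exists d; split => // g pg g0.
  apply: contrapT => hg; apply: none; exists g; split => // tau T.
  have [t1 h1 l1] := maxts.2 _ T g; apply: le_lt_trans l1 _.
  by rewrite ltNge; apply/negP => le_d; apply: hg; exists t1.
have pos p : projection p -> p <> 0 -> forall tau, tracial_state tau -> 0 < tr tau p.
  move=> pp p0 tau T; have [d d0 h] := tr_proj_lower_bound rr0 sA pp p0.
  exact: lt_le_trans d0 (h _ T).
have [m m576] : exists m, 576 <= (2 * m)%:R + 1 :> R.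
  by exists 288%N; rewrite natrM; lra.
(* The value of [m] has been forgotten; this [L] satisfies the three size conditions of the descent
   for every [m]. *)
pose L := (2 * m + 19)%N.
have L0 : (0 : R) < L%:R by rewrite ltr0n /L addnS.
have [e [pe e0 he]] := small _ (divr_gt0 ltr01 L0).
have [||u hu] := @slots_exist _ _ L e cmp pe.
- by rewrite /L addnS.
- by move=> tau T; have := he _ T; rewrite ltr_pdivlMr // mulrC.
have half p := trace_halving rr0 sA maxts small (p := p).
have [r [pr orth trr]] := orthogonal_sequence T0 pe e0 half pos.
have [|||N0 hN0] := corner_traceless_proj_comb rr0 cmp hu pe m576 _ _ _ pr orth trr.
- by rewrite /L; lia.
- by rewrite /L; lia.
- by rewrite /L; lia.
have [dn [h [C [ph C0 hC]]]] := trace_subtraction rr0 maxts.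
have r0 : r 0%N <> 0.
  move=> Z; have [tau T] := T0; have [h1 _] := trr 0%N tau T.
  by rewrite Z (tr0 T) ltxx in h1.
have [mm [N1 hN1]] := compress_to_corner rr0 sA (pr 0%N).1 r0.
(* [K] bounds [b] and [K2] bounds [b'], relative to |a|. The terms of [V] cover the coefficients of
   the three summands [s], [b - b'] and [b'] of [a]. *)
pose K := 1 + dn%:R * C; have K0 : 1 <= K by rewrite lerDl mulr_ge0.
pose K2 := mm%:R * K; have K20 : 0 <= K2 by rewrite mulr_ge0 //; lra.
pose V := C + 4 * K + 16 * (K2 + 1).
exists (dn * 1 + (N1 + N0))%N, V; split; first by rewrite /V; lra.
move=> a sa; have na0 := nrm_ge0 a.
have [beta [hbeta traceless]] := hC a sa.
set s := \sum_i _ in traceless; pose b := a - s.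
have ss : star s = s.
  rewrite star_sum; apply: eq_bigr => i _; rewrite starZr; congr (_ *: _).
  exact: (ph i).1.
have sb : star b = b by rewrite starB sa ss.
have nb : nrm b <= K * nrm a.
  apply: le_trans (nrmB _ _) _; rewrite /K mulrDl mul1r lerD2l.
  apply: le_trans (nrm_sum _ _ _) _.
  apply: le_trans (_ : \sum_(i < dn) C * nrm a <= _).
    apply: ler_sum => i _; rewrite nrmZr; apply: le_trans (hbeta i).
    by rewrite ler_piMr // nrm_proj.
  by rewrite sumr_const card_ord -[leLHS]mulr_natl mulrA.
have [b' [sb' rb' tb' nb' cb']] := hN1 b sb.
have aE : a = s + ((b - b') + b') by rewrite subrK /b; ncring.
rewrite [X in proj_comb _ _ X]aE.
apply: proj_combD.
  apply: proj_comb_sum_ord => i.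
  apply: (proj_comb_mono (leqnn _) _ (proj_combZ _ (proj_comb_proj (ph i)))).
  rewrite cabs_real mulr1; apply: le_trans (hbeta i) _; rewrite ler_wpM2r //.
  by rewrite /V; lra.
apply: proj_combD.
  apply: (proj_comb_mono (leqnn _) _ cb').
  apply: le_trans (_ : 4 * (K * nrm a) <= _); first by rewrite ler_pM2l.
  by rewrite mulrA ler_wpM2r // /V; lra.
have [a0|an0] := eqVneq (nrm a) 0.
  have b0 : nrm b <= 0 by rewrite a0 mulr0 in nb.
  have -> : b' = 0.
    apply: nrm_eq0; apply/eqP; rewrite eq_le nrm_ge0 andbT; apply: le_trans nb' _.
    by rewrite mulr_ge0_le0.
  exact: proj_comb0.
have ap : 0 < nrm a by rewrite lt_neqAle eq_sym an0.
(* Adding 1 keeps [l] positive even if [K2] vanishes, so that [b'] can be normalized. *)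
pose l := (K2 + 1) * nrm a; have l0 : 0 < l by rewrite mulr_gt0 //; lra.
have nbl : nrm b' <= l.
  apply: le_trans nb' _; apply: le_trans (_ : mm%:R * (K * nrm a) <= _).
    by rewrite ler_wpM2l.
  by rewrite mulrA -/K2 /l mulrDl mul1r lerDl.
have := hN0 (l^-1%:C *: b').
rewrite starZr sb' -scalerAr rb' => /(_ erefl erefl) hc.
have {hc} := hc _ _; rewrite nrmZr gtr0_norm ?invr_gt0 // mulrC ler_pdivrMr // mul1r.
have tz tau : tracial_state tau -> tr tau (l^-1%:C *: b') = 0.
  by move=> T; rewrite (trZ T) tb' // traceless // mulr0.
move=> /(_ tz nbl) /(proj_combZ l%:C).
rewrite scalerA -rmorphM /= mulfV ?gt_eqF // scale1r.
apply: proj_comb_mono => //; rewrite cabs_real gtr0_norm // /l /V; nra.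
Qed.

End Assembly.

(** * From self-adjoint to arbitrary elements *)

Unset Implicit Arguments.

Theorem theorem4p4 (R : realType) (A : cstarAlgType R)
    (A_simple : simple A) (A_separable : separable A)
    (A_rr0 : real_rank_zero A) (A_sr1 : stable_rank_one A)
    (A_comparison : strict_comparison A)
    (A_finite_extreme : finite_set (extreme_points (tracial_states A))) :
  linear_span [set p : A | projection p] = [set: A] /\
  exists (N : nat) (V0 : R), [/\ (1 <= N)%N, 0 < V0 &
    forall a : A, exists (n : nat) (alpha : 'I_n -> R[i]) (p : 'I_n -> A),
      [/\ (n <= N)%N,
          forall i, `|alpha i| <= V0%:C * `|a|,
          forall i, projection (p i) &
          a = \sum_(i < n) alpha i *: p i]].
Proof.
have [N [V [V0 hV]]] := selfadjoint_proj_comb A_simple A_separable A_rr0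
  A_comparison A_finite_extreme.
have main (a : A) : proj_comb (N + N) (V * nrm a) a.
  have [h [g [sh sg aE nh ng]]] := selfadjoint_parts a.
  rewrite [X in proj_comb _ _ X]aE; apply: proj_combD.
    by apply: (proj_comb_mono (leqnn _) _ (hV h sh)); rewrite ler_wpM2l.
  apply: (proj_comb_mono (leqnn _) _ (proj_combZ 'i%C (hV g sg))).
  by rewrite cabs_i mul1r ler_wpM2l.
have bound : exists (N : nat) (V0 : R), [/\ (1 <= N)%N, 0 < V0 &
    forall a : A, exists (n : nat) (alpha : 'I_n -> R[i]) (p : 'I_n -> A),
      [/\ (n <= N)%N,
          forall i, `|alpha i| <= V0%:C * `|a|,
          forall i, projection (p i) &
          a = \sum_(i < n) alpha i *: p i]].
  (* The successor and the summand 1 ensure that both constants are positive. *)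
  exists (N + N).+1, (V + 1); split=> //; first by rewrite ltr_wpDl.
  move=> a; have [s [sN hs aE]] := main a.
  exists (size s), (fun i => (nth (0, 0) s i).1), (fun i => (nth (0, 0) s i).2); split.
  - exact: leqW.
  - move=> i; have [le _] := hs _ (mem_nth (0, 0) (ltn_ord i)).
    rewrite cabsE nrmE -rmorphM lecR; apply: le_trans le _.
    by rewrite ler_wpM2r ?nrm_ge0 // lerDl.
  - by move=> i; have [] := hs _ (mem_nth (0, 0) (ltn_ord i)).
  by rewrite {1}aE (big_nth (0, 0)) big_mkord.
split => //; apply/seteqP; split => // a _.
have [_ [_ [_ _ /(_ a) [n [alpha [p [_ _ pp aE]]]]]]] := bound.
by exists n, alpha, p.
Qed.
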